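(* There are no quaternionic submersions between quaternionic Kähler manifolds which are not locally hyper-Kähler. That is, if $(M,\sigma,g)$ and $(N,\sigma',g')$ are quaternionic Kähler manifolds neither of which is locally hyper-Kähler, then there is no quaternionic submersion $\pi:(M,\sigma,g)\to(N,\sigma',g')$.
   Context: An almost quaternionic structure on a differentiable manifold $M$ is a rank 3 subbundle $\sigma$ of $\mathrm{End}(TM)$ that locally admits a basis of sections $\{J_1,J_2,J_3\}$ (a canonical local basis) with $J_\alpha^2=-\mathrm{Id}$ for $\alpha=1,2,3$ and $J_1J_2=-J_2J_1=J_3$. If $g$ is a Riemannian metric with $g(J_\alpha X,J_\alpha Y)=g(X,Y)$ for $\alpha=1,2,3$, all vector fields $X,Y$ and any canonical local basis, then $(M,\sigma,g)$ is an almost quaternionic hermitian manifold. It is a quaternionic Kähler manifold if $\sigma$ is parallel with respect to the Levi-Civita connection $\nabla$ of $g$; equivalently, for canonical local bases there are local 1-forms $\omega_1,\omega_2,\omega_3$ with $\nabla_XJ_1=\omega_3(X)J_2-\omega_2(X)J_3$, $\nabla_XJ_2=-\omega_3(X)J_1+\omega_1(X)J_3$, $\nabla_XJ_3=\omega_2(X)J_1-\omega_1(X)J_2$. A quaternionic Kähler manifold is locally hyper-Kähler if $\omega_1=\omega_2=\omega_3=0$, i.e. around every point there is a canonical local basis with $\nabla J_\alpha=0$ for $\alpha=1,2,3$. A map $f:M\to N$ between almost quaternionic hermitian manifolds $(M,\sigma,g)$, $(N,\sigma',g')$ is $(\sigma,\sigma')$-holomorphic if for every $x\in M$ and every $J\in\sigma_x$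 there exists $J'\in\sigma'_{f(x)}$ with $f_*\circ J=J'\circ f_*$. A quaternionic submersion is a Riemannian submersion which is a $(\sigma,\sigma')$-holomorphic map.
   Formalization: A Riemannian submersion is taken to have dim M > dim N (positive-dimensional fibres); with equal dimensions allowed, the identity map of HP^k, k ≥ 2, would be a counterexample. *)

(* Defs.v *)
From HB Require Import structures.
From mathcomp Require Import all_boot all_order all_algebra.
From mathcomp Require Import all_classical all_reals all_analysis.
Import Order.TTheory GRing.Theory Num.Theory numFieldNormedType.Exports.

Set Implicit Arguments.
Unset Strict Implicit.
Unset Printing Implicit Defensive.

Local Open Scope classical_set_scope.
Local Open Scope ring_scope.

(* Points of R^n, and tangent vectors read in a chart, are columns 'cV[R]_n, so
   that endomorphisms and differentials act as A *m v and a composition is the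
   matrix product taken in the same order. *)

Definition partial (R : realType) (n : nat) (W : normedModType R) (k : 'I_n)
    (f : 'cV[R]_n -> W) (x : 'cV[R]_n) : W :=
  'D_(delta_mx k 0 : 'cV[R]_n) f x.

(* Meant for an open set U: values of f outside U are then irrelevant. *)
Fixpoint Ck_on (R : realType) (n : nat) (W : normedModType R) (r : nat)
    (U : set 'cV[R]_n) (f : 'cV[R]_n -> W) : Prop :=
  (forall x, U x -> {for x, continuous f}) /\
  if r is r'.+1 then
    forall k : 'I_n,
      (forall x, U x -> derivable f x (delta_mx k 0 : 'cV[R]_n)) /\
      Ck_on r' U (partial k f)
  else True.

Definition smooth_on (R : realType) (n : nat) (W : normedModType R)
    (U : set 'cV[R]_n) (f : 'cV[R]_n -> W) : Prop :=
  forall r, Ck_on r U f.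

Definition jac (R : realType) (m n : nat) (f : 'cV[R]_m -> 'cV[R]_n)
    (x : 'cV[R]_m) : 'M[R]_(n, m) :=
  \matrix_(i < n, j < m) (partial j f x) i 0.

(* A differentiable (C^oo) manifold of dimension n, given by an atlas.  Charts
   are total functions, meaningful on their domains only. *)
Record manifold (R : realType) (n : nat) := Manifold {
  carrier :> topologicalType;
  chart_index : Type;
  cdom : chart_index -> set carrier;
  chart : chart_index -> carrier -> 'cV[R]_n;
  chart_inv : chart_index -> 'cV[R]_n -> carrier;
  manifold_hausdorff : hausdorff_space carrier;
  manifold_second_countable : @second_countable carrier;
  cdom_cover : forall p, exists i, cdom i p;
  cdom_open : forall i, open (cdom i);
  chart_open : forall i, open (chart i @` cdom i);
  chart_continuous : forall i p, cdom i p -> {for p, continuous (chart i)};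
  chartK : forall i p, cdom i p -> chart_inv i (chart i p) = p;
  chart_inv_continuous : forall i x, (chart i @` cdom i) x ->
    {for x, continuous (chart_inv i)};
  chart_transition : forall i j,
    smooth_on (chart i @` (cdom i `&` cdom j)) (chart j \o chart_inv i)
}.

(* Matrix of the change of chart T_pM -> T_pM from chart i to chart j. *)
Definition transition (R : realType) (n : nat) (M : manifold R n)
    (i j : chart_index M) (p : M) : 'M[R]_n :=
  jac (chart j \o chart_inv i) (chart i p).

(* Tensor fields with two indices are given by their components: A i p is the
   matrix in chart i of the value at p, meaningful when p lies in cdom i.  What
   kind of tensor A is (endomorphism or bilinear form) is decided by the
   transformation law imposed on it below. *)
Definition components (R : realType) (n : nat) (M : manifold R n) : Type :=
  chart_index M -> M -> 'M[R]_n.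

Definition smooth_components (R : realType) (n : nat) (M : manifold R n)
    (U : set M) (A : components M) : Prop :=
  forall i, smooth_on (chart i @` (cdom i `&` U)) (A i \o chart_inv i).

(* Smooth sections of End(TM) over the open set U. *)
Definition endo_field (R : realType) (n : nat) (M : manifold R n)
    (U : set M) (A : components M) : Prop :=
  (forall i j p, U p -> cdom i p -> cdom j p ->
     A j p *m transition i j p = transition i j p *m A i p) /\
  smooth_components U A.

(* The value at p of the bilinear form g, on vectors read in chart i. *)
Definition form (R : realType) (n : nat) (M : manifold R n) (g : components M)
    (i : chart_index M) (p : M) (u v : 'cV[R]_n) : R :=
  (u^T *m g i p *m v) 0 0.

Definition riemannian_metric (R : realType) (n : nat) (M : manifold R n)
    (g : components M) : Prop :=
  [/\ (forall i j p u v, cdom i p -> cdom j p ->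
         form g j p (transition i j p *m u) (transition i j p *m v)
         = form g i p u v),
      (forall i p u v, cdom i p -> form g i p u v = form g i p v u),
      (forall i p u, cdom i p -> u != 0 -> 0 < form g i p u u)
    & smooth_components [set: M] g].

(* Partial derivative in chart i of the components in chart i. *)
Definition dcomp (R : realType) (n : nat) (M : manifold R n)
    (A : components M) (i : chart_index M) (k : 'I_n) (p : M) : 'M[R]_n :=
  partial k (A i \o chart_inv i) (chart i p).

(* Levi-Civita connection in chart i: the (l, j) entry of christoffel g i k p
   is Gamma^l_{kj}
     = 1/2 sum_s g^{ls} (d_k g_{sj} + d_j g_{ks} - d_s g_{kj}). *)
Definition christoffel (R : realType) (n : nat) (M : manifold R n)
    (g : components M) (i : chart_index M) (k : 'I_n) (p : M) : 'M[R]_n :=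
  \matrix_(l < n, j < n)
    (2^-1 * \sum_(s < n) invmx (g i p) l s *
       (dcomp g i k p s j + dcomp g i j p k s - dcomp g i s p k j)).

(* nabla_u A at p for an endomorphism field A and u in T_pM, read in chart i:
   (nabla_k A) = d_k A + [Gamma_k, A]. *)
Definition nabla (R : realType) (n : nat) (M : manifold R n)
    (g : components M) (i : chart_index M) (p : M) (u : 'cV[R]_n)
    (A : components M) : 'M[R]_n :=
  \sum_(k < n) u k 0 *:
    (dcomp A i k p + christoffel g i k p *m A i p
                   - A i p *m christoffel g i k p).

(* A family of subspaces of the spaces End(T_pM), read in charts. *)
Definition endo_subspaces (R : realType) (n : nat) (M : manifold R n) : Type :=
  chart_index M -> M -> {vspace 'M[R]_n}.

Definition canonical_local_basis (R : realType) (n : nat) (M : manifold R n)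
    (sigma : endo_subspaces M) (U : set M) (J1 J2 J3 : components M) : Prop :=
  [/\ open U,
      [/\ endo_field U J1, endo_field U J2 & endo_field U J3],
      (forall i p, U p -> cdom i p ->
         basis_of (sigma i p) [:: J1 i p; J2 i p; J3 i p])
    & (forall i p, U p -> cdom i p ->
         [/\ J1 i p *m J1 i p = - 1%:M,
             J2 i p *m J2 i p = - 1%:M,
             J3 i p *m J3 i p = - 1%:M,
             J1 i p *m J2 i p = J3 i p
           & - (J2 i p *m J1 i p) = J3 i p])].

(* The independence of sigma from the charts and its smoothness follow from the
   existence of local bases made of smooth endomorphism fields; rank 3 is part
   of basis_of. *)
Definition almost_quaternionic (R : realType) (n : nat) (M : manifold R n)
    (sigma : endo_subspaces M) : Prop :=
  forall p : M, exists (U : set M) (J1 J2 J3 : components M),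
    U p /\ canonical_local_basis sigma U J1 J2 J3.

Definition preserves_metric (R : realType) (n : nat) (M : manifold R n)
    (g : components M) (U : set M) (J : components M) : Prop :=
  forall i p u v, U p -> cdom i p ->
    form g i p (J i p *m u) (J i p *m v) = form g i p u v.

Definition almost_quaternionic_hermitian (R : realType) (n : nat)
    (M : manifold R n) (sigma : endo_subspaces M) (g : components M) : Prop :=
  [/\ almost_quaternionic sigma,
      riemannian_metric g
    & forall U J1 J2 J3, canonical_local_basis sigma U J1 J2 J3 ->
        [/\ preserves_metric g U J1, preserves_metric g U J2
          & preserves_metric g U J3]].

(* nabla maps local sections of sigma to sections of sigma. *)
Definition parallel_subbundle (R : realType) (n : nat) (M : manifold R n)
    (sigma : endo_subspaces M) (g : components M) : Prop :=
  forall (U : set M) (A : components M), open U -> endo_field U A ->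
    (forall i p, U p -> cdom i p -> A i p \in sigma i p) ->
    forall i p u, U p -> cdom i p -> nabla g i p u A \in sigma i p.

Definition quaternionic_kahler (R : realType) (n : nat) (M : manifold R n)
    (sigma : endo_subspaces M) (g : components M) : Prop :=
  almost_quaternionic_hermitian sigma g /\ parallel_subbundle sigma g.

Definition parallel_on (R : realType) (n : nat) (M : manifold R n)
    (g : components M) (U : set M) (A : components M) : Prop :=
  forall i p u, U p -> cdom i p -> nabla g i p u A = 0.

(* Used for quaternionic Kaehler (M, sigma, g). *)
Definition locally_hyperkahler (R : realType) (n : nat) (M : manifold R n)
    (sigma : endo_subspaces M) (g : components M) : Prop :=
  forall p : M, exists (U : set M) (J1 J2 J3 : components M),
    [/\ U p, canonical_local_basis sigma U J1 J2 J3,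
        parallel_on g U J1, parallel_on g U J2 & parallel_on g U J3].

Definition smooth_map (R : realType) (m n : nat) (M : manifold R m)
    (N : manifold R n) (f : M -> N) : Prop :=
  continuous f /\
  forall i j, smooth_on (chart i @` (cdom i `&` f @^-1` cdom j))
                        (chart j \o f \o chart_inv i).

(* f_* at p, from T_pM read in chart i to T_{f p}N read in chart j. *)
Definition differential (R : realType) (m n : nat) (M : manifold R m)
    (N : manifold R n) (f : M -> N) (i : chart_index M) (j : chart_index N)
    (p : M) : 'M[R]_(n, m) :=
  jac (chart j \o f \o chart_inv i) (chart i p).

Definition horizontal (R : realType) (m n : nat) (M : manifold R m)
    (N : manifold R n) (g : components M) (f : M -> N)
    (i : chart_index M) (j : chart_index N) (p : M) (u : 'cV[R]_m) : Prop :=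
  forall v : 'cV[R]_m, differential f i j p *m v = 0 -> form g i p u v = 0.

(* As usual for Riemannian submersions, the fibres have positive dimension:
   dim M > dim N.  (For dim M = dim N these are the local isometries, such as
   the identity of any quaternionic Kaehler manifold.)  Surjectivity of f is not
   required. *)
Definition riemannian_submersion (R : realType) (m n : nat) (M : manifold R m)
    (N : manifold R n) (g : components M) (g' : components N) (f : M -> N)
    : Prop :=
  [/\ (n < m)%N,
      smooth_map f,
      (forall i j p, cdom i p -> cdom j (f p) -> \rank (differential f i j p) = n)
    & (forall i j p u v, cdom i p -> cdom j (f p) ->
         horizontal g f i j p u -> horizontal g f i j p v ->
         form g' j (f p) (differential f i j p *m u) (differential f i j p *m v)
         = form g i p u v)].

Definition holomorphic_map (R : realType) (m n : nat) (M : manifold R m)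
    (N : manifold R n) (sigma : endo_subspaces M) (sigma' : endo_subspaces N)
    (f : M -> N) : Prop :=
  forall i j p, cdom i p -> cdom j (f p) ->
  forall J, J \in sigma i p ->
  exists2 J', J' \in sigma' j (f p) &
    differential f i j p *m J = J' *m differential f i j p.

Definition quaternionic_submersion (R : realType) (m n : nat)
    (M : manifold R m) (N : manifold R n)
    (sigma : endo_subspaces M) (g : components M)
    (sigma' : endo_subspaces N) (g' : components N) (f : M -> N) : Prop :=
  riemannian_submersion g g' f /\ holomorphic_map sigma sigma' f.

(* Main.v *)
(* Near p let P be the g-orthogonal projector of TM onto ker(d pi). Holomorphy makes
   ker(d pi) stable under the J_a and their skewness makes its complement stable too, so
   P commutes with sigma. The O'Neill tensors of pi are the two halves of nabla P; since
   nabla_X J_a lies in sigma, nabla P commutes with sigma as well. A bilinear map which is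
   (skew-)symmetric and linear for two anticommuting complex structures vanishes, so
   nabla P = 0 and M is locally a Riemannian product. The factors are nonzero, as
   0 < n < m. The curvature R of M then preserves the splitting and vanishes on mixed
   arguments, so the curvature F(u, v) of sigma, defined by
   [R(u, v), J_a] = sum_c F(u, v)_ca J_c, is zero for vertical arguments when tested on
   horizontal vectors, and conversely. Hence sigma is flat; a parallel frame is obtained by
   Picard iteration along the rays of a chart ball, so M is locally hyper-Kaehler. *)
From HB Require Import structures.
Require Import Defs.
From mathcomp Require Import all_boot all_order all_algebra.
From mathcomp Require Import all_classical all_reals all_analysis.
From mathcomp Require Import ring lra.
Import Order.TTheory GRing.Theory Num.Theory numFieldNormedType.Exports.

Set Implicit Arguments.
Unset Strict Implicit.
Unset Printing Implicit Defensive.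

Local Open Scope classical_set_scope.
Local Open Scope ring_scope.

(** * Calculus on coordinate space *)

(** No splitting theorem is invoked: in a chart the proof differentiates the closed formula P = 1 -
    S G' D, where D is the Jacobian of pi, S = G^-1 D^T and G' is the metric of N at the image.
    Smoothness of P and the properties of nabla P are then matrix identities. The symmetries of
    nabla P have two sources. On vertical arguments D (nabla P) is minus the Hessian of the
    coordinates of pi, which is symmetric; on horizontal arguments nabla P is skew because D S =
    G'^-1 is constant along the fibres. One test vector can decide whether a component of F
    vanishes, because every nonzero real combination of the J_a is invertible. Solving for a
    parallel frame needs an integrability argument: transport along rays controls the radial
    direction alone, so the iterates come with bounds on their covariant derivatives in all
    directions, and flatness is what makes these tend to zero. The resulting change of frame is
    orthogonal because the connection matrices are skew, hence it preserves the quaternion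
    relations. *)

Section lines.
Variables (R : realType) (m : nat).
Local Notation E := 'cV[R]_m.
Local Notation e_ k := (delta_mx k 0 : E).

(** Both difference quotients are the same function of the increment, so derivability of [f] in the
    one direction [v] suffices. *)
Lemma is_derive_line (W : normedModType R) (f : E -> W) (x v : E) (s : R) :
  derivable f (x + s *: v) v ->
  is_derive s 1 (fun u : R => f (x + u *: v)) ('D_v f (x + s *: v)).
Proof.
have eqf : (fun h : R => h^-1 *: (((fun u : R => f (x + u *: v)) \o shift s) (h *: 1)
     - f (x + s *: v)))
   = (fun h : R => h^-1 *: ((f \o shift (x + s *: v)) (h *: v) - f (x + s *: v))).
  apply/funext => h /=; congr (_ *: (f _ - _)).
  by rewrite scaler1 scalerDl addrCA.
move=> df; apply: DeriveDef; first by rewrite /derivable eqf.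
by rewrite /derive eqf.
Qed.

(** The intermediate point is written [t * a] with [t] in the unit interval so that [a] may have
    either sign; each sign is the mean value theorem on an ordered segment. *)
Lemma line_mvt (f : E -> R) (x v : E) (a : R) :
  (forall t : R, 0 <= t <= 1 -> derivable f (x + (t * a) *: v) v) ->
  exists2 t : R, 0 <= t <= 1 &
    f (x + a *: v) - f x = a * 'D_v f (x + (t * a) *: v).
Proof.
move=> df; pose g := fun u : R => f (x + u *: v).
have dg (s t : R) : s = t * a -> 0 <= t <= 1 ->
    is_derive s 1 g ('D_v f (x + s *: v)).
  by move=> -> /df; exact: is_derive_line.
have [a0|a0|a0] := ltgtP a 0.
- have tP (s : R) : a <= s -> s <= 0 -> s = s / a * a /\ 0 <= s / a <= 1.
    move=> as_ s0; rewrite divfK ?lt_eqF//; split => //.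
    by rewrite ler_ndivrMr// mul1r as_ andbT ler_ndivlMr// mul0r.
  have := @MVT_segment _ g (fun s => 'D_v f (x + s *: v)) a 0 (ltW a0).
  case.
  + move=> s /[!in_itv]/= /andP[/ltW as_ /ltW s0].
    by have [+ +] := tP _ as_ s0; exact: dg.
  + apply: derivable_within_continuous => s /[!in_itv]/= /andP[as_ s0].
    by have [sE sI] := tP _ as_ s0; case: (dg _ _ sE sI).
  + move=> s /[!in_itv]/= /andP[as_ s0] H.
    have [sE sI] := tP _ as_ s0; exists (s / a) => //; rewrite -sE.
    move: H; rewrite /g scale0r addr0 sub0r mulrN => /(congr1 -%R).
    by rewrite opprB opprK mulrC.
- have tP (s : R) : 0 <= s -> s <= a -> s = s / a * a /\ 0 <= s / a <= 1.
    move=> s0 as_; rewrite divfK ?gt_eqF//; split => //.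
    by rewrite ler_pdivrMr// mul1r as_ andbT ler_pdivlMr// mul0r.
  have := @MVT_segment _ g (fun s => 'D_v f (x + s *: v)) 0 a (ltW a0).
  case.
  + move=> s /[!in_itv]/= /andP[/ltW as_ /ltW s0].
    by have [+ +] := tP _ as_ s0; exact: dg.
  + apply: derivable_within_continuous => s /[!in_itv]/= /andP[as_ s0].
    by have [sE sI] := tP _ as_ s0; case: (dg _ _ sE sI).
  + move=> s /[!in_itv]/= /andP[as_ s0] H.
    have [sE sI] := tP _ as_ s0; exists (s / a) => //; rewrite -sE.
    by move: H; rewrite /g scale0r addr0 subr0 mulrC.
- exists 0; first by rewrite lexx ler01.
  by rewrite a0 scale0r addr0 subrr mul0r.
Qed.

(** The norm is the maximum norm, so balls are cubes: mixing coordinates of two of their points does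
    not leave them. *)
Lemma ball_cvP (c : E) (r : R) (x : E) :
  0 < r -> ball c r x <-> forall i, `|c i 0 - x i 0| < r.
Proof.
move=> r0; split.
  by move=> + i => -[_ /(_ i 0)].
by move=> h; split=> // i j; rewrite (ord1 j); exact: h.
Qed.

(* Move from x to y one coordinate at a time. *)
Lemma ball_lipschitz (f : E -> R) (c : E) (r C : R) (x y : E) :
  (forall z k, ball c r z -> derivable f z (e_ k) /\ `|partial k f z| <= C) ->
  ball c r x -> ball c r y ->
  `|f y - f x| <= C * \sum_k `|y k 0 - x k 0|.
Proof.
move=> df cx cy.
have r0 : 0 < r by case: cx.
pose z n : E := \col_i (if (i < n)%N then y i 0 else x i 0).
have z0 : z 0 = x by apply/colP => i; rewrite mxE.
have zm : z m = y by apply/colP => i; rewrite mxE ltn_ord.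
have tele : f y - f x = \sum_(k < m) (f (z k.+1) - f (z k)).
  by rewrite -z0 -zm -(telescope_sumr (f \o z) (leq0n m)) big_mkord.
rewrite tele (le_trans (ler_norm_sum _ _ _))// mulr_sumr ler_sum// => k _.
have zS : z k.+1 = z k + (y k 0 - x k 0) *: e_ k.
  apply/colP => i; rewrite !mxE eqxx andbT ltnS leq_eqVlt.
  have [->|ik] := eqVneq i k; first by rewrite eqxx ltnn mulr1 addrC subrK.
  by rewrite (negPf ik : (i == k :> nat) = false)/= mulr0 addr0.
have inb (t : R) : 0 <= t <= 1 -> ball c r (z k + (t * (y k 0 - x k 0)) *: e_ k).
  move=> /andP[t0 t1]; apply/ball_cvP => // i.
  move/ball_cvP : cx => /(_ r0 i); move/ball_cvP : cy => /(_ r0 i).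
  rewrite !mxE eqxx andbT; have [->|ik] := eqVneq i k.
    rewrite ltnn mulr1 !ltr_norml => /andP[h1 h2] /andP[h3 h4].
    have [xy|/ltW yx] := lerP (x k 0) (y k 0).
      have t1' : t * (y k 0 - x k 0) <= 1 * (y k 0 - x k 0).
        by rewrite ler_wpM2r// subr_ge0.
      have t0' : 0 <= t * (y k 0 - x k 0) by rewrite mulr_ge0// subr_ge0.
      by apply/andP; split; lra.
    have t1' : t * (x k 0 - y k 0) <= 1 * (x k 0 - y k 0).
      by rewrite ler_wpM2r// subr_ge0.
    have t0' : 0 <= t * (x k 0 - y k 0) by rewrite mulr_ge0// subr_ge0.
    by apply/andP; split; lra.
  by case: ifP; rewrite mulr0 addr0.
have [t t01] := line_mvt (fun t ht => (df _ k (inb t ht)).1).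
rewrite -zS => ->; rewrite normrM mulrC ler_wpM2r//.
exact: (df _ k (inb t t01)).2.
Qed.

End lines.

(** * Differentiability from continuous partial derivatives, and the chain rule *)

Section frechet.
Variables (R : realType) (m : nat).
Local Notation E := 'cV[R]_m.
Local Notation e_ k := (delta_mx k 0 : E).

Lemma cv_sum_delta (v : E) : v = \sum_k v k 0 *: e_ k.
Proof.
rewrite [LHS]matrix_sum_delta; apply: eq_bigr => i _.
by rewrite big_ord1.
Qed.

Lemma derive_partial (W : normedModType R) (f : E -> W) (x v : E) :
  differentiable f x -> 'D_v f x = \sum_k v k 0 *: partial k f x.
Proof.
move=> df; rewrite deriveE// [in LHS](cv_sum_delta v) linear_sum.
by apply: eq_bigr => k _; rewrite linearZ /= /partial deriveE.
Qed.

Definition row_form (a : 'I_m -> R) (h : E) : R := \sum_k a k * h k 0.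

Lemma row_form_linear a : linear (row_form a).
Proof.
move=> c u v; rewrite /row_form scaler_sumr -big_split/=; apply: eq_bigr => k _.
by rewrite !mxE mulrDr mulrCA.
Qed.

Lemma row_form_continuous a : continuous (row_form a).
Proof.
move=> x; rewrite /row_form; apply: (cvg_big add_continuous (F := nbhs x)) => k _.
by apply: cvgM; [exact: cvg_cst|exact: coord_continuous].
Qed.

Lemma mx_normr_entry (p q : nat) (A : 'M[R]_(p, q)) i j : `|A i j| <= `|A|.
Proof.
rewrite [leRHS]/Num.Def.normr/= mx_normrE.
exact: (le_bigmax _ (fun ij => `|A ij.1 ij.2|) (i, j)).
Qed.

(** Subtracting the linear candidate [L] leaves a function with small partials near [x], and
    [ball_lipschitz] turns this into the little-o estimate. *)
Lemma differentiable_C1 (O : set E) (f : E -> R) (x : E) :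
  open O -> O x ->
  (forall z k, O z -> derivable f z (e_ k)) ->
  (forall k, {for x, continuous (partial k f)}) ->
  differentiable f x.
Proof.
move=> oO Ox df cf.
pose a k := partial k f x.
pose L : {linear E -> R} :=
  HB.pack (row_form a) (GRing.isLinear.Build _ _ _ _ _ (row_form_linear a)).
have cL : continuous L by exact: row_form_continuous.
have dL (z : E) : differentiable L z by exact: linear_differentiable.
have LE k (z : E) : 'D_(e_ k) L z = a k.
  rewrite deriveE// diff_lin//= /row_form (bigD1 k)//= mxE !eqxx mulr1 big1 ?addr0//.
  by move=> i ik; rewrite mxE (negPf ik) mulr0.
have key : (f : E -> R^o) \o shift x =
    cst (f x : R^o) + (L : E -> R^o) +o_ (0 : E) id.
  apply/eqaddoP => e e0.
  (* The Lipschitz bound sums [m] coordinates, each at most the norm of [h]; [m.+1] also covers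
     [m = 0]. *)
  pose C := e / m.+1%:R.
  have C0 : 0 < C by rewrite divr_gt0.
  have [r r0 rP] : exists2 r : R, 0 < r & forall z, ball x r z -> O z /\
      forall k, `|partial k f z - a k| <= C.
    have : \forall z \near x, O z /\ forall k, `|partial k f z - a k| <= C.
      near=> z; split; first by near: z; exact: open_nbhs_nbhs.
      near: z; apply: filter_forall => k.
      have /cvgrPdist_le/(_ _ C0) := cf k.
      by apply: filterS => z; rewrite distrC.
    by move=> /nbhs_ballP[r r0 rP]; exists r.
  pose g := f - (L : E -> R).
  have dg z k : ball x r z -> derivable g z (e_ k) /\ `|partial k g z| <= C.
    move=> /rP[Oz Cz]; split.
      by apply: derivableB; [exact: df|exact: diff_derivable].
    rewrite /partial deriveB; [|exact: df|exact: diff_derivable].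
    by rewrite LE; exact: Cz.
  near=> h.
  have hx : ball x r (h + x).
    rewrite -ball_normE/= opprD addrCA subrr addr0 normrN.
    by near: h; exact: (@nbhs0_lt R E r r0).
  have := ball_lipschitz dg (ballxx _ r0) hx.
  have -> : (f \o shift x - (cst (f x) + (L : E -> R))) h = g (h + x) - g x.
    have LD : row_form a (h + x) = row_form a h + row_form a x.
      exact: (linearD L).
    by rewrite /g !fctE /= LD; ring.
  move=> /le_trans; apply.
  rewrite /C mulrAC ler_pdivrMr// -mulrA ler_wpM2l ?(ltW e0)//.
  apply: (@le_trans _ _ (\sum_(k < m) `|h|)).
    by apply: ler_sum => k _; rewrite mxE addrK mx_normr_entry.
  rewrite sumr_const card_ord mulr_natr.
  by rewrite [leRHS]mulrSr lerDl normr_ge0.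
apply/diff_locallyP; rewrite (diff_unique cL key); split => //.
Unshelve. all: by end_near. Qed.

Lemma derive_line0 (V W : normedModType R) (f : V -> W) (x v : V) :
  'D_1 (fun h : R => f (h *: v + x)) 0 = 'D_v f x.
Proof.
have eqf : (fun h : R => h^-1 *: (((fun u : R => f (u *: v + x)) \o shift 0) (h *: 1)
     - f (0 *: v + x)))
   = (fun h : R => h^-1 *: ((f \o shift x) (h *: v) - f x)).
  by apply/funext => h /=; rewrite addr0 scaler1 scale0r add0r.
by rewrite /derive eqf.
Qed.

(* The chain rule along a line only needs g to be derivable in one direction. *)
Lemma is_derive_chain (V : normedModType R) (W : normedModType R)
    (f : E -> W) (g : V -> E) (x v : V) :
  derivable g x v -> differentiable f (g x) ->
  is_derive x v (f \o g) ('D_('D_v g x) f (g x)).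
Proof.
move=> dg df.
pose l (h : R) := g (h *: v + x).
have l0 : l 0 = g x by rewrite /l scale0r add0r.
have dl : differentiable l 0 by exact/derivable1_diffP/(derivable1P g x v).1.
have dfl : differentiable f (l 0) by rewrite l0.
have dc : differentiable (f \o l) 0 by exact: differentiable_comp.
have lE : 'D_v g x = 'D_1 l 0.
  by rewrite /l derive_line0.
apply: DeriveDef.
  by apply/derivable1P/derivable1_diffP.
transitivity ('D_1 (f \o l) 0).
  by rewrite -(derive_line0 (f \o g)).
by rewrite deriveE// diff_comp//= lE -[in RHS]l0 deriveE// [in RHS]deriveE.
Qed.

End frechet.

(** * Symmetry of second partial derivatives *)

Section schwarz.
Variables (R : realType) (m : nat).
Local Notation E := 'cV[R]_m.
Local Notation e_ k := (delta_mx k 0 : E).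

Lemma is_derive_shift_arg (W : normedModType R) (f : E -> W) (a x v : E) :
  derivable f (x + a) v -> is_derive x v (fun z => f (z + a)) ('D_v f (x + a)).
Proof.
have eqf : (fun h : R => h^-1 *: (((fun z => f (z + a)) \o shift x) (h *: v)
     - f (x + a)))
   = (fun h : R => h^-1 *: ((f \o shift (x + a)) (h *: v) - f (x + a))).
  by apply/funext => h /=; rewrite addrA.
move=> df; apply: DeriveDef; first by rewrite /derivable eqf.
by rewrite /derive eqf.
Qed.

Lemma norm_delta (k : 'I_m) : `|e_ k| <= 1 :> R.
Proof.
rewrite [leLHS]/Num.Def.normr/= mx_normrE; apply: bigmax_le => // -[i j] _ /=.
by rewrite mxE; case: (_ && _); rewrite ?normr1 ?normr0.
Qed.

(** Two mean value theorems: along [e_ j] for [phi], then along [e_ k] for [partial j f]. The point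
    found is at distance at most [s + s]; the third [s] makes the inequality strict. *)
Lemma second_difference (f : E -> R) (x : E) (r s : R) (j k : 'I_m) :
  0 < s -> s + s < r ->
  (forall z, ball x r z -> derivable f z (e_ j)) ->
  (forall z, ball x r z -> derivable (partial j f) z (e_ k)) ->
  exists2 z, ball x (s + s + s) z &
    f (x + s *: e_ j + s *: e_ k) - f (x + s *: e_ j) - (f (x + s *: e_ k) - f x)
    = s * (s * partial k (partial j f) z).
Proof.
move=> s0 sr df ddf.
have nrm (t t' : R) : 0 <= t <= 1 -> 0 <= t' <= 1 ->
    `|(t * s) *: e_ j + (t' * s) *: e_ k| <= s + s.
  have le (u : R) l : 0 <= u <= 1 -> `|(u * s) *: e_ l| <= s.
    move=> /andP[u0 u1]; have s0' := ltW s0.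
    rewrite normrZ ger0_norm ?mulr_ge0// -[leRHS]mulr1.
    by rewrite ler_pM ?norm_delta ?mulr_ge0 ?ler_piMl.
  by move=> ht ht'; rewrite (le_trans (ler_normD _ _))// lerD ?le.
have inb (t t' : R) q : s + s < q -> 0 <= t <= 1 -> 0 <= t' <= 1 ->
    ball x q (x + (t * s) *: e_ j + (t' * s) *: e_ k).
  move=> sq ht ht'; rewrite -ball_normE/= -addrA opprD addrA subrr sub0r normrN.
  exact: le_lt_trans (nrm _ _ ht ht') sq.
have i0 : 0 <= (0 : R) <= 1 by rewrite lexx ler01.
have i1 : 0 <= (1 : R) <= 1 by rewrite lexx ler01.
pose phi z := f (z + s *: e_ k) - f z.
have dphi (t : R) : 0 <= t <= 1 -> is_derive (x + (t * s) *: e_ j) (e_ j) phi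
   (partial j f (x + (t * s) *: e_ j + s *: e_ k)
     - partial j f (x + (t * s) *: e_ j)).
  move=> ht; have h1 := df _ (inb t 1 r sr ht i1).
  have h2 := df _ (inb t 0 r sr ht i0).
  rewrite mul1r in h1; rewrite mul0r scale0r addr0 in h2.
  apply: is_deriveB; first exact: is_derive_shift_arg.
  exact: derivableP.
have [t ht H1] := line_mvt (fun t ht => @ex_derive _ _ _ _ _ _ _ (dphi t ht)).
have [t' ht' H2] : exists2 t' : R, 0 <= t' <= 1 &
   partial j f (x + (t * s) *: e_ j + s *: e_ k)
     - partial j f (x + (t * s) *: e_ j)
   = s * 'D_(e_ k) (partial j f) (x + (t * s) *: e_ j + (t' * s) *: e_ k).
  by apply: line_mvt => t' ht'; apply: ddf; exact: inb.
exists (x + (t * s) *: e_ j + (t' * s) *: e_ k).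
  by apply: inb => //; rewrite ltrDl.
rewrite -[LHS]/(phi (x + s *: e_ j) - phi x) H1.
by rewrite (@derive_val _ _ _ _ _ _ _ (dphi t ht)) H2.
Qed.

Lemma close_sub (a b c e : R) :
  `|a - c| <= e / 2 -> `|b - c| <= e / 2 -> `|a - b| <= e.
Proof.
move=> ac bc; have -> : a - b = (a - c) - (b - c) by ring.
by rewrite (le_trans (ler_normB _ _))// [leRHS](splitr e) lerD.
Qed.

(** The second difference is symmetric in [j] and [k], so the two mixed partials agree at two points
    [z] and [w] arbitrarily close to [x]; continuity brings both back to [x]. *)
Lemma partial_comm (O : set E) (f : E -> R) (x : E) (j k : 'I_m) :
  open O -> O x ->
  (forall z l, O z -> derivable f z (e_ l)) ->
  (forall z l l', O z -> derivable (partial l f) z (e_ l')) ->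
  (forall l l', {for x, continuous (partial l' (partial l f))}) ->
  partial j (partial k f) x = partial k (partial j f) x.
Proof.
move=> oO Ox df ddf cf; apply/eqP; rewrite -subr_eq0 -normr_le0.
apply/ler_addgt0Pl => e e0; rewrite addr0.
have e20 : 0 < e / 2 by rewrite divr_gt0.
have [r r0 rP] : exists2 r : R, 0 < r & forall z, ball x r z -> [/\ O z,
   `|partial j (partial k f) x - partial j (partial k f) z| <= e / 2 &
   `|partial k (partial j f) x - partial k (partial j f) z| <= e / 2].
  have /nbhs_ballP[r r0 rP] : \forall z \near x, [/\ O z,
     `|partial j (partial k f) x - partial j (partial k f) z| <= e / 2 &
     `|partial k (partial j f) x - partial k (partial j f) z| <= e / 2].
    have /cvgrPdist_le/(_ _ e20) h1 := cf k j.
    have /cvgrPdist_le/(_ _ e20) h2 := cf j k.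
    have hO : \forall z \near x, O z by exact: open_nbhs_nbhs.
    by apply: filterS3 h1 h2 hO => z h1z h2z Oz; exact: And3 Oz h1z h2z.
  by exists r.
have inO z : ball x r z -> O z by case/rP.
pose s := r / 4.
have s0 : 0 < s by rewrite divr_gt0.
have sr : s + s < r by rewrite /s; lra.
have sr3 : s + s + s <= r by rewrite /s; lra.
have [z zb zE] := second_difference s0 sr (fun z h => df z j (inO _ h)) (fun z h => ddf z j k
    (inO _ h)).
have [w wb wE] := second_difference s0 sr (fun z h => df z k (inO _ h)) (fun z h => ddf z k j
    (inO _ h)).
have zw : partial k (partial j f) z = partial j (partial k f) w.
  have : s * (s * partial k (partial j f) z) = s * (s * partial j (partial k f) w).
    have swap (a b c d : R) : a - b - (c - d) = a - c - (b - d) by ring.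
    rewrite (addrAC x (s *: e_ k)) swap in wE.
    exact: etrans (esym zE) wE.
  by move=> /(mulfI (lt0r_neq0 s0)) /(mulfI (lt0r_neq0 s0)).
have inr z' : ball x (s + s + s) z' -> ball x r z' by exact: le_ball.
have [_ _ hz] := rP z (inr _ zb).
have [_ hw _] := rP w (inr _ wb).
rewrite zw in hz.
exact: close_sub hw hz.
Qed.

End schwarz.

(** * Closure properties of functions of class C^r *)

Section Ck.
Variables (R : realType) (m : nat).
Local Notation E := 'cV[R]_m.
Local Notation e_ k := (delta_mx k 0 : E).
Implicit Types (U : set E) (r : nat).

Section anycodomain.
Variable W : normedModType R.
Implicit Types f g : E -> W.

Lemma near_open U (P : E -> Prop) x : open U -> U x -> (forall z, U z -> P z) ->
  \forall z \near x, P z.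
Proof.
by move=> oU Ux h; apply: filterS h _; exact: open_nbhs_nbhs.
Qed.

Lemma partial_eq_on U f g k x : open U -> U x -> (forall z, U z -> f z = g z) ->
  partial k f x = partial k g x.
Proof. by move=> oU Ux fg; apply: near_eq_derive; exact: (near_open oU Ux fg). Qed.

Lemma continuous_eq_on U f g x : open U -> U x -> (forall z, U z -> f z = g z) ->
  {for x, continuous f} -> {for x, continuous g}.
Proof.
move=> oU Ux fg; rewrite /prop_for /continuous_at -(fg _ Ux); apply: cvg_trans.
apply: near_eq_cvg; first exact: (nbhs_filter x).
by apply: near_open oU Ux _ => z Uz; rewrite fg.
Qed.

(** [Ck_on] speaks of total functions; agreement on [U] passes to all derivatives because [U] is
    open and a derivative depends only on the germ. *)
Lemma Ck_on_eq r U f g : open U -> (forall x, U x -> f x = g x) ->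
  Ck_on r U f -> Ck_on r U g.
Proof.
move=> oU; elim: r f g => [|r IH] f g fg /= [cf df]; split.
- by move=> x Ux; exact: (continuous_eq_on oU Ux fg (cf x Ux)).
- by [].
- by move=> x Ux; exact: (continuous_eq_on oU Ux fg (cf x Ux)).
- move=> k; have [dfk Hk] := df k; split.
    by move=> x Ux; apply: near_eq_derivable (dfk x Ux); exact: (near_open oU Ux fg).
  by apply: IH Hk => x Ux; exact: partial_eq_on fg.
Qed.

Lemma Ck_on_sub r U V f : V `<=` U -> Ck_on r U f -> Ck_on r V f.
Proof.
move=> VU; elim: r f => [|r IH] f /= [cf df]; split=> //.
- by move=> x /VU; exact: cf.
- by move=> x /VU; exact: cf.
- move=> k; have [dfk Hk] := df k; split; last exact: IH.
  by move=> x /VU; exact: dfk.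
Qed.

Lemma Ck_onS r U f : Ck_on r.+1 U f -> Ck_on r U f.
Proof.
elim: r f => [|r IH] f; first by case.
move=> [cf df]; split=> // k; have [dfk Hk] := df k; split=> //.
exact: IH.
Qed.

Lemma Ck_on_cst r U (w : W) : open U -> Ck_on r U (fun=> w).
Proof.
move=> oU; elim: r w => [|r IH] w /=; split=> //.
- by move=> x _; exact: cst_continuous.
- by move=> x _; exact: cst_continuous.
- move=> k; split; first by move=> x _; exact: derivable_cst.
  by apply: Ck_on_eq (IH 0) => // x _; rewrite /partial derive_cst.
Qed.

Lemma Ck_onD r U f g : open U -> Ck_on r U f -> Ck_on r U g ->
  Ck_on r U (fun x => f x + g x).
Proof.
move=> oU; elim: r f g => [|r IH] f g /= [cf df] [cg dg]; split=> //.
- by move=> x Ux; exact: continuousD (cf x Ux) (cg x Ux).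
- by move=> x Ux; exact: continuousD (cf x Ux) (cg x Ux).
- move=> k; have [dfk Hk] := df k; have [dgk Gk] := dg k; split.
    by move=> x Ux; exact: derivableD (dfk x Ux) (dgk x Ux).
  apply: Ck_on_eq (IH _ _ Hk Gk) => // x Ux.
  by rewrite /partial -deriveD//; [exact: dfk|exact: dgk].
Qed.

End anycodomain.

Section scalar.
Implicit Types f g : E -> R.

Lemma Ck_onM r U f g : open U -> Ck_on r U f -> Ck_on r U g ->
  Ck_on r U (fun x => f x * g x).
Proof.
move=> oU; elim: r f g => [|r IH] f g /= [cf df] [cg dg]; split=> //.
- by move=> x Ux; exact: continuousM (cf x Ux) (cg x Ux).
- by move=> x Ux; exact: continuousM (cf x Ux) (cg x Ux).
- move=> k; have [dfk Hk] := df k; have [dgk Gk] := dg k; split.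
    by move=> x Ux; exact: derivableM (dfk x Ux) (dgk x Ux).
  have Cf : Ck_on r U f by apply: Ck_onS.
  have Cg : Ck_on r U g by apply: Ck_onS.
  apply: Ck_on_eq (Ck_onD oU (IH _ _ Cf Gk) (IH _ _ Cg Hk)) => // x Ux.
  by rewrite /partial -deriveM//; [exact: dfk|exact: dgk].
Qed.

Lemma Ck_onN r U f : open U -> Ck_on r U f -> Ck_on r U (fun x => - f x).
Proof.
move=> oU cf; apply: Ck_on_eq (Ck_onM oU (Ck_on_cst r (-1 : R) oU) cf) => // x _.
by rewrite mulN1r.
Qed.

Lemma Ck_on_sum r U (I : Type) (s : seq I) (F : I -> E -> R) : open U ->
  (forall i, Ck_on r U (F i)) -> Ck_on r U (fun x => \sum_(i <- s) F i x).
Proof.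
move=> oU cF; elim: s => [|i s IH].
  by apply: Ck_on_eq (Ck_on_cst r (0 : R) oU) => // x _; rewrite big_nil.
by apply: Ck_on_eq (Ck_onD oU (cF i) IH) => // x _; rewrite big_cons.
Qed.

Lemma Ck_on_prod r U (I : Type) (s : seq I) (F : I -> E -> R) : open U ->
  (forall i, Ck_on r U (F i)) -> Ck_on r U (fun x => \prod_(i <- s) F i x).
Proof.
move=> oU cF; elim: s => [|i s IH].
  by apply: Ck_on_eq (Ck_on_cst r (1 : R) oU) => // x _; rewrite big_nil.
by apply: Ck_on_eq (Ck_onM oU (cF i) IH) => // x _; rewrite big_cons.
Qed.

Lemma Ck_onV r U f : open U -> (forall x, U x -> f x != 0) ->
  Ck_on r U f -> Ck_on r U (fun x => (f x)^-1).
Proof.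
move=> oU f0; elim: r => [|r IH] /= [cf df]; split=> //.
- by move=> x Ux; apply: continuousV (cf x Ux); exact: f0.
- by move=> x Ux; apply: continuousV (cf x Ux); exact: f0.
- move=> k; have [dfk Hk] := df k; split.
    by move=> x Ux; apply: derivableV; [exact: f0|exact: dfk].
  have Cf : Ck_on r U f by apply: Ck_onS.
  have Cv := IH Cf.
  apply: Ck_on_eq (Ck_onN oU (Ck_onM oU (Ck_onM oU Cv Cv) Hk)) => // x Ux.
  rewrite /partial deriveV//; [|exact: f0|exact: dfk].
  by rewrite /GRing.scale/= mulNr -exprVn expr2.
Qed.

Lemma Ck_on_differentiable U f x : open U -> U x -> Ck_on 1 U f ->
  differentiable f x.
Proof.
move=> oU Ux [_ df]; apply: (differentiable_C1 oU Ux).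
  by move=> z k Uz; exact: (df k).1.
by move=> k; exact: (df k).2.1.
Qed.

End scalar.

Lemma Ck_on_coord r U k : open U -> Ck_on r U (fun x : E => x k 0).
Proof.
move=> oU; have dk (x v : E) : derivable (fun x : E => x k 0 : R) x v.
  exact/diff_derivable/differentiable_coord.
case: r => [|r] /=; split=> //.
- by move=> x _; exact: coord_continuous.
- by move=> x _; exact: coord_continuous.
- move=> l; split=> //.
  apply: Ck_on_eq (Ck_on_cst r (e_ l k 0) oU) => // x _.
  have [] := derivable_mxP (@id E) x (e_ l) => _ h.
  have := derive_mx (@derivable_id _ _ x (e_ l)); rewrite derive_id => ->.
  by rewrite mxE.
Qed.

Lemma mx_continuousP (p q : nat) (A : E -> 'M[R]_(p, q)) x :
  {for x, continuous A} <-> forall i j, {for x, continuous (fun z => A z i j)}.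
Proof.
split=> [cA i j|cA].
  exact: (continuous_comp cA (@coord_continuous _ _ _ i j _)).
move=> S [P nP PS].
have : \forall z \near x, forall i j, P i j (A z i j).
  have FF := nbhs_filter x.
  apply: (filter_forall (F := nbhs x)) => i.
  by apply: (filter_forall (F := nbhs x)) => j; exact: cA i j _ (nP i j).
by apply: filterS => z hz; exact: PS.
Qed.

Lemma partial_mxE (p q : nat) (A : E -> 'M[R]_(p, q)) k x i j :
  derivable A x (e_ k) -> partial k A x i j = partial k (fun z => A z i j) x.
Proof. by move=> dA; rewrite /partial derive_mx// mxE. Qed.

Lemma Ck_on_mxP (p q : nat) (A : E -> 'M[R]_(p, q)) r U : open U ->
  Ck_on r U A <-> forall i j, Ck_on r U (fun x => A x i j).
Proof.
move=> oU; elim: r A => [|r IH] A /=.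
  split=> [[cA _] i j|cA]; split=> // x Ux; first by move/mx_continuousP: (cA x Ux).
  by apply/mx_continuousP => i j; exact: (cA i j).1.
split=> [[cA dA] i j|cA]; split.
- by move=> x Ux; move/mx_continuousP: (cA x Ux).
- move=> k; have [dAk Hk] := dA k; split.
    by move=> x Ux; have /derivable_mxP := dAk x Ux.
  have /IH/(_ i j) := Hk; apply: Ck_on_eq => // x Ux.
  by rewrite partial_mxE//; exact: dAk.
- by move=> x Ux; apply/mx_continuousP => i j; exact: (cA i j).1.
- move=> k; have dAk x : U x -> derivable A x (e_ k).
    by move=> Ux; apply/derivable_mxP => i j; exact: ((cA i j).2 k).1.
  split=> //; apply/IH => i j.
  apply: Ck_on_eq ((cA i j).2 k).2 => // x Ux.
  by rewrite partial_mxE//; exact: dAk.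
Qed.

End Ck.

Section smooth.
Variables (R : realType) (m : nat).
Local Notation E := 'cV[R]_m.
Local Notation e_ k := (delta_mx k 0 : E).
Variable U : set E.
Hypothesis oU : open U.

Section general.
Variable W : normedModType R.
Implicit Type f : E -> W.

Lemma smooth_partial f k : smooth_on U f -> smooth_on U (partial k f).
Proof. by move=> sf r; have [_ h] := sf r.+1; exact: (h k).2. Qed.

Lemma smooth_derivable f k x : smooth_on U f -> U x -> derivable f x (e_ k).
Proof. by move=> sf Ux; have [_ h] := sf 1; exact: (h k).1. Qed.

Lemma smooth_continuous f x : smooth_on U f -> U x -> {for x, continuous f}.
Proof. by move=> sf Ux; exact: (sf 0).1. Qed.

Lemma smooth_on_eq f g : (forall x, U x -> f x = g x) ->
  smooth_on U f -> smooth_on U g.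
Proof. by move=> fg sf r; exact: Ck_on_eq (sf r). Qed.

Lemma smooth_cst (w : W) : smooth_on U (fun=> w).
Proof. by move=> r; exact: Ck_on_cst. Qed.

Lemma smoothD f g : smooth_on U f -> smooth_on U g ->
  smooth_on U (fun x => f x + g x).
Proof. by move=> sf sg r; exact: Ck_onD. Qed.

Lemma partialD f g k x : smooth_on U f -> smooth_on U g -> U x ->
  partial k (fun x => f x + g x) x = partial k f x + partial k g x.
Proof.
by move=> sf sg Ux; rewrite /partial -deriveD//; exact: smooth_derivable.
Qed.

Lemma partialN f k x : smooth_on U f -> U x ->
  partial k (fun x => - f x) x = - partial k f x.
Proof. by move=> sf Ux; rewrite /partial -deriveN//; exact: smooth_derivable. Qed.

Lemma partial_cst (w : W) k (x : E) : partial k (fun=> w) x = 0 :> W.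
Proof. by rewrite /partial derive_cst. Qed.

End general.

Section scalar.
Implicit Types f g : E -> R.

Lemma smoothM f g : smooth_on U f -> smooth_on U g ->
  smooth_on U (fun x => f x * g x).
Proof. by move=> sf sg r; exact: Ck_onM. Qed.

Lemma partialM f g k x : smooth_on U f -> smooth_on U g -> U x ->
  partial k (fun x => f x * g x) x = partial k f x * g x + f x * partial k g x.
Proof.
move=> sf sg Ux; have df : derivable f x (e_ k) by exact: smooth_derivable.
have dg : derivable g x (e_ k) by exact: smooth_derivable.
rewrite /partial; have := deriveM df dg; rewrite addrC => fgE.
by apply: etrans fgE _; congr (_ + _); exact: mulrC.
Qed.

#[local] Opaque partial.

Lemma smooth_sum (I : Type) (s : seq I) (F : I -> E -> R) :
  (forall i, smooth_on U (F i)) -> smooth_on U (fun x => \sum_(i <- s) F i x).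
Proof. by move=> sF r; apply: Ck_on_sum => // i; exact: sF. Qed.

Lemma partial_sum (I : Type) (s : seq I) (F : I -> E -> R) k x :
  (forall i, smooth_on U (F i)) -> U x ->
  partial k (fun x => \sum_(i <- s) F i x) x = \sum_(i <- s) partial k (F i) x.
Proof.
move=> sF Ux; elim: s => [|i s IH].
  rewrite big_nil -[RHS](partial_cst (0 : R) k x); congr (partial k _ x).
  by apply/funext => z; rewrite big_nil.
rewrite big_cons -IH -partialD//; last by apply: smooth_sum.
by congr (partial k _ x); apply/funext => z; rewrite big_cons.
Qed.

Lemma smooth_prod (I : Type) (s : seq I) (F : I -> E -> R) :
  (forall i, smooth_on U (F i)) -> smooth_on U (fun x => \prod_(i <- s) F i x).
Proof. by move=> sF r; apply: Ck_on_prod => // i; exact: sF. Qed.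

Lemma smoothV f : (forall x, U x -> f x != 0) -> smooth_on U f ->
  smooth_on U (fun x => (f x)^-1).
Proof. by move=> f0 sf r; exact: Ck_onV. Qed.

Lemma smooth_coord k : smooth_on U (fun x : E => x k 0).
Proof. by move=> r; exact: Ck_on_coord. Qed.

Lemma smooth_differentiable f x : smooth_on U f -> U x -> differentiable f x.
Proof. by move=> sf Ux; exact: (Ck_on_differentiable oU Ux (sf 1)). Qed.

Lemma smooth_partial_comm f j k x : smooth_on U f -> U x ->
  partial j (partial k f) x = partial k (partial j f) x.
Proof.
move=> sf Ux; have := @partial_comm R m U f x j k oU Ux; apply.
- by move=> z l Uz; exact: smooth_derivable.
- by move=> z l l' Uz; apply: smooth_derivable => //; exact: smooth_partial.
- by move=> l l'; apply: smooth_continuous => //; do 2 apply: smooth_partial.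
Qed.

End scalar.

Section matrices.
Variables p q : nat.
Implicit Types A B : E -> 'M[R]_(p, q).

Lemma smooth_mxP A : smooth_on U A <-> forall i j, smooth_on U (fun x => A x i j).
Proof.
split=> [sA i j r|sA r]; first by have /Ck_on_mxP := sA r; apply.
by apply/Ck_on_mxP => // i j; exact: sA.
Qed.

Lemma smooth_entry A i j : smooth_on U A -> smooth_on U (fun x => A x i j).
Proof. by move/smooth_mxP. Qed.

Lemma partial_entry A k x i j : smooth_on U A -> U x ->
  partial k (fun z => A z i j) x = partial k A x i j.
Proof. by move=> sA Ux; rewrite -partial_mxE//; exact: smooth_derivable. Qed.

Lemma smoothN A : smooth_on U A -> smooth_on U (fun x => - A x).
Proof.
move=> sA; apply/smooth_mxP => i j r.
have := Ck_onN oU (smooth_entry i j sA r).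
by apply: Ck_on_eq => // x _; rewrite mxE.
Qed.

Lemma smooth_scale (f : E -> R) A : smooth_on U f -> smooth_on U A ->
  smooth_on U (fun x => f x *: A x).
Proof.
move=> sf sA; apply/smooth_mxP => i j.
have := smoothM sf (smooth_entry i j sA).
by apply: smooth_on_eq => x _; rewrite mxE.
Qed.

Lemma partial_scale (f : E -> R) A k x : smooth_on U f -> smooth_on U A -> U x ->
  partial k (fun x => f x *: A x) x = partial k f x *: A x + f x *: partial k A x.
Proof.
move=> sf sA Ux; apply/matrixP => i j; rewrite -partial_entry//; last exact: smooth_scale.
transitivity (partial k (fun z => f z * A z i j) x).
  by congr (partial k _ x); apply/funext => z; rewrite mxE.
rewrite partialM//; last exact: smooth_entry.
by rewrite partial_entry// !mxE.
Qed.

Lemma smooth_mx_sum (I : Type) (s : seq I) (F : I -> E -> 'M[R]_(p, q)) :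
  (forall i, smooth_on U (F i)) -> smooth_on U (fun x => \sum_(i <- s) F i x).
Proof.
move=> sF; elim: s => [|i s IH].
  by apply: smooth_on_eq (smooth_cst (0 : 'M[R]_(p, q))) => x _; rewrite big_nil.
by apply: smooth_on_eq (smoothD (sF i) IH) => x _; rewrite big_cons.
Qed.

Lemma partial_mx_sum (I : Type) (s : seq I) (F : I -> E -> 'M[R]_(p, q)) k x :
  (forall i, smooth_on U (F i)) -> U x ->
  partial k (fun x => \sum_(i <- s) F i x) x = \sum_(i <- s) partial k (F i) x.
Proof.
move=> sF Ux; elim: s => [|i s IH].
  rewrite big_nil -[RHS](partial_cst (0 : 'M[R]_(p, q)) k x); congr (partial k _ x).
  by apply/funext => z; rewrite big_nil.
rewrite big_cons -IH -partialD//; last by apply: smooth_mx_sum.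
by congr (partial k _ x); apply/funext => z; rewrite big_cons.
Qed.

Lemma partial_comm_mx A j k x : smooth_on U A -> U x ->
  partial j (partial k A) x = partial k (partial j A) x.
Proof.
move=> sA Ux; apply/matrixP => a b.
have h l l' : partial l (partial l' A) x a b =
    partial l (partial l' (fun z => A z a b)) x.
  have sA' : smooth_on U (partial l' A) by exact: smooth_partial.
  have <- : partial l (fun z => partial l' A z a b) x = partial l (partial l' A) x a b.
    exact: partial_entry sA' Ux.
  apply: (partial_eq_on l oU Ux) => z Uz.
  by apply: esym; exact: partial_entry sA Uz.
apply: etrans (h j k) (etrans _ (esym (h k j))).
exact: smooth_partial_comm (smooth_entry a b sA) Ux.
Qed.

End matrices.

Lemma smooth_tr p q (A : E -> 'M[R]_(p, q)) : smooth_on U A -> smooth_on U (fun x => (A x)^T).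
Proof.
move=> sA; apply/smooth_mxP => i j; apply: smooth_on_eq (smooth_entry j i sA) => x _.
by rewrite mxE.
Qed.

Lemma partial_tr p q (A : E -> 'M[R]_(p, q)) k x : smooth_on U A -> U x ->
  partial k (fun x => (A x)^T) x = (partial k A x)^T.
Proof.
move=> sA Ux; apply/matrixP => i j; rewrite -partial_entry//; last exact: smooth_tr.
rewrite mxE -partial_entry//.
by congr (partial k _ x); apply/funext => z; rewrite mxE.
Qed.

Lemma smooth_mul p q s (A : E -> 'M[R]_(p, q)) (B : E -> 'M[R]_(q, s)) :
  smooth_on U A -> smooth_on U B -> smooth_on U (fun x => A x *m B x).
Proof.
move=> sA sB; apply/smooth_mxP => i j.
have h l := smoothM (smooth_entry i l sA) (smooth_entry l j sB).
by apply: smooth_on_eq (smooth_sum (index_enum _) h) => x _; rewrite mxE.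
Qed.

Lemma partial_mul p q s (A : E -> 'M[R]_(p, q)) (B : E -> 'M[R]_(q, s)) k x :
  smooth_on U A -> smooth_on U B -> U x ->
  partial k (fun x => A x *m B x) x = partial k A x *m B x + A x *m partial k B x.
Proof.
move=> sA sB Ux; apply/matrixP => i j; rewrite -partial_entry//; last exact: smooth_mul.
transitivity (partial k (fun z => \sum_l A z i l * B z l j) x).
  by congr (partial k _ x); apply/funext => z; rewrite mxE.
have sAe l := smooth_entry i l sA; have sBe l := smooth_entry l j sB.
rewrite partial_sum//; last by move=> l; exact: smoothM.
rewrite !mxE -big_split/=; apply: eq_bigr => l _.
by rewrite partialM// !partial_entry.
Qed.

Lemma smooth_det p (A : E -> 'M[R]_p) : smooth_on U A ->
  smooth_on U (fun x => \det (A x)).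
Proof.
move=> sA; apply: smooth_sum => s; apply: smoothM; first exact: smooth_cst.
by apply: smooth_prod => i; exact: smooth_entry.
Qed.

(** Cramer's rule: the adjugate is polynomial in the entries, and the determinant has no zero on
    [U]. *)
Lemma smooth_invmx p (A : E -> 'M[R]_p) : (forall x, U x -> A x \in unitmx) ->
  smooth_on U A -> smooth_on U (fun x => invmx (A x)).
Proof.
move=> uA sA.
have sadj : smooth_on U (fun x => \adj (A x)).
  apply/smooth_mxP => i j.
  suff : smooth_on U (fun x => cofactor (A x) j i).
    by apply: smooth_on_eq => x _; rewrite mxE.
  apply: smoothM; first exact: smooth_cst.
  apply: smooth_det; apply/smooth_mxP => a b.
  have := smooth_entry (lift j a) (lift i b) sA.
  by apply: smooth_on_eq => x _; rewrite !mxE.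
have sdet : smooth_on U (fun x => (\det (A x))^-1).
  by apply: smoothV (smooth_det sA) => x /uA; rewrite unitmxE unitfE.
by apply: smooth_on_eq (smooth_scale sdet sadj) => x /uA uAx; rewrite /invmx uAx.
Qed.

End smooth.

(** * Composition of smooth maps *)

Section composition.
Variables (R : realType) (m n : nat).
Variables (U : set 'cV[R]_m) (V : set 'cV[R]_n).
Hypotheses (oU : open U) (oV : open V).

Lemma partial_comp_scalar (f : 'cV[R]_n -> R) (phi : 'cV[R]_m -> 'cV[R]_n) k x :
  differentiable f (phi x) -> derivable phi x (delta_mx k 0) ->
  derivable (f \o phi) x (delta_mx k 0) /\
  partial k (f \o phi) x = \sum_l partial k phi x l 0 * partial l f (phi x).
Proof.
move=> df dphi; have [dc dE] := is_derive_chain dphi df.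
by split=> //; apply: etrans dE _; rewrite derive_partial.
Qed.

(** Induction on [r] through the chain rule: a partial of the composite is a sum of products of a
    partial of [phi] with some [partial l f] composed with [phi], and the induction hypothesis holds
    for every [f]. *)
Lemma Ck_on_comp r (f : 'cV[R]_n -> R) (phi : 'cV[R]_m -> 'cV[R]_n) :
  (forall x, U x -> V (phi x)) -> Ck_on r V f -> Ck_on r U phi ->
  Ck_on r U (f \o phi).
Proof.
move=> UV; elim: r f => [|r IH] f Cf Cphi; (split; last first).
- by [].
- by move=> x Ux; apply: continuous_comp (Cphi.1 x Ux) (Cf.1 _ (UV _ Ux)).
- move=> k.
  have df x : U x -> differentiable f (phi x).
    move=> Ux; apply: (Ck_on_differentiable oV (UV _ Ux)).
    by split; [exact: Cf.1|move=> l; split; [exact: (Cf.2 l).1|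
      case: (r) (Cf.2 l).2 => [|s] []]].
  have h x (Ux : U x) := partial_comp_scalar (df x Ux) ((Cphi.2 k).1 x Ux).
  split; first by move=> x Ux; exact: (h x Ux).1.
  apply: (Ck_on_eq oU (f := fun x => \sum_l partial k phi x l 0 * partial l f (phi x))).
    by move=> x Ux; rewrite (h x Ux).2.
  apply: Ck_on_sum => // l; apply: Ck_onM => //.
    by have /(Ck_on_mxP _ _ oU) := (Cphi.2 k).2; apply.
  by apply: (IH (partial l f)); [exact: (Cf.2 l).2|exact: Ck_onS].
- by move=> x Ux; apply: continuous_comp (Cphi.1 x Ux) (Cf.1 _ (UV _ Ux)).
Qed.

Lemma smooth_comp p q (A : 'cV[R]_n -> 'M[R]_(p, q)) (phi : 'cV[R]_m -> 'cV[R]_n) :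
  (forall x, U x -> V (phi x)) -> smooth_on V A -> smooth_on U phi ->
  smooth_on U (A \o phi).
Proof.
move=> UV sA sphi; apply/(smooth_mxP oU) => i j r.
by apply: (@Ck_on_comp r (fun z => A z i j)) => //; exact: (smooth_entry oV).
Qed.

Lemma partial_comp p q (A : 'cV[R]_n -> 'M[R]_(p, q))
    (phi : 'cV[R]_m -> 'cV[R]_n) k x :
  (forall x, U x -> V (phi x)) -> smooth_on V A -> smooth_on U phi -> U x ->
  partial k (A \o phi) x = \sum_l partial k phi x l 0 *: partial l A (phi x).
Proof.
move=> UV sA sphi Ux; have Vx := UV _ Ux; apply/matrixP => i j.
have sAphi : smooth_on U (A \o phi) by exact: smooth_comp.
apply: etrans (esym (partial_entry k i j sAphi Ux)) _.
have dA : differentiable (fun z => A z i j) (phi x).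
  by apply: (smooth_differentiable oV) => //; exact: (smooth_entry oV).
have dphi : derivable phi x (delta_mx k 0) by exact: (smooth_derivable sphi).
have [_ compE] := partial_comp_scalar dA dphi; apply: etrans compE _.
rewrite summxE; apply: eq_bigr => l _; rewrite mxE; congr (_ * _).
exact: partial_entry sA Vx.
Qed.

End composition.

(** * Averages along rays and uniform limits *)

Section ray_average.
Variables (R : realType) (m : nat).
Local Notation E := 'cV[R]_m.
Local Notation e_ k := (delta_mx k 0 : E).
Variables (c : E) (r : R).
Hypothesis r0 : 0 < r.
Local Notation B := (ball c r).
Local Notation mu := (@lebesgue_measure R).

Definition ray (t : R) (x : E) : E := c + t *: (x - c).

(** The weight makes the family closed under differentiation: each partial derivative in [x] brings
    out one factor [t], so the smoothness proof is an induction with [a] varying. *)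
Definition ray_average (a : nat) (f : E -> R) (x : E) : R :=
  \int[mu]_(t in `[0, 1]) (t ^+ a * f (ray t x)).

Lemma oB : open B. Proof. exact: ball_open. Qed.

Lemma ray_ball t x : 0 <= t <= 1 -> B x -> B (ray t x).
Proof.
move=> /andP[t0 t1]; rewrite -ball_normE/= /ray opprD addrA subrr sub0r normrN.
rewrite normrZ ger0_norm// distrC; apply: le_lt_trans.
by rewrite ler_piMl.
Qed.

Lemma ray1 x : ray 1 x = x. Proof. by rewrite /ray scale1r addrC subrK. Qed.

Lemma rayD t x h : ray t (x + h) = ray t x + t *: h.
Proof. by rewrite /ray (addrAC x) scalerDr addrA. Qed.

Lemma ray_joint_continuous t x :
  {for (t, x), continuous (fun p : R * E => ray p.1 p.2)}.
Proof.
apply: cvgD; first exact: cvg_cst.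
apply: cvgZ; first exact: cvg_fst.
by apply: cvgB; [exact: cvg_snd|exact: cvg_cst].
Qed.

Lemma ray_continuous (f : E -> R) t x : {for ray t x, continuous f} ->
  {for t, continuous (fun s => f (ray s x))}.
Proof.
move=> cf; apply: (@continuous_comp _ _ _ (fun s => ray s x)) => //.
by apply: cvgD; [exact: cvg_cst|apply: cvgZ; [exact: cvg_id|exact: cvg_cst]].
Qed.

Lemma ray_within (f : E -> R) x : (forall z, B z -> {for z, continuous f}) -> B x ->
  {within `[0, 1], continuous (fun t => f (ray t x))}.
Proof.
move=> cf Bx; apply: continuous_in_subspaceT => t.
rewrite inE/= in_itv/= => t01; apply: ray_continuous; apply: cf.
exact: ray_ball.
Qed.

Lemma ray_within_pow a (f : E -> R) x :
  (forall z, B z -> {for z, continuous f}) -> B x ->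
  {within `[0, 1], continuous (fun t => t ^+ a * f (ray t x))}.
Proof.
move=> cf Bx; apply: continuous_in_subspaceT => t.
rewrite inE/= in_itv/= => t01; apply: cvgM; first exact: exprn_continuous.
by apply: ray_continuous; apply: cf; exact: ray_ball.
Qed.

Lemma ray_integrable a (f : E -> R) x :
  (forall z, B z -> {for z, continuous f}) -> B x ->
  mu.-integrable `[0, 1] (EFin \o (fun t => t ^+ a * f (ray t x))).
Proof.
move=> cf Bx; apply: continuous_compact_integrable; first exact: segment_compact.
exact: ray_within_pow.
Qed.

(** The bound is uniform for [y] near [x], as domination under the integral requires. Joint
    continuity gives it near each [t], and compactness of the segment yields one neighbourhood of
    [x] for all [t]. *)
Lemma ray_bound (f : E -> R) x : (forall z, B z -> {for z, continuous f}) -> B x ->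
  exists M : R, \forall y \near x, forall t, 0 <= t <= 1 -> `|f (ray t y)| <= M.
Proof.
move=> cf Bx.
have [t0 _ t0max] : exists2 t0, t0 \in `[0, 1]%R &
    forall t, t \in `[0, 1]%R -> `|f (ray t x)| <= `|f (ray t0 x)|.
  apply: (@EVT_max R (fun t => `|f (ray t x)|)) => //.
  apply: (@ray_within (fun z => `|f z|)) => // z /cf cfz.
  exact: (continuous_comp cfz (@norm_continuous _ _ _)).
exists (`|f (ray t0 x)| + 1).
have /compact_near_coveringP cpt := @segment_compact R 0 1.
have := cpt E (nbhs x) (fun y t => `|f (ray t y)| <= `|f (ray t x)| + 1) (nbhs_filter x).
move=> /(_ _)/filterS; apply.
  move=> y h t t01; rewrite (le_trans (h t _))/= ?in_itv// lerD2r.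
  by apply: t0max; rewrite in_itv.
move=> t; rewrite /= in_itv/= => t01.
have ct := cf _ (ray_ball t01 Bx).
have /(continuous_comp (@ray_joint_continuous t x)) cc := ct.
have /cvgrPdist_lt/(_ (1 / 2))[//|[A C] /= [At Cx] AC] := cc.
exists (A, C) => //= -[s y] /= [As Cy].
have h1 := AC (s, y) (conj As Cy); have h2 := AC (s, x) (conj As (nbhs_singleton Cx)).
rewrite /= in h1 h2.
have := ler_normD (f (ray s x)) (f (ray t x) - f (ray s x) - (f (ray t x) - f (ray s y))).
have := ler_normB (f (ray t x) - f (ray s x)) (f (ray t x) - f (ray s y)).
have -> : f (ray s x) + (f (ray t x) - f (ray s x) - (f (ray t x) - f (ray s y))) = f (ray s
    y) by ring.
lra.
Qed.

Lemma ray_average_bound a (f : E -> R) x M :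
  (forall z, B z -> {for z, continuous f}) -> B x ->
  (forall t, 0 <= t <= 1 -> `|f (ray t x)| <= M) -> `|ray_average a f x| <= M.
Proof.
move=> cf Bx fM; have intf := ray_integrable a cf Bx.
have M0 : 0 <= M by apply: le_trans (fM 0 _); rewrite ?normr_ge0// lexx ler01.
apply: le_trans (le_normr_Rintegral _ intf) _ => //.
have -> : M = \int[mu]_(t in `[0%R, 1%R]) (cst M) t.
  rewrite Rintegral_cst//.
  have mu01 : mu `[0, 1]%classic = 1%E.
    by rewrite lebesgue_measure_itv/= lte_fin ltr01 oppr0 adde0.
  by apply: esym; apply: etrans (congr1 (fun u => M * fine u) mu01) _; rewrite mulr1.
apply: le_Rintegral => //.
- exact: (integrable_norm intf).
- apply: continuous_compact_integrable; first exact: segment_compact.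
  by apply: continuous_in_subspaceT => t _; exact: cst_continuous.
- move=> t; rewrite /= in_itv/= => /andP[t0 t1].
  rewrite normrM -[leRHS]mul1r ler_pM//; last by apply: fM; rewrite t0.
  by rewrite normrX ger0_norm// exprn_ile1.
Qed.

Lemma ray_averageB a (f g : E -> R) x :
  (forall z, B z -> {for z, continuous f}) ->
  (forall z, B z -> {for z, continuous g}) -> B x ->
  ray_average a (fun z => f z - g z) x = ray_average a f x - ray_average a g x.
Proof.
move=> cf cg Bx; rewrite /ray_average -RintegralB//; [|exact: ray_integrable..].
by apply: eq_Rintegral => t _; rewrite mulrBr.
Qed.

Lemma ray_average_eq a (f g : E -> R) x : B x -> (forall z, B z -> f z = g z) ->
  ray_average a f x = ray_average a g x.
Proof.
move=> Bx fg; apply: eq_Rintegral => t; rewrite inE/= in_itv/= => t01.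
by rewrite fg//; exact: ray_ball.
Qed.

Lemma smooth_ray_derive (f : E -> R) x v t (s : R) : smooth_on B f ->
  B (ray t x + s *: v) ->
  is_derive s 1 (fun u : R => f (ray t x + u *: v))
   ('D_v f (ray t x + s *: v)).
Proof.
move=> sf Bs; apply: is_derive_line; apply: diff_derivable.
exact: (@smooth_differentiable R m B oB f _ sf Bs).
Qed.

Lemma derive_scale (f : E -> R) z t k : differentiable f z ->
  'D_(t *: e_ k) f z = t * partial k f z.
Proof. by move=> df; rewrite /partial !deriveE// linearZ. Qed.

(** Differentiation under the integral, dominated by the constant of [ray_bound]. Moving [x] by
    [s *: e_ k] moves the point at time [t] by [(s * t) *: e_ k], whence the extra power of [t]. *)
Lemma ray_average_partial a (f : E -> R) x k : smooth_on B f -> B x ->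
  is_derive x (e_ k) (ray_average a f) (ray_average a.+1 (partial k f) x).
Proof.
move=> sf Bx.
have cf z : B z -> {for z, continuous f} by exact: smooth_continuous.
have cdf z : B z -> {for z, continuous (partial k f)}.
  by apply: smooth_continuous; exact: smooth_partial.
have [M MP] := ray_bound cdf Bx.
have [d d0 dP] : exists2 d : R, 0 < d & forall s : R, `|s| < d ->
    B (x + s *: e_ k) /\ forall t, 0 <= t <= 1 -> `|partial k f (ray t (x + s *: e_ k))| <= M.
  have hB : \forall y \near x, B y by apply: open_nbhs_nbhs; split => //; exact: oB.
  have /nbhs_ballP[d d0 dP] : nbhs x (B `&`
      [set y | forall t, 0 <= t <= 1 -> `|partial k f (ray t y)| <= M]).
    exact: filterI.
  exists d => // s sd; apply: dP; rewrite -ball_normE/= opprD addrA subrr sub0r normrN.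
  rewrite normrZ (le_lt_trans _ sd)// -[leRHS]mulr1 ler_wpM2l//; exact: norm_delta.
pose F (s t : R) := t ^+ a * f (ray t (x + s *: e_ k)).
have inI (s : R) : `]- d, d[%classic s -> `|s| < d.
  by rewrite /= in_itv/= ltr_norml.
have I0 : `]- d, d[%classic (0 : R) by rewrite /= in_itv/= oppr_lt0 d0.
have dF (s t : R) : `]- d, d[%classic s -> `[0%R, 1%R]%classic t ->
    is_derive s 1 (F ^~ t) (t ^+ a.+1 * partial k f (ray t (x + s *: e_ k))).
  move=> /inI /dP[Bs _]; rewrite /= in_itv/= => t01.
  have Bt := ray_ball t01 Bs; have E1 : ray t (x + s *: e_ k) = ray t x + s *: (t *: e_ k).
    by rewrite rayD scalerA mulrC -scalerA.
  rewrite E1 in Bt *.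
  have h := smooth_ray_derive sf Bt.
  rewrite derive_scale in h; last exact: (@smooth_differentiable R m B oB f _ sf Bt).
  have -> : F ^~ t = (t ^+ a) \*: (fun u : R => f (ray t x + u *: (t *: e_ k))) :> (R -> R).
    by apply/funext => u; rewrite /F rayD scalerA (mulrC t) -scalerA.
  have -> : t ^+ a.+1 * partial k f (ray t x + s *: (t *: e_ k)) =
    t ^+ a *: (t * partial k f (ray t x + s *: (t *: e_ k))) by rewrite exprSr /GRing.scale/=
        mulrA.
  exact: is_deriveZ.
have intF s : `]- d, d[%classic s -> mu.-integrable `[0, 1] (EFin \o F s).
  by move=> /inI /dP[Bs _]; exact: ray_integrable.
have derF s t : `]- d, d[%classic s -> `[0%R, 1%R]%classic t -> derivable (F ^~ t) s 1.
  by move=> hs ht; case: (dF s t hs ht).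
have M0 : 0 <= M.
  have : `|(0 : R)| < d by rewrite normr0.
  by move=> /dP[_ /(_ 0)]; rewrite lexx ler01 => /(_ isT); apply: le_trans.
have intM : mu.-integrable `[0%R, 1%R] (EFin \o cst M).
  apply: continuous_compact_integrable; first exact: segment_compact.
  by apply: continuous_in_subspaceT => t _; exact: cst_continuous.
have bdF s t : `]- d, d[%classic s -> `[0%R, 1%R]%classic t -> `|partial1of2 F s t| <= M.
  move=> hs ht; rewrite partial1of2E (@derive_val _ _ _ _ _ _ _ (dF s t hs ht)).
  have [_ h] := dP _ (inI _ hs); move: ht; rewrite /= in_itv/= => t01.
  rewrite normrM -[leRHS]mul1r ler_pM//; last exact: h.
  by move/andP: t01 => [t0 t1]; rewrite normrX ger0_norm// exprn_ile1.
have m01 : measurable (`[0%R, 1%R]%classic : set (measurableTypeR R)).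
  exact: measurable_itv.
have der := @derivable_under_integral R _ (measurableTypeR R) mu F _ m01 _ _ _ I0 intF derF
    (cst M) (fun=> M0) intM bdF.
have val := @differentiation_under_integral R _ (measurableTypeR R) mu F _ m01 _ _ _ I0 intF
    derF (cst M) (fun=> M0) intM bdF.
rewrite derive1E in val.
have lineE : (fun s : R => ray_average a f (s *: e_ k + x)) =
  (fun s => \int[mu]_(t in `[0%R, 1%R]) F s t).
  by apply/funext => s; rewrite /ray_average addrC.
apply: DeriveDef; first by apply/derivable1P; rewrite lineE.
rewrite -derive_line0 lineE val /ray_average; apply: eq_Rintegral => t.
rewrite inE/= => ht; rewrite partial1of2E (@derive_val _ _ _ _ _ _ _ (dF 0 t I0 ht)).
by rewrite scale0r addr0.
Qed.

(** The partials of [f] are bounded along all rays to points near [x], so the average has bounded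
    partials there and is Lipschitz by [ball_lipschitz]. *)
Lemma ray_average_continuous a (f : E -> R) x : smooth_on B f -> B x ->
  {for x, continuous (ray_average a f)}.
Proof.
move=> sf Bx.
have sdf k : smooth_on B (partial k f) by exact: smooth_partial.
have [M MP] : exists M : R, \forall y \near x, forall k t,
    0 <= t <= 1 -> `|partial k f (ray t y)| <= M.
  have h k := cid (ray_bound (fun z Bz => smooth_continuous (sdf k) Bz) Bx).
  exists (\sum_k `|sval (h k)|).
  have : \forall y \near x, forall k t, 0 <= t <= 1 ->
      `|partial k f (ray t y)| <= sval (h k).
    have FF := nbhs_filter x.
    apply: (filter_forall (F := nbhs x)) => k; exact: svalP (h k).
  apply: filterS => y hy k t t01; apply: le_trans (hy k t t01) _.
  by apply: le_trans (ler_norm _) _; rewrite (bigD1 k)//= lerDl sumr_ge0.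
have hB : \forall y \near x, B y by apply: open_nbhs_nbhs; split => //; exact: oB.
have /nbhs_ballP[d d0 dP] : nbhs x (B `&`
    [set y | forall k t, 0 <= t <= 1 -> `|partial k f (ray t y)| <= M]).
  exact: filterI.
have lip y : ball x d y ->
    `|ray_average a f y - ray_average a f x| <= M * \sum_k `|y k 0 - x k 0|.
  move=> hy; apply: (ball_lipschitz _ (ballxx _ d0) hy) => z k /dP[Bz hz].
  have [der val] := ray_average_partial a k sf Bz; split => //.
  rewrite [partial _ _ _]val; apply: ray_average_bound => //.
    by move=> w; exact: smooth_continuous.
  exact: hz.
have FF := nbhs_filter x; apply/cvgrPdist_lt => e e0.
pose q := e / (`|M| * m%:R + 1).
have D0 : 0 < `|M| * m%:R + 1 by rewrite ltr_wpDl// mulr_ge0.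
have q0 : 0 < q by rewrite divr_gt0.
have near1 : \forall y \near x, ball x d y by exact: nbhsx_ballx.
have near2 : \forall y \near x, ball x q y by exact: nbhsx_ballx.
apply: filterS (filterI near1 near2) => y [hy].
rewrite -ball_normE/= => yq; rewrite distrC (le_lt_trans (lip y hy))//.
have sumq : \sum_k `|y k 0 - x k 0| <= m%:R * q.
  apply: (@le_trans _ _ (\sum_(k < m) q)); last by rewrite sumr_const card_ord mulr_natl.
  apply: ler_sum => k _; rewrite (le_trans _ (ltW yq))// distrC.
  by have := mx_normr_entry (x - y) k 0; rewrite !mxE.
have sum0 : 0 <= \sum_k `|y k 0 - x k 0| by rewrite sumr_ge0.
apply: (@le_lt_trans _ _ (`|M| * (m%:R * q))).
  apply: (le_trans (ler_wpM2r sum0 (ler_norm M))).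
  by rewrite ler_wpM2l.
by rewrite mulrA /q mulrA ltr_pdivrMr// mulrC ltr_pM2l// ltrDl ltr01.
Qed.

Lemma smooth_ray_average a (f : E -> R) : smooth_on B f -> smooth_on B (ray_average a f).
Proof.
move=> sf n; elim: n a f sf => [|n IH] a f sf /=; split=> //.
- by move=> x Bx; exact: ray_average_continuous.
- by move=> x Bx; exact: ray_average_continuous.
- move=> k; split; first by move=> x Bx; case: (ray_average_partial a k sf Bx).
  apply: (Ck_on_eq oB (f := ray_average a.+1 (partial k f))).
    by move=> x Bx; case: (ray_average_partial a k sf Bx).
  by apply: IH; exact: smooth_partial.
Qed.

Lemma ray_average_sum a (w : 'I_m -> R) (F : 'I_m -> E -> R) x :
  (forall j, smooth_on B (F j)) -> B x ->
  ray_average a (fun z => \sum_j w j * F j z) x = \sum_j w j * ray_average a (F j) x.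
Proof.
move=> sF Bx; elim: (index_enum _) => [|j s IH].
  rewrite big_nil /ray_average; under eq_Rintegral do rewrite big_nil mulr0.
  by rewrite Rintegral_cst// mul0r.
have swF i : smooth_on B (fun z => w i * F i z).
  by apply: (smoothM oB) => //; exact: (smooth_cst oB).
have int (f : E -> R) : smooth_on B f ->
    mu.-integrable `[0, 1] (EFin \o (fun t => t ^+ a * f (ray t x))).
  by move=> sf; apply: ray_integrable => // z; exact: smooth_continuous.
rewrite big_cons -IH /ray_average -RintegralZl//; last exact: int.
rewrite -RintegralD//.
- by apply: eq_Rintegral => t _; rewrite big_cons mulrDr mulrCA.
- have := int _ (swF j); congr (integrable _ _ _); apply/funext => t /=.
  by rewrite mulrCA.
- exact: (int (fun z => \sum_(j <- s) w j * F j z) (smooth_sum oB s swF)).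
Qed.

(** Integrate the derivative of [t * f (ray t x)] over the unit interval; this is the homotopy
    identity behind the Poincare lemma. *)
Lemma radial_primitive (f : E -> R) x : smooth_on B f -> B x ->
  f x = ray_average 0 f x + \sum_j (x - c) j 0 * ray_average 1 (partial j f) x.
Proof.
move=> sf Bx.
have sdf j : smooth_on B (partial j f) by exact: smooth_partial.
pose w z := \sum_j (x - c) j 0 * partial j f z.
have sw : smooth_on B w.
  by apply: (smooth_sum oB) => j; apply: (smoothM oB) => //; exact: (smooth_cst oB).
have cf z : B z -> {for z, continuous f} by exact: smooth_continuous.
have cw z : B z -> {for z, continuous w} by exact: smooth_continuous.
have dray (t : R) : 0 <= t <= 1 ->
    is_derive t 1 (fun s => f (ray s x)) (w (ray t x)).
  move=> t01; have Bt := ray_ball t01 Bx.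
  have df := @smooth_differentiable R m B oB f _ sf Bt.
  have h : is_derive t 1 (fun s => f (ray s x)) ('D_(x - c) f (ray t x)).
    by apply: is_derive_line; exact: diff_derivable.
  by rewrite derive_partial in h.
pose G (s : R) := s * f (ray s x).
have dG (t : R) : 0 <= t <= 1 -> is_derive t 1 G
    (t ^+ 0 * f (ray t x) + t ^+ 1 * w (ray t x)).
  move=> t01; have h := dray t t01.
  apply: is_derive_eq (is_deriveM (is_derive_id t 1) h) _.
  by rewrite /GRing.scale/= expr0 expr1 mul1r mulr1 addrC.
rewrite -ray_average_sum// /ray_average -RintegralD//;
  [|exact: (ray_integrable 0 cf Bx)|exact: (ray_integrable 1 cw Bx)].
have cG (t : R) : 0 <= t <= 1 -> {for t, continuous G}.
  by move=> /dG[dt _]; apply: differentiable_continuous; exact/derivable1_diffP.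
rewrite /Rintegral (@continuous_FTC2 R _ G)//.
- by rewrite /= /G mul0r mul1r subr0 ray1.
- apply: continuous_in_subspaceT => t; rewrite inE/= in_itv/= => t01.
  have Bt := ray_ball t01 Bx.
  apply: cvgD; (apply: cvgM; first exact: exprn_continuous).
    exact: (ray_continuous (cf _ Bt)).
  exact: (ray_continuous (cw _ Bt)).
- split.
  + by move=> t; rewrite in_itv/= => /andP[t0 t1]; case: (dG t) => //; rewrite !ltW.
  + by apply: cvg_at_right_filter; apply: cG; rewrite lexx ler01.
  + by apply: cvg_at_left_filter; apply: cG; rewrite lexx ler01.
- move=> t; rewrite in_itv/= => /andP[t0 t1]; rewrite derive1E.
  by case: (dG t) => //; rewrite !ltW.
Qed.

End ray_average.

Section uniform_limits.
Variables (R : realType) (m : nat).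
Local Notation E := 'cV[R]_m.
Local Notation e_ k := (delta_mx k 0 : E).
Variables (B : set E) (oB : open B).

Lemma uniform_limit_continuous (F : E -> R) (x : E) : B x ->
  (forall e : R, 0 < e -> exists f : E -> R,
    (forall z, B z -> {for z, continuous f}) /\
    (forall z, B z -> `|f z - F z| <= e)) ->
  {for x, continuous F}.
Proof.
move=> Bx app; have FF := nbhs_filter x; apply/cvgrPdist_lt => e e0.
have e40 : 0 < e / 4 by rewrite divr_gt0.
have [f [cf fF]] := app _ e40.
have /cvgrPdist_lt/(_ _ e40) cfx := cf x Bx.
have hB : \forall y \near x, B y by exact: open_nbhs_nbhs.
apply: filterS (filterI cfx hB) => y [h By].
have h1 := fF _ Bx; have h2 := fF _ By.
move: h1 h2 h; rewrite ler_norml ltr_norml ler_norml ltr_norml.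
by move=> /andP[a1 a2] /andP[b1 b2] /andP[c1 c2]; apply/andP; split; lra.
Qed.

Lemma uniform_limit_derive (F g : E -> R) (x : E) (k : 'I_m) : B x ->
  {for x, continuous g} ->
  (forall e : R, 0 < e -> exists f : E -> R,
    [/\ forall z, B z -> derivable f z (e_ k),
        forall z, B z -> `|f z - F z| <= e
      & forall z, B z -> `|partial k f z - g z| <= e]) ->
  is_derive x (e_ k) F (g x).
Proof.
move=> Bx cg app.
suff lim : (fun s : R => s^-1 *: ((F \o shift x) (s *: e_ k) - F x)) @ 0^' --> g x.
  by apply: DeriveDef; [apply/cvg_ex; exists (g x)|exact: cvg_lim lim].
apply/cvgrPdist_le => e e0.
have e20 : 0 < e / 2 by rewrite divr_gt0.
have hB : \forall y \near x, B y by exact: open_nbhs_nbhs.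
have /cvgrPdist_lt/(_ _ e20) hg := cg.
have /nbhs_ballP[d d0 dP] : nbhs x (B `&` [set y | `|g x - g y| < e / 2]).
  exact: filterI.
near=> s.
have s0 : s != 0 by near: s; exact: nbhs_dnbhs_neq.
have sd : `|s| < d by near: s; exact: dnbhs0_lt.
have s_gt0 : 0 < `|s| by rewrite normr_gt0.
have bd (t : R) : 0 <= t <= 1 -> ball x d (x + (t * s) *: e_ k).
  move=> /andP[t0 t1]; rewrite -ball_normE/= opprD addrA subrr sub0r normrN.
  rewrite normrZ (le_lt_trans _ sd)// -[leRHS]mulr1 ler_pM ?norm_delta//.
  by rewrite normrM ger0_norm// ler_piMl.
suff key : `|F (x + s *: e_ k) - F x - s * g x| <= `|s| * e.
  have -> : g x - s^-1 *: ((F \o shift x) (s *: e_ k) - F x) =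
     - (s^-1 * (F (x + s *: e_ k) - F x - s * g x)).
    have alg (p q : R) : p - s^-1 * q = - (s^-1 * (q - s * p)) by field.
    by rewrite /= [s *: _ + x]addrC; exact: alg.
  by rewrite normrN normrM normfV ler_pdivrMl.
have i1 : 0 <= (1 : R) <= 1 by rewrite lexx ler01.
have i0 : 0 <= (0 : R) <= 1 by rewrite lexx ler01.
(* The increment [s] is now fixed, so the approximant may depend on it: [eta] absorbs the errors of
   [f] at the two end points, while the slope contributes at most [e / 2 + e / 2]. *)
apply/ler_addgt0Pr => eta eta0.
pose q := Num.min (e / 2) (eta / 2).
have q0 : 0 < q by rewrite lt_min e20 divr_gt0.
have qe : q <= e / 2 by rewrite ge_min lexx.
have qeta : q <= eta / 2 by rewrite ge_min lexx orbT.
have [f [df fF dfg]] := app _ q0.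
have [t t01 mvt] := line_mvt (fun t ht => df _ (dP _ (bd t ht)).1).
have B1 : B (x + s *: e_ k) by have [] := dP _ (bd 1 i1); rewrite mul1r.
have h1 := fF _ Bx; have h2 := fF _ B1.
have [Bt gt] := dP _ (bd t t01).
have h3 : `|'D_(e_ k) f (x + (t * s) *: e_ k) - g x| <= e.
  have h4 := dfg _ Bt; rewrite /= distrC in gt.
  have -> : 'D_(e_ k) f (x + (t * s) *: e_ k) - g x =
    (partial k f (x + (t * s) *: e_ k) - g (x + (t * s) *: e_ k))
    + (g (x + (t * s) *: e_ k) - g x) by rewrite addrA subrK.
  by rewrite (le_trans (ler_normD _ _))// [leRHS]splitr lerD// ?(ltW gt)// (le_trans h4).
have -> : F (x + s *: e_ k) - F x - s * g x =
   s * ('D_(e_ k) f (x + (t * s) *: e_ k) - g x)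
   - (f (x + s *: e_ k) - F (x + s *: e_ k)) + (f x - F x).
  by rewrite mulrBr -mvt; ring.
rewrite (le_trans (ler_normD _ _))// [eta]splitr addrA lerD//; last exact: le_trans h1 qeta.
rewrite (le_trans (ler_normB _ _))// lerD//; last exact: le_trans h2 qeta.
by rewrite normrM ler_wpM2l.
Unshelve. all: by end_near. Qed.

(* The limit is squeezed between the monotone sequences u i - 4^-i and u i + 4^-i. *)
Lemma geometric_limit (u : nat -> R) :
  (forall i, `|u i.+1 - u i| <= 4^-1 ^+ i.+1) ->
  exists l, forall i, `|u i - l| <= 4^-1 ^+ i.
Proof.
move=> hu; pose g i : R := 4^-1 ^+ i.
have g0 i : 0 < g i by rewrite exprn_gt0.
have gS i : g i = 4 * g i.+1 by rewrite /g exprS mulrA divff ?mul1r.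
have step i : u i - g i <= u i.+1 - g i.+1 /\ u i.+1 + g i.+1 <= u i + g i.
  have := hu i; rewrite -/(g i.+1) ler_norml => /andP[h1 h2].
  by have := gS i; have := g0 i.+1; split; lra.
have mono i j : (i <= j)%N -> u i - g i <= u j - g j /\ u j + g j <= u i + g i.
  move=> /subnKC <-; elim: (j - i)%N => [|k [h1 h2]]; first by rewrite addn0.
  by rewrite addnS; have [h3 h4] := step (i + k)%N; split; lra.
have ub i j : u i - g i <= u j + g j.
  have := g0 i; have := g0 j; case/orP: (leq_total i j) => /mono[]; lra.
pose A := range (fun i => u i - g i).
have supA : has_sup A.
  by split; [exists (u 0 - g 0), 0%N|exists (u 0 + g 0) => _ [i _ <-]; exact: ub].
exists (sup A) => i; rewrite -/(g i) ler_norml; apply/andP; split.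
  have : sup A <= u i + g i by apply: ge_sup; [exact: supA.1|move=> _ [j _ <-]; exact: ub].
  by lra.
have : u i - g i <= sup A by apply: (ub_le_sup supA.2); exists i.
by lra.
Qed.

End uniform_limits.

Lemma addmxE (R : nmodType) p q (A B : 'M[R]_(p, q)) i j : (A + B) i j = A i j + B i j.
Proof. by rewrite mxE. Qed.

Lemma oppmxE (R : zmodType) p q (A : 'M[R]_(p, q)) i j : (- A) i j = - A i j.
Proof. by rewrite mxE. Qed.

Lemma trmx11 (R : Type) (A : 'M[R]_1) : A^T 0 0 = A 0 0.
Proof. by rewrite mxE. Qed.

Ltac mx_abel := apply/matrixP => ? ?; rewrite ?(addmxE, oppmxE); ring.

(** * Pointwise algebra of quaternionic submersions *)

Section anticommuting.
Variables (R : realFieldType) (m d : nat) (J : 'I_d -> 'M[R]_m).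
Hypothesis JJ : forall b, J b *m J b = - 1%:M.
Hypothesis JC : forall b c, b != c -> J b *m J c = - (J c *m J b).

(** Adding to the double sum its copy with the indices exchanged makes the off-diagonal terms cancel
    in pairs and doubles the diagonal. *)
Lemma sqr_span_J (x : 'I_d -> R) :
  (\sum_b x b *: J b) *m (\sum_b x b *: J b) = - (\sum_b x b ^+ 2)%:M.
Proof.
have two0 : (2 : R) != 0 by rewrite pnatr_eq0.
apply: (scalerI two0); rewrite scaler_nat mulr2n.
have E : (\sum_b x b *: J b) *m (\sum_b x b *: J b) =
    \sum_b \sum_c (x b * x c) *: (J b *m J c).
  rewrite mulmx_suml; apply: eq_bigr => b _; rewrite mulmx_sumr.
  by apply: eq_bigr => c _; rewrite -scalemxAl -scalemxAr scalerA.
rewrite {1}E {1}E [X in _ + X]exchange_big -big_split/=.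
rewrite scalerN -scalemx1 scaler_suml scaler_sumr -sumrN; apply: eq_bigr => b _.
rewrite -big_split (bigD1 b)//= JJ big1 ?addr0.
  by rewrite -scalerDl -mulr2n scalerN scalerA mulr_natl expr2.
by move=> c cb; rewrite (JC cb) mulrC -scalerDr addrN scaler0.
Qed.

(** The square of the combination is minus the scalar [\sum_b x b ^+ 2], so a combination with a
    nonzero kernel vector has all coefficients zero. An element of the span is thus determined by
    its value at one nonzero vector. *)
Lemma span_J_eq0 (x : 'I_d -> R) (v : 'cV[R]_m) :
  v != 0 -> (\sum_b x b *: J b) *m v = 0 -> forall b, x b = 0.
Proof.
move=> v0 Xv b; have : (\sum_b x b *: J b) *m ((\sum_b x b *: J b) *m v) = 0.
  by rewrite Xv mulmx0.
rewrite mulmxA sqr_span_J mulNmx mul_scalar_mx => /eqP.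
rewrite oppr_eq0 scaler_eq0 (negPf v0) orbF => /eqP sum0.
have /psumr_eq0P/(_ sum0 b isT)/eqP : forall c, true -> 0 <= x c ^+ 2.
  by move=> c _; exact: sqr_ge0.
by rewrite sqrf_eq0 => /eqP.
Qed.

(** The structures are orthogonal for the trace form, which later reads off coefficients in their
    span by a smooth formula. *)
Lemma mxtrace_JJ b c : \tr (J b *m J c) = - (m%:R *+ (b == c)).
Proof.
have [->|bc] := eqVneq b c; first by rewrite JJ raddfN/= mxtrace1.
have : \tr (J b *m J c) = - \tr (J b *m J c).
  by rewrite {1}(JC bc) raddfN/= mxtrace_mulC.
by rewrite mulr0n oppr0; lra.
Qed.

End anticommuting.

Section inner_product.
Variables (R : realFieldType) (m : nat) (G : 'M[R]_m).
Hypothesis Gsym : G^T = G.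
Hypothesis Gpos : forall u : 'cV[R]_m, u != 0 -> 0 < (u^T *m G *m u) 0 0.

Definition ip (u v : 'cV[R]_m) : R := (u^T *m G *m v) 0 0.

Lemma ipC u v : ip u v = ip v u.
Proof.
by rewrite /ip -[in LHS](trmxK (u^T *m G *m v)) mxE !trmx_mul trmxK Gsym mulmxA.
Qed.

Lemma ipDl u u' v : ip (u + u') v = ip u v + ip u' v.
Proof. by rewrite /ip linearD !mulmxDl mxE. Qed.

Lemma ipNr u v : ip u (- v) = - ip u v.
Proof. by rewrite /ip mulmxN mxE. Qed.

Lemma ip0r u : ip u 0 = 0.
Proof. by rewrite /ip mulmx0 mxE. Qed.

Lemma ip_adj (A B : 'M[R]_m) u v : G *m A = B^T *m G ->
  ip u (A *m v) = ip (B *m u) v.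
Proof.
by move=> h; rewrite /ip trmx_mul -!mulmxA (mulmxA G) h !mulmxA.
Qed.

Lemma ip_eq0 u : ip u u = 0 -> u = 0.
Proof.
move=> h; apply/eqP/negPn/negP => /Gpos; rewrite -/(ip u u) h.
by rewrite ltxx.
Qed.

Lemma posdef_unitmx : G \in unitmx.
Proof.
rewrite -row_free_unit; apply/row_freeP.
have : row_free G by apply/inj_row_free => v vG0; apply: trmx_inj; rewrite trmx0;
  apply: ip_eq0; rewrite /ip trmxK vG0 mul0mx mxE.
by move=> /row_freeP.
Qed.

End inner_product.

(* Moving J1, then J2, through both arguments in either order gives opposite values
   as J1 and J2 anticommute. *)
Lemma quaternionic_bilinear_eq0 (R : realFieldType) (m : nat) (J1 J2 : 'M[R]_m)
    (A : 'cV[R]_m -> Prop) (b : 'cV[R]_m -> 'cV[R]_m -> 'cV[R]_m) (s : R) :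
  J1 *m J1 = - 1%:M -> J2 *m J2 = - 1%:M -> J1 *m J2 = - (J2 *m J1) ->
  s * s = 1 ->
  (forall u, A u -> A (J1 *m u)) -> (forall u, A u -> A (J2 *m u)) ->
  (forall u v, A u -> A v -> b u v = s *: b v u) ->
  (forall u v, A u -> A v -> b u (J1 *m v) = J1 *m b u v) ->
  (forall u v, A u -> A v -> b u (J2 *m v) = J2 *m b u v) ->
  forall u v, A u -> A v -> b u v = 0.
Proof.
move=> J11 J22 J12 ss A1 A2 bC b1 b2 u v Au Av.
have A1u := A1 _ Au; have A2v := A2 _ Av.
have h1 : b (J1 *m u) (J2 *m v) = J2 *m (J1 *m b u v).
  rewrite b2// bC// b1// bC// -!scalemxAr scalerA ss scale1r //.
have h2 : b (J1 *m u) (J2 *m v) = J1 *m (J2 *m b u v).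
  rewrite bC// b1// (bC _ _ A2v Au) b2// -!scalemxAr scalerA ss scale1r //.
have h3 : J2 *m (J1 *m b u v) = 0.
  have two0 : (2 : R) != 0 by rewrite pnatr_eq0.
  apply: (scalerI two0); rewrite scaler0 scaler_nat mulr2n.
  by rewrite {1}[J2 *m (J1 *m _)](etrans (esym h1) h2) !mulmxA J12 mulNmx addNr.
have : J1 *m (J2 *m (J2 *m (J1 *m b u v))) = 0 by rewrite h3 !mulmx0.
by rewrite (mulmxA J2 J2) J22 mulNmx mul1mx mulmxN mulmxA J11 mulNmx mul1mx opprK.
Qed.

Section directional.
Variables (R : realFieldType) (m p q : nat).
Implicit Types (Q : 'I_m -> 'M[R]_(p, q)) (u : 'cV[R]_m).

Definition along Q u : 'M[R]_(p, q) := \sum_k u k 0 *: Q k.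

Lemma alongD Q u v : along Q (u + v) = along Q u + along Q v.
Proof. by rewrite /along -big_split; apply: eq_bigr => k _; rewrite mxE scalerDl. Qed.

Lemma along_delta Q k : along Q (delta_mx k 0) = Q k.
Proof.
rewrite /along (bigD1 k)//= mxE !eqxx scale1r big1 ?addr0// => l lk.
by rewrite mxE (negPf lk) scale0r.
Qed.

Lemma along_add Q Q' u : along (fun k => Q k + Q' k) u = along Q u + along Q' u.
Proof. by rewrite /along -big_split; apply: eq_bigr => k _; rewrite scalerDr. Qed.

Lemma along_eq Q Q' u : (forall k, Q k = Q' k) -> along Q u = along Q' u.
Proof. by move=> h; apply: eq_bigr => k _; rewrite h. Qed.

End directional.

Lemma alongMl (R : realFieldType) (m p q s : nat) (Q : 'I_m -> 'M[R]_(p, q))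
    (A : 'M[R]_(s, p)) u : along (fun k => A *m Q k) u = A *m along Q u.
Proof.
by rewrite /along mulmx_sumr; apply: eq_bigr => k _; rewrite -scalemxAr.
Qed.

Lemma alongMr (R : realFieldType) (m p q s : nat) (Q : 'I_m -> 'M[R]_(p, q))
    (A : 'M[R]_(q, s)) u : along (fun k => Q k *m A) u = along Q u *m A.
Proof.
by rewrite /along mulmx_suml; apply: eq_bigr => k _; rewrite -scalemxAl.
Qed.

Lemma along_sym (R : realFieldType) (m p : nat) (Q : 'I_m -> 'M[R]_(p, m)) :
  (forall i k l, Q k i l = Q l i k) ->
  forall u v, along Q u *m v = along Q v *m u.
Proof.
move=> Qs u v; apply/colP => i; rewrite !mxE.
under eq_bigr do rewrite summxE mulr_suml.
rewrite exchange_big; apply: eq_bigr => k _ /=.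
rewrite summxE mulr_suml; apply: eq_bigr => l _.
by rewrite !mxE (Qs i l k); ring.
Qed.

(* Q is nabla P for the vertical projector P = 1 - S W D, and H the second
   fundamental form of the submersion with differential D; S is the horizontal lift. *)
Section vertical_projector.
Variables (R : realFieldType) (m n : nat).
Implicit Types u v w : 'cV[R]_m.
Variables (G : 'M[R]_m) (D : 'M[R]_(n, m)) (S : 'M[R]_(m, n)) (W : 'M[R]_n).
Hypothesis Gsym : G^T = G.
Hypothesis Gpos : forall u : 'cV[R]_m, u != 0 -> 0 < (u^T *m G *m u) 0 0.
Hypothesis GS : G *m S = D^T.
Hypothesis WDS : W *m (D *m S) = 1%:M.
Let P' := S *m W *m D.
Let P := 1%:M - P'.
Variables (Q : 'I_m -> 'M[R]_m) (H : 'I_m -> 'M[R]_(n, m)).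
Variables J1 J2 : 'M[R]_m.
Hypothesis J11 : J1 *m J1 = - 1%:M.
Hypothesis J22 : J2 *m J2 = - 1%:M.
Hypothesis J12 : J1 *m J2 = - (J2 *m J1).
Hypothesis PJ1 : P *m J1 = J1 *m P.
Hypothesis PJ2 : P *m J2 = J2 *m P.
Hypothesis QP : forall k, Q k *m P + P *m Q k = Q k.
Hypothesis GQ : forall k, G *m Q k = (Q k)^T *m G.
Hypothesis QJ1 : forall k, Q k *m J1 = J1 *m Q k.
Hypothesis QJ2 : forall k, Q k *m J2 = J2 *m Q k.
Hypothesis DQ : forall k, D *m Q k = - (H k *m P).
Hypothesis Hsym : forall i k l, H k i l = H l i k.
Hypothesis HS : forall v, D *m v = 0 ->
  along H v *m S + (along H v *m S)^T = 0.

Let DSW : D *m S *m W = 1%:M.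
Proof. exact: mulmx1C WDS. Qed.

Let DP' : D *m P' = D.
Proof. by rewrite /P' !mulmxA DSW mul1mx. Qed.

Let DP : D *m P = 0.
Proof. by rewrite /P mulmxBr mulmx1 DP' subrr. Qed.

Let P'P' : P' *m P' = P'.
Proof. by rewrite {1}/P' -!mulmxA DP' /P' mulmxA. Qed.

Let PP' : P *m P' = 0.
Proof. by rewrite /P mulmxBl mul1mx P'P' subrr. Qed.

Let PP : P *m P = P.
Proof. by rewrite {2}/P mulmxBr mulmx1 PP' subr0. Qed.

Notation ver u := (P *m u = u).
Notation hor u := (P *m u = 0).
Notation ipG := (ip G).

Let horE u : hor u -> P' *m u = u.
Proof.
by rewrite /P mulmxBl mul1mx => /eqP; rewrite subr_eq0 => /eqP.
Qed.

Let verD u : ver u -> D *m u = 0.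
Proof. by move=> <-; rewrite mulmxA DP mul0mx. Qed.

Let lift u : exists x, P' *m u = S *m x.
Proof. by exists (W *m (D *m u)); rewrite /P' !mulmxA. Qed.

Let ip_lift x v : ipG (S *m x) v = (x^T *m (D *m v)) 0 0.
Proof.
have SG : S^T *m G = D by rewrite -[LHS]trmxK trmx_mul trmxK Gsym GS trmxK.
by rewrite /ip trmx_mul -(mulmxA x^T S^T) SG mulmxA.
Qed.

Let Qv := along Q.
Let B u v := Qv u *m v.

Let QvP u : Qv u *m P + P *m Qv u = Qv u.
Proof. by rewrite /Qv -alongMr -alongMl -along_add; exact: along_eq. Qed.

(** The derivative of P P = P exchanges the kernel and the image of a projector; [Bhor] is the other
    half. *)
Let Bver u v : ver v -> hor (B u v).
Proof.
move=> hv; have : B u v = B u v + P *m B u v.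
  by rewrite {1}/B -QvP mulmxDl -!mulmxA hv.
by rewrite -{1}[B u v]addr0 => /addrI.
Qed.

Let Bhor u v : hor v -> ver (B u v).
Proof.
move=> hv; rewrite [in RHS]/B -QvP mulmxDl -(mulmxA _ P v) hv mulmx0 add0r.
by rewrite mulmxA.
Qed.

Let GB u v w : ipG (B u v) w = ipG v (B u w).
Proof.
rewrite /B (@ip_adj _ _ _ _ (Qv u)) //.
rewrite /Qv -alongMl linear_sum /= mulmx_suml; apply: eq_bigr => k _.
by rewrite GQ linearZ /= -scalemxAl.
Qed.

(** On vertical [v] the tensor [B] is minus the Hessian [H] seen through [D]; this is where the
    symmetry of second derivatives enters. *)
Let DB u v : ver v -> D *m B u v = - (along H u *m v).
Proof.
move=> hv; rewrite /B /Qv mulmxA -alongMl (along_eq u DQ).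
rewrite (along_eq u (fun k => esym (mulNmx (H k) P))) alongMr.
rewrite -mulmxA hv -mulNmx; congr (_ *m _).
by rewrite /along -sumrN; apply: eq_bigr => k _; rewrite scalerN.
Qed.

Let ver_J1 u : ver u -> ver (J1 *m u).
Proof. by move=> hu; rewrite mulmxA PJ1 -mulmxA hu. Qed.
Let ver_J2 u : ver u -> ver (J2 *m u).
Proof. by move=> hu; rewrite mulmxA PJ2 -mulmxA hu. Qed.
Let hor_J1 u : hor u -> hor (J1 *m u).
Proof. by move=> hu; rewrite mulmxA PJ1 -mulmxA hu mulmx0. Qed.
Let hor_J2 u : hor u -> hor (J2 *m u).
Proof. by move=> hu; rewrite mulmxA PJ2 -mulmxA hu mulmx0. Qed.

Let B_J1 u v : B u (J1 *m v) = J1 *m B u v.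
Proof. by rewrite /B /Qv mulmxA -alongMr (along_eq u QJ1) alongMl mulmxA. Qed.
Let B_J2 u v : B u (J2 *m v) = J2 *m B u v.
Proof. by rewrite /B /Qv mulmxA -alongMr (along_eq u QJ2) alongMl mulmxA. Qed.

Let hor_inj u : hor u -> D *m u = 0 -> u = 0.
Proof. by move=> /horE <- Du; rewrite mulmxA DP' in Du; rewrite /P' -mulmxA Du mulmx0. Qed.

(* The fibres are totally geodesic. *)
Let Tver u v : ver u -> ver v -> B u v = 0.
Proof.
apply: (quaternionic_bilinear_eq0 (A := fun u => ver u) (b := B) (s := 1) J11 J22 J12) => //;
  try by rewrite mulr1.
move=> {}u {}v hu hv; rewrite scale1r; apply/eqP; rewrite -subr_eq0; apply/eqP.
apply: hor_inj; first by rewrite mulmxBr !Bver ?subrr.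
by rewrite mulmxBr !DB// (along_sym Hsym) subrr.
Qed.

(* The horizontal distribution is integrable. *)
Let Ahor u v : hor u -> hor v -> B u v = 0.
Proof.
apply: (quaternionic_bilinear_eq0 (A := fun u => hor u) (b := B) (s := -1) J11 J22 J12) => //;
  try by rewrite mulrNN mulr1.
move=> {}u {}v hu hv; rewrite scaleN1r; apply/eqP; rewrite -addr_eq0; apply/eqP.
apply: (ip_eq0 Gpos).
(* The symmetric part [z] is vertical. By self-adjointness and [DB], its squared norm becomes minus
   the symmetrisation of [along H z *m S] evaluated on the vectors lifting to [u] and [v], which
   [HS] annihilates. *)
set z := B u v + B v u.
have hz : ver z by rewrite /z mulmxDr !Bhor.
have [x xE] := lift u; have [y yE] := lift v.
rewrite horE// in xE; rewrite horE// in yE.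
rewrite {1}/z ipDl !GB [X in ipG X (B u z)]yE [X in ipG X (B v z)]xE !ip_lift.
rewrite !DB// (along_sym Hsym u) (along_sym Hsym v) [in X in X + _]xE [in X in _ + X]yE.
have /(congr1 (fun M : 'M[R]_n => (y^T *m M *m x) 0 0)) := HS (verD hz).
rewrite mulmx0 mul0mx [RHS]mxE mulmxDr mulmxDl addmxE => h.
rewrite !mulmxN !oppmxE -opprD -[RHS]oppr0; congr (- _); rewrite -[RHS]h.
congr (_ + _); first by rewrite !mulmxA.
by rewrite -[LHS]trmx11 !trmx_mul !trmxK !mulmxA.
Qed.

Lemma vertical_projector_parallel k : Q k = 0.
Proof.
have all0 u w : B u w = 0.
  have split (v : 'cV[R]_m) : v = P *m v + P' *m v.
    by rewrite -mulmxDl /P subrK mul1mx.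
  have verP v : ver (P *m v) by rewrite mulmxA PP.
  have horP v : hor (P' *m v) by rewrite mulmxA PP' mul0mx.
  have BDl v v' z : B (v + v') z = B v z + B v' z by rewrite /B /Qv alongD mulmxDl.
  have BDr v z z' : B v (z + z') = B v z + B v z' by rewrite /B mulmxDr.
  (* The mixed terms reduce to the pure ones: [B v z] has the type of [v], and its squared norm is
     the product of [z] with [B v (B v z)], to which [Tver] or [Ahor] applies. *)
  have VH v z : ver v -> hor z -> B v z = 0.
    move=> hv hz; apply: (ip_eq0 Gpos); rewrite GB.
    by rewrite Tver ?ip0r//; exact: Bhor.
  have HV v z : hor v -> ver z -> B v z = 0.
    move=> hv hz; apply: (ip_eq0 Gpos); rewrite GB.
    by rewrite Ahor ?ip0r//; exact: Bver.
  rewrite (split u) (split w) BDl !BDr (Tver (verP u) (verP w)).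
  rewrite (Ahor (horP u) (horP w)) (VH _ _ (verP u) (horP w)).
  by rewrite (HV _ _ (horP u) (verP w)) !addr0.
apply/matrixP => i j; have := all0 (delta_mx k 0) (delta_mx j 0).
rewrite /B /Qv along_delta -colE => /colP/(_ i).
by rewrite !mxE.
Qed.

End vertical_projector.

Lemma sum_swap3 (V : zmodType) (m : nat) (F : 'I_m -> 'I_m -> 'I_m -> V) :
  \sum_j \sum_k \sum_l F j k l = \sum_j \sum_k \sum_l F l j k.
Proof.
under [RHS]eq_bigr do rewrite exchange_big /=.
by rewrite [RHS]exchange_big.
Qed.

(** * Curvature of a local product carrying a quaternionic structure *)

Section curvature_algebra.
Variables (R : realFieldType) (m : nat).
Implicit Types u v w x y z : 'cV[R]_m.
Variable Rm : 'I_m -> 'I_m -> 'M[R]_m.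

Definition curv u v : 'M[R]_m := \sum_j \sum_k (u j 0 * v k 0) *: Rm j k.

Lemma curv_mul u v w :
  curv u v *m w = \sum_j \sum_k \sum_l (u j 0 * v k 0 * w l 0) *: col l (Rm j k).
Proof.
rewrite /curv mulmx_suml; apply: eq_bigr => j _; rewrite mulmx_suml.
apply: eq_bigr => k _; rewrite -scalemxAl.
have -> : Rm j k *m w = \sum_l w l 0 *: col l (Rm j k).
  apply/colP => i; rewrite mxE summxE; apply: eq_bigr => l _.
  by rewrite !mxE mulrC.
by rewrite scaler_sumr; apply: eq_bigr => l _; rewrite scalerA.
Qed.

Hypothesis Ranti : forall j k, Rm j k = - Rm k j.
Hypothesis bianchi : forall j k l,
  col l (Rm j k) + col j (Rm k l) + col k (Rm l j) = 0.

Lemma curvC u v : curv u v = - curv v u.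
Proof.
rewrite /curv exchange_big /= -sumrN; apply: eq_bigr => j _; rewrite -sumrN.
by apply: eq_bigr => k _; rewrite Ranti scalerN mulrC.
Qed.

Lemma curv_bianchi u v w :
  curv u v *m w + curv v w *m u + curv w u *m v = 0.
Proof.
rewrite !curv_mul.
have e2 := sum_swap3 (fun j k l => (v j 0 * w k 0 * u l 0) *: col l (Rm j k)).
rewrite (sum_swap3 (fun j k l => (v l 0 * w j 0 * u k 0) *: col k (Rm l j))) in e2.
have e3 := sum_swap3 (fun j k l => (w j 0 * u k 0 * v l 0) *: col l (Rm j k)).
rewrite e2 e3 -!big_split; apply: big1 => j _; rewrite -!big_split; apply: big1 => k _.
rewrite -!big_split; apply: big1 => l _ /=.
have -> : v k 0 * w l 0 * u j 0 = u j 0 * v k 0 * w l 0 by ring.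
have -> : w l 0 * u j 0 * v k 0 = u j 0 * v k 0 * w l 0 by ring.
by rewrite -!scalerDr bianchi scaler0.
Qed.

Variables (G P : 'M[R]_m) (d : nat) (J : 'I_d -> 'M[R]_m).
Hypothesis Gsym : G^T = G.
Hypothesis Gpos : forall u : 'cV[R]_m, u != 0 -> 0 < (u^T *m G *m u) 0 0.
Hypothesis GR : forall j k, G *m Rm j k = - ((Rm j k)^T *m G).
Hypothesis PP : P *m P = P.
Hypothesis RP : forall j k, Rm j k *m P = P *m Rm j k.
Hypothesis JJ : forall b, J b *m J b = - 1%:M.
Hypothesis JC : forall b c, b != c -> J b *m J c = - (J c *m J b).
Hypothesis PJ : forall b, P *m J b = J b *m P.
Variable F : 'I_m -> 'I_m -> 'M[R]_d.
Hypothesis RJ : forall j k b,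
  Rm j k *m J b - J b *m Rm j k = \sum_c F j k c b *: J c.
Variables u0 v0 : 'cV[R]_m.
Hypotheses (u0_neq0 : u0 != 0) (v0_neq0 : v0 != 0).
Hypotheses (Pu0 : P *m u0 = 0) (Pv0 : P *m v0 = v0).

Notation ver u := (P *m u = u).
Notation hor u := (P *m u = 0).
Notation ipG := (ip G).

Let curvP u v w : P *m (curv u v *m w) = curv u v *m (P *m w).
Proof.
rewrite !mulmxA; congr (_ *m _); rewrite /curv mulmx_sumr mulmx_suml.
apply: eq_bigr => j _; rewrite mulmx_sumr mulmx_suml.
by apply: eq_bigr => k _; rewrite -scalemxAl -scalemxAr RP.
Qed.

Let ip_curv u v w z : ipG (curv u v *m w) z = - ipG w (curv u v *m z).
Proof.
rewrite -ipNr -mulNmx; apply: esym; apply: ip_adj.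
have tr : (curv u v)^T = \sum_j \sum_k (u j 0 * v k 0) *: (Rm j k)^T.
  rewrite /curv linear_sum; apply: eq_bigr => j _ /=; rewrite linear_sum.
  by apply: eq_bigr => k _; rewrite linearZ.
rewrite tr mulmxN /curv mulmx_sumr mulmx_suml -sumrN.
apply: eq_bigr => j _; rewrite mulmx_sumr mulmx_suml -sumrN.
by apply: eq_bigr => k _; rewrite -scalemxAl -scalemxAr GR scalerN opprK.
Qed.

(** Curvature commutes with [P], so [P] kills the two Bianchi terms applied to horizontal vectors
    and keeps the third. *)
Let curv_hhv x y v : hor x -> hor y -> ver v -> curv x y *m v = 0.
Proof.
move=> hx hy hv; have := curv_bianchi x y v.
move=> /(congr1 (mulmx P)); rewrite !mulmxDr !curvP hx hy hv !mulmx0 !addr0.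
by [].
Qed.

(** Here [P] fixes the two Bianchi terms applied to vertical vectors and kills the third; those two
    therefore sum to zero, and so does the remaining one. *)
Let curv_vvh u v x : ver u -> ver v -> hor x -> curv u v *m x = 0.
Proof.
move=> hu hv hx; have b := curv_bianchi u v x.
have := congr1 (mulmx P) b; rewrite !mulmxDr !curvP hu hv hx !mulmx0 add0r => b2.
by move: b; rewrite -addrA b2 addr0.
Qed.

(* <R(x,u)y,z> is symmetric in x, y by Bianchi and skew in y, z. *)
Let curv_hvh x u y : hor x -> ver u -> hor y -> curv x u *m y = 0.
Proof.
move=> hx hu hy.
have sym (a b : 'cV[R]_m) : hor a -> hor b -> curv a u *m b = curv b u *m a.
  move=> ha hb; have := curv_bianchi a u b.
  rewrite (curv_hhv hb ha hu) addr0 (curvC u b) mulNmx => /eqP.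
  by rewrite subr_eq0 => /eqP.
pose t a b c := ipG (curv a u *m b) c.
have tsym (a b c : 'cV[R]_m) : hor a -> hor b -> t a b c = t b a c.
  by move=> ha hb; rewrite /t sym.
have tskew a b c : t a b c = - t a c b by rewrite /t ip_curv ipC.
have hz : hor (curv x u *m y) by rewrite curvP hy mulmx0.
apply: (ip_eq0 Gpos); rewrite -/(t x y _); move: (curv x u *m y) hz => z hz.
have e1 := tsym x y z hx hy.
have e2 := tskew y x z.
have e3 := tsym y z x hy hz.
have e4 := tskew z y x.
have e5 := tsym z x y hz hx.
have e6 := tskew x z y.
lra.
Qed.

Let Fv u v : 'M[R]_d := \sum_j \sum_k (u j 0 * v k 0) *: F j k.

Let curvJ u v b : curv u v *m J b - J b *m curv u v = \sum_c Fv u v c b *: J c.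
Proof.
rewrite /curv mulmx_suml mulmx_sumr -sumrB.
under [RHS]eq_bigr do rewrite summxE scaler_suml.
rewrite [RHS]exchange_big; apply: eq_bigr => j _ /=.
rewrite mulmx_suml mulmx_sumr -sumrB.
under [RHS]eq_bigr do rewrite summxE scaler_suml.
rewrite [RHS]exchange_big; apply: eq_bigr => k _ /=.
rewrite -scalemxAl -scalemxAr -scalerBr RJ scaler_sumr.
by apply: eq_bigr => c _; rewrite mxE scalerA.
Qed.

(** The commutator of [curv u v] with [J b] lies in the span of the [J c], so by [span_J_eq0] it
    vanishes once it kills one nonzero [w]. *)
Let Fv_eq0 u v w : w != 0 -> (forall b, curv u v *m (J b *m w) = 0) ->
  curv u v *m w = 0 -> Fv u v = 0.
Proof.
move=> w0 hJ hw; apply/matrixP => c b; rewrite [RHS]mxE.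
apply: (span_J_eq0 JJ JC w0 (x := fun c => Fv u v c b)).
by rewrite -curvJ mulmxBl -!mulmxA hw mulmx0 hJ subrr.
Qed.

Let ver_J b u : ver u -> ver (J b *m u).
Proof. by move=> hu; rewrite mulmxA PJ -mulmxA hu. Qed.
Let hor_J b u : hor u -> hor (J b *m u).
Proof. by move=> hu; rewrite mulmxA PJ -mulmxA hu mulmx0. Qed.

(** Each block is tested where the curvature is already known to vanish: pairs of horizontal vectors
    on [v0], all other pairs on [u0]. The [J b] preserve the type of the test vector. *)
Lemma span_curvature_eq0 j k : F j k = 0.
Proof.
have FE : F j k = Fv (delta_mx j 0) (delta_mx k 0).
  rewrite /Fv (bigD1 j)//= [X in _ + X]big1 => [|i ij]; last first.
    by apply: big1 => l _; rewrite mxE (negPf ij) mul0r scale0r.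
  rewrite addr0 (bigD1 k)//= [X in _ + X]big1 => [|i ik]; last first.
    by rewrite [X in _ * X]mxE (negPf ik) mulr0 scale0r.
  by rewrite !mxE !eqxx mul1r scale1r addr0.
have FvDl u u' v : Fv (u + u') v = Fv u v + Fv u' v.
  rewrite /Fv -big_split; apply: eq_bigr => i _; rewrite -big_split.
  by apply: eq_bigr => l _; rewrite mxE mulrDl scalerDl.
have FvDr u v v' : Fv u (v + v') = Fv u v + Fv u v'.
  rewrite /Fv -big_split; apply: eq_bigr => i _; rewrite -big_split.
  by apply: eq_bigr => l _; rewrite mxE mulrDr scalerDl.
have hh x y : hor x -> hor y -> Fv x y = 0.
  move=> hx hy; apply: (Fv_eq0 v0_neq0); last exact: curv_hhv.
  by move=> b; apply: curv_hhv => //; exact: ver_J.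
have vv u v : ver u -> ver v -> Fv u v = 0.
  move=> hu hv; apply: (Fv_eq0 u0_neq0); last exact: curv_vvh.
  by move=> b; apply: curv_vvh => //; exact: hor_J.
have hv x u : hor x -> ver u -> Fv x u = 0.
  move=> hx hu; apply: (Fv_eq0 u0_neq0); last exact: curv_hvh.
  by move=> b; apply: curv_hvh => //; exact: hor_J.
have vh u x : ver u -> hor x -> Fv u x = 0.
  have curvC' y : curv u x *m y = - (curv x u *m y) by rewrite curvC mulNmx.
  move=> hu hx; apply: (Fv_eq0 u0_neq0) => [b|]; rewrite curvC' curv_hvh ?oppr0//.
  exact: hor_J.
have split (v : 'cV[R]_m) : v = P *m v + (v - P *m v) by rewrite addrC subrK.
have verP v : ver (P *m v) by rewrite mulmxA PP.
have horP v : hor (v - P *m v) by rewrite mulmxBr verP subrr.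
have all0 u x v y : ver u -> hor x -> ver v -> hor y -> Fv (u + x) (v + y) = 0.
  by move=> hu hx hv' hy; rewrite FvDl !FvDr vv// vh// hv// hh// !addr0.
by rewrite FE (split (delta_mx j 0)) (split (delta_mx k 0)); apply: all0.
Qed.

End curvature_algebra.

#[local] Opaque partial.

(** * Parallel frames of flat connections *)

Section matrix_norm.
Variable R : realType.

Lemma mx_norm_le (p q : nat) (A : 'M[R]_(p, q)) (M : R) :
  0 <= M -> (forall i j, `|A i j| <= M) -> `|A| <= M.
Proof.
move=> M0 h; rewrite [leLHS]/Num.Def.normr/= mx_normrE.
by apply: bigmax_le => // -[i j] _; exact: h.
Qed.

Lemma mx_norm_mul (p q s : nat) (A : 'M[R]_(p, q)) (B : 'M[R]_(q, s)) :
  `|A *m B| <= q%:R * `|A| * `|B|.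
Proof.
apply: mx_norm_le => [|i j]; first by rewrite !mulr_ge0.
rewrite mxE (le_trans (ler_norm_sum _ _ _))//.
apply: (@le_trans _ _ (\sum_(l < q) `|A| * `|B|)).
  by apply: ler_sum => l _; rewrite normrM ler_pM ?mx_normr_entry.
by rewrite sumr_const card_ord -mulrA mulr_natl.
Qed.

Lemma mx_norm1 (d : nat) : `|1%:M : 'M[R]_d| <= 1.
Proof.
by apply: mx_norm_le => // i j; rewrite mxE; case: (_ == _); rewrite ?normr1 ?normr0.
Qed.

Lemma norm_sum_scale (m p q : nat) (w : 'I_m -> R) (A : 'I_m -> 'M[R]_(p, q)) r M :
  (forall j, `|w j| <= r) -> (forall j, `|A j| <= M) ->
  `|\sum_j w j *: A j| <= m%:R * r * M.
Proof.
move=> wr AM; rewrite (le_trans (ler_norm_sum _ _ _))//.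
apply: (@le_trans _ _ (\sum_(l < m) r * M)).
  by apply: ler_sum => l _; rewrite normrZ ler_pM.
by rewrite sumr_const card_ord -mulrA mulr_natl.
Qed.

End matrix_norm.

(** With [a], [b] the cross derivatives of the connection matrices and [h] an iterate, flatness
    trades [a - b] for a commutator, whose terms complete [dj] and [dk] to covariant derivatives of
    [h]. *)
Lemma flat_commutator (R : realType) d (a b Tj Tk h dj dk : 'M[R]_d) :
  a - b + Tj *m Tk - Tk *m Tj = 0 ->
  a *m h + Tk *m dj - (b *m h + Tj *m dk) =
  Tk *m (dj + Tj *m h) - Tj *m (dk + Tk *m h).
Proof.
move=> flat; have -> : a = b - Tj *m Tk + Tk *m Tj.
  by apply/eqP; rewrite -subr_eq0 -[X in _ == X]flat; apply/eqP; mx_abel.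
rewrite !(mulmxDr, mulmxDl, mulNmx) !mulmxA; mx_abel.
Qed.

(** * Picard iteration along rays for dF = - Th F *)

Section picard.
Variables (R : realType) (m d : nat).
Local Notation E := 'cV[R]_m.
Local Notation e_ k := (delta_mx k 0 : E).
Variables (c : E) (r : R).
Hypothesis r0 : 0 < r.
Local Notation B := (ball c r).
Let oB : open B := @oB R m c r.

Definition ray_average_mx p q a (A : E -> 'M[R]_(p, q)) (x : E) : 'M[R]_(p, q) :=
  \matrix_(i, j) ray_average c a (fun z => A z i j) x.

Lemma smooth_ray_average_mx p q a (A : E -> 'M[R]_(p, q)) :
  smooth_on B A -> smooth_on B (ray_average_mx a A).
Proof.
move=> sA; apply/(smooth_mxP oB) => i j.
have := smooth_ray_average a (smooth_entry oB i j sA).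
by apply: (smooth_on_eq oB) => x _; rewrite mxE.
Qed.

Lemma partial_ray_average_mx p q a (A : E -> 'M[R]_(p, q)) k x :
  smooth_on B A -> B x ->
  partial k (ray_average_mx a A) x = ray_average_mx a.+1 (partial k A) x.
Proof.
move=> sA Bx; have sK := smooth_ray_average_mx a sA.
apply/matrixP => i j; apply: etrans (esym (partial_entry k i j sK Bx)) _.
have -> : (fun z => ray_average_mx a A z i j) = ray_average c a (fun z => A z i j).
  by apply/funext => z; rewrite mxE.
have [_ val] := ray_average_partial a k (smooth_entry oB i j sA) Bx.
apply: etrans val _; rewrite [RHS]mxE; apply: (ray_average_eq _ Bx) => z Bz.
exact: partial_entry sA Bz.
Qed.

Lemma ray_average_mx_bound p q a (A : E -> 'M[R]_(p, q)) x M :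
  smooth_on B A -> B x -> (forall z, B z -> `|A z| <= M) ->
  `|ray_average_mx a A x| <= M.
Proof.
move=> sA Bx AM; have M0 : 0 <= M by apply: le_trans (AM x Bx).
apply: mx_norm_le => // i j; rewrite mxE; apply: (@ray_average_bound _ _ c r) => //.
  by move=> z; exact: (smooth_continuous (smooth_entry oB i j sA)).
by move=> t t01; apply: le_trans (mx_normr_entry _ _ _) (AM _ _); exact: ray_ball.
Qed.

Lemma ray_average_mxB p q a (A A' : E -> 'M[R]_(p, q)) x :
  smooth_on B A -> smooth_on B A' -> B x ->
  ray_average_mx a (fun z => A z - A' z) x = ray_average_mx a A x - ray_average_mx a A' x.
Proof.
move=> sA sA' Bx; apply/matrixP => i j; rewrite !mxE.
have cA z : B z -> {for z, continuous (fun z => A z i j)}.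
  exact: (smooth_continuous (smooth_entry oB i j sA)).
have cA' z : B z -> {for z, continuous (fun z => A' z i j)}.
  exact: (smooth_continuous (smooth_entry oB i j sA')).
rewrite -(ray_averageB _ cA cA' Bx); apply: (ray_average_eq _ Bx) => z _.
by rewrite !mxE.
Qed.

Lemma ray_average_mx_eq p q a (A A' : E -> 'M[R]_(p, q)) x :
  B x -> (forall z, B z -> A z = A' z) ->
  ray_average_mx a A x = ray_average_mx a A' x.
Proof.
move=> Bx AA; apply/matrixP => i j; rewrite !mxE.
by apply: (ray_average_eq _ Bx) => z Bz; rewrite AA.
Qed.

Lemma radial_primitive_mx p q (A : E -> 'M[R]_(p, q)) x : smooth_on B A -> B x ->
  A x = ray_average_mx 0 A x
    + \sum_j (x - c) j 0 *: ray_average_mx 1 (partial j A) x.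
Proof.
move=> sA Bx; apply/matrixP => i j.
rewrite (radial_primitive (smooth_entry oB i j sA) Bx) [RHS]mxE [in RHS]mxE.
congr (_ + _); rewrite summxE; apply: eq_bigr => l _; rewrite [RHS]mxE; congr (_ * _).
rewrite [RHS]mxE; apply: (ray_average_eq _ Bx) => z Bz.
exact: partial_entry sA Bz.
Qed.

Variable Th : 'I_m -> E -> 'M[R]_d.
Hypothesis sTh : forall k, smooth_on B (Th k).
Hypothesis flat : forall j k x, B x ->
  partial j (Th k) x - partial k (Th j) x + Th j x *m Th k x - Th k x *m Th j x = 0.
Variable C : R.
Hypothesis ThC : forall k x, B x -> `|Th k x| <= C.
Hypothesis C0 : 0 <= C.
Hypothesis small : m%:R * r * (d%:R * C) <= 4^-1.

(** The fixed point equation is parallel transport along the rays from [c], with value 1 at [c]. In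
    [small], [m] counts the coordinates of size at most [r], and [d * C] bounds multiplication by
    [Th j] in the maximum norm. *)
Fixpoint picard (i : nat) : E -> 'M[R]_d :=
  if i is i'.+1 then fun x =>
    1%:M - \sum_j (x - c) j 0 *: ray_average_mx 0 (fun z => Th j z *m picard i' z) x
  else fun=> 1%:M.

Lemma picardS i x : picard i.+1 x = 1%:M
  - \sum_j (x - c) j 0 *: ray_average_mx 0 (fun z => Th j z *m picard i z) x.
Proof. by []. Qed.

Lemma smooth_radius j : smooth_on B (fun x : E => (x - c) j 0).
Proof.
have := smoothD oB (smooth_coord oB j) (smooth_cst oB (- c j 0 : R)).
by apply: (smooth_on_eq oB) => x _; rewrite !mxE.
Qed.

Lemma partial_radius j k x : B x ->
  partial k (fun x : E => (x - c) j 0) x = (j == k)%:R :> R.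
Proof.
move=> Bx; have sid : smooth_on B (fun x : E => x).
  by apply/(smooth_mxP oB) => i l; rewrite (ord1 l); exact: (smooth_coord oB).
have sxc : smooth_on B (fun x : E => x - c).
  by apply: (smoothD oB) => //; exact: (smooth_cst oB).
apply: etrans (partial_entry k j 0 sxc Bx) _.
rewrite (partialD k sid (smooth_cst oB _) Bx) partial_cst addr0.
have -> : partial k (fun x : E => x) x = e_ k by exact: derive_id.
by rewrite mxE eqxx andbT.
Qed.

Lemma smooth_picard i : smooth_on B (picard i).
Proof.
elim: i => [|i IH] /=; first exact: (smooth_cst oB).
apply: (smoothD oB); first exact: (smooth_cst oB).
apply: (smoothN oB); apply: (smooth_mx_sum oB) => j.
apply: (smooth_scale oB); first exact: smooth_radius.
by apply: smooth_ray_average_mx; exact: (smooth_mul oB).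
Qed.

Lemma smooth_Th_picard j i : smooth_on B (fun z => Th j z *m picard i z).
Proof. by apply: (smooth_mul oB) => //; exact: smooth_picard. Qed.

Lemma radius_le x j : B x -> `|(x - c) j 0| <= r.
Proof.
by move=> /(ball_cvP _ _ r0)/(_ j)/ltW; rewrite !mxE distrC.
Qed.

(** By [small], one step multiplies uniform distances by at most 1/4; the first step already has
    this size because [picard 0] is the identity. *)
Lemma picard_step i x : B x -> `|picard i.+1 x - picard i x| <= 4^-1 ^+ i.+1.
Proof.
have dC0 : 0 <= d%:R * C by rewrite mulr_ge0.
elim: i x => [|i IH] x Bx.
  rewrite /= (_ : _ - _ = - \sum_j (x - c) j 0 *: ray_average_mx 0 (fun z => Th j z *m 1%:M)
      x); last by rewrite addrAC subrr sub0r.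
  rewrite normrN expr1; apply: le_trans small.
  apply: norm_sum_scale => j; first exact: radius_le.
  apply: ray_average_mx_bound => //; first exact: (smooth_Th_picard j 0).
  move=> z Bz; rewrite (le_trans (mx_norm_mul _ _))// -[leRHS]mulr1.
  by rewrite ler_pM ?mulr_ge0 ?mx_norm1// ler_wpM2l// ThC.
have -> : picard i.+2 x - picard i.+1 x =
  - \sum_j (x - c) j 0 *: ray_average_mx 0 (fun z => Th j z *m (picard i.+1 z - picard i z)) x.
  rewrite (picardS i.+1 x) (picardS i x) opprD opprK addrACA subrr add0r addrC.
  rewrite -sumrB -sumrN; apply: eq_bigr => j _; rewrite -scalerBr -scalerN; congr (_ *: _).
  rewrite -opprB -ray_average_mxB//; [|exact: smooth_Th_picard..].
  apply: congr1; apply: ray_average_mx_eq Bx _ => z _.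
  exact: esym (mulmxBr _ _ _).
rewrite normrN exprS; apply: le_trans (ler_wpM2r _ small); last by rewrite exprn_ge0.
rewrite -[leRHS]mulrA; apply: norm_sum_scale => j; first exact: radius_le.
apply: ray_average_mx_bound => //.
  apply: (smooth_mul oB) => //; apply: (smoothD oB); first exact: smooth_picard.
  by apply: (smoothN oB); exact: smooth_picard.
move=> z Bz; rewrite (le_trans (mx_norm_mul _ _))//.
by rewrite ler_pM ?mulr_ge0 ?IH// ler_wpM2l// ThC.
Qed.

#[local] Opaque picard.

(** Covariant derivative of the iterate for the connection d + Th. The iteration is designed for the
    radial direction only, so the decay of the defects in every direction has to come from
    flatness. *)
Definition defect i k x := partial k (picard i) x + Th k x *m picard i x.

Lemma smooth_defect i k : smooth_on B (defect i k).
Proof.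
apply: (smoothD oB); last exact: smooth_Th_picard.
by apply: smooth_partial; exact: smooth_picard.
Qed.

(* Flatness turns the derivative of a Picard step into an average of the previous defects. *)
Lemma defectS i k x : B x -> defect i.+1 k x =
  \sum_j (x - c) j 0 *: ray_average_mx 1
    (fun z => Th k z *m defect i j z - Th j z *m defect i k z) x
  + Th k x *m (picard i.+1 x - picard i x).
Proof.
move=> Bx; rewrite /defect (mulmxBr (Th k x) (picard i.+1 x)).
suff E : partial k (picard i.+1) x + Th k x *m picard i x =
    \sum_j (x - c) j 0 *: ray_average_mx 1
      (fun z => Th k z *m defect i j z - Th j z *m defect i k z) x.
  by rewrite -E addrAC addrA subrK.
have sTp j : smooth_on B (fun z => Th j z *m picard i z) by exact: smooth_Th_picard.
have sK j := smooth_ray_average_mx 0 (sTp j).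
have sw j : smooth_on B (fun x => (x - c) j 0 *: ray_average_mx 0 (fun z => Th j z *m picard
    i z) x).
  by apply: (smooth_scale oB) => //; exact: smooth_radius.
have ssum := smooth_mx_sum oB (index_enum _) sw.
have -> : partial k (picard i.+1) x =
   - (ray_average_mx 0 (fun z => Th k z *m picard i z) x
      + \sum_j (x - c) j 0 *: ray_average_mx 1 (partial k (fun z => Th j z *m picard i z)) x).
  have -> : picard i.+1 = fun x => 1%:M
      + - \sum_j (x - c) j 0 *: ray_average_mx 0 (fun z => Th j z *m picard i z) x.
    by apply/funext => z; exact: picardS.
  rewrite (partialD k (smooth_cst oB _) (smoothN oB ssum) Bx) partial_cst add0r.
  rewrite (partialN k ssum Bx) (partial_mx_sum oB (index_enum _) k sw Bx); congr (- _).
  under eq_bigr => j _ do rewrite (partial_scale oB k (smooth_radius j) (sK j) Bx)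
      partial_radius// partial_ray_average_mx//.
  rewrite big_split /=; congr (_ + _).
  rewrite (bigD1 k)//= eqxx scale1r big1 ?addr0// => j jk.
  by rewrite (negPf jk) scale0r.
(* Differentiating the factor [(x - c) k 0] left a plain average of [Th k *m picard i]; the radial
   primitive writes [Th k *m picard i] itself as that average plus a radial sum, so the averages
   cancel. *)
rewrite (radial_primitive_mx (sTp k) Bx) opprD addrACA addNr add0r addrC -sumrB.
apply: eq_bigr => j _; rewrite -scalerBr; congr (_ *: _).
rewrite -ray_average_mxB//; [|exact: smooth_partial..].
apply: ray_average_mx_eq => // z Bz.
have sp := smooth_picard i.
rewrite (partial_mul oB j (sTh k) sp Bz) (partial_mul oB k (sTh j) sp Bz).
exact: flat_commutator (flat j k Bz).
Qed.

(** The right-hand side solves exactly a_0 = C and a_(i+1) = a_i / 2 + d C / 4^(i+1). The factor 1/2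
    is the 1/4 of [small] times the two products in [defectS]; the inhomogeneous term comes from
    [picard_step]. *)
Lemma defect_bound i k x : B x ->
  `|defect i k x| <= (C + d%:R * C) * 2^-1 ^+ i - d%:R * C * 4^-1 ^+ i.
Proof.
have dC0 : 0 <= d%:R * C by rewrite mulr_ge0.
elim: i k x => [|i IH] k x Bx.
  rewrite !expr0 !mulr1 addrK /defect.
  have -> : picard 0 = fun=> 1%:M by [].
  by rewrite partial_cst add0r mulmx1; exact: ThC.
have T0 : 0 <= (C + d%:R * C) * 2^-1 ^+ i - d%:R * C * 4^-1 ^+ i.
  by apply: le_trans (IH k x Bx).
rewrite defectS//.
apply: le_trans (ler_normD _ _) _.
apply: (@le_trans _ _ ((m%:R * r) * (2 * (d%:R * C * ((C + d%:R * C) * 2^-1 ^+ i - d%:R * C *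
    4^-1 ^+ i))) + d%:R * C * 4^-1 ^+ i.+1)).
  apply: lerD; last first.
    rewrite (le_trans (mx_norm_mul _ _))// ler_pM ?mulr_ge0 ?picard_step//.
    by rewrite ler_wpM2l// ThC.
  apply: norm_sum_scale => j; first exact: radius_le.
  apply: ray_average_mx_bound => //.
    apply: (smoothD oB); first by apply: (smooth_mul oB) => //; exact: smooth_defect.
    by apply: (smoothN oB); apply: (smooth_mul oB) => //; exact: smooth_defect.
  move=> z Bz; rewrite (le_trans (ler_normB _ _))// mulrDl mul1r.
  by rewrite lerD// (le_trans (mx_norm_mul _ _))// ler_pM ?mulr_ge0 ?IH// ler_wpM2l// ThC.
move: T0 small; set T := (X in 0 <= X); set P := m%:R * r; set Q := d%:R * C.
move=> T0 PQ.
have : P * (2 * (Q * T)) <= 2^-1 * T.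
  have -> : P * (2 * (Q * T)) = (P * Q) * (2 * T) by ring.
  have -> : 2^-1 * T = 4^-1 * (2 * T) by field.
  by rewrite ler_wpM2r// mulr_ge0.
rewrite /T -/Q !exprS; set u := 2^-1 ^+ i; set v := 4^-1 ^+ i => h.
have v0 : 0 <= v by rewrite exprn_ge0.
have Qv : 0 <= Q * v by rewrite mulr_ge0.
lra.
Qed.

Lemma picard_center i : picard i c = 1%:M.
Proof.
case: i => [|i] //; rewrite picardS big1 ?subr0// => j _.
by rewrite subrr mxE scale0r.
Qed.

Lemma half_pow_small (e : R) : 0 < e -> exists i : nat, 2^-1 ^+ i <= e.
Proof.
move=> e0; exists (Num.trunc e^-1).+1.
rewrite exprVn -lef_pV2 ?posrE ?invr_gt0 ?exprn_gt0// invrK.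
apply: (le_trans (ltW (truncnS_gt _))).
by rewrite -natrX ler_nat ltnW// ltn_expl.
Qed.

Lemma picard_limit : exists F : E -> 'M[R]_d,
  forall x, B x -> forall i, `|picard i x - F x| <= 4^-1 ^+ i.
Proof.
suff /choice[F FP] : forall x, exists A : 'M[R]_d,
    B x -> forall i, `|picard i x - A| <= 4^-1 ^+ i by exists F => x Bx; exact: FP.
move=> x; have [Bx|nB] := pselect (B x); last by exists 0.
have lim a b : exists l, forall i, `|picard i x a b - l| <= 4^-1 ^+ i.
  apply: geometric_limit => i; apply: le_trans (picard_step i Bx).
  by have := mx_normr_entry (picard i.+1 x - picard i x) a b; rewrite !mxE.
exists (\matrix_(a, b) sval (cid (lim a b))) => _ i.
apply: mx_norm_le => [|a b]; first by rewrite exprn_ge0.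
by rewrite !mxE; exact: (svalP (cid (lim a b))).
Qed.

(** The iterates converge uniformly by [picard_limit], and their partials do so by [defect_bound],
    so the limit solves the equation. The equation then raises its regularity. *)
Lemma small_ball_parallel_frame : exists F : E -> 'M[R]_d,
  [/\ smooth_on B F, F c = 1%:M
    & forall k x, B x -> partial k F x = - (Th k x *m F x)].
Proof.
have [F FP] := picard_limit; exists F.
have dC0 : 0 <= d%:R * C by rewrite mulr_ge0.
have pow42 i : 4^-1 ^+ i <= 2^-1 ^+ i :> R.
  by rewrite lerXn2r ?nnegrE// lef_pV2 ?posrE// ler_nat.
have Fe (e : R) : 0 < e -> exists i, 4^-1 ^+ i <= e /\
    (C + d%:R * C) * 2^-1 ^+ i <= e.
  move=> e0; have K0 : 0 < C + d%:R * C + 1 by rewrite ltr_wpDl// addr_ge0.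
  have [i hi] := half_pow_small (divr_gt0 e0 K0); exists i.
  have p0 : 0 < 2^-1 ^+ i :> R by rewrite exprn_gt0.
  rewrite ler_pdivlMr// in hi; have := pow42 i.
  have q0 : 0 <= (C + d%:R * C) * 2^-1 ^+ i by apply: mulr_ge0; [exact: addr_ge0|exact: ltW].
  rewrite mulrC mulrDl mul1r in hi.
  by split; lra.
have cF x a b : B x -> {for x, continuous (fun z => F z a b)}.
  move=> Bx; apply: (uniform_limit_continuous oB Bx) => e /Fe[i [ie _]].
  exists (fun z => picard i z a b); split.
    by move=> z; exact: (smooth_continuous (smooth_entry oB a b (smooth_picard i))).
  move=> z Bz; apply: le_trans ie; apply: le_trans (FP z Bz i).
  by have := mx_normr_entry (picard i z - F z) a b; rewrite !mxE.
have dF k x a b : B x ->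
    is_derive x (e_ k) (fun z => F z a b) ((- (Th k x *m F x)) a b).
  move=> Bx; apply: (@uniform_limit_derive _ _ _ oB (fun z => F z a b)
    (fun z => (- (Th k z *m F z)) a b)) => //.
    have cTF : Ck_on 0 B (fun z => Th k z *m F z).
      apply/(Ck_on_mxP _ _ oB) => p q.
      have h l : Ck_on 0 B (fun z => Th k z p l * F z l q).
        apply: (Ck_onM oB); first exact: (smooth_entry oB p l (sTh k) 0).
        by split=> // z; exact: cF.
      by apply: Ck_on_eq (Ck_on_sum (index_enum _) oB h) => // z _; rewrite mxE.
    have /(Ck_on_mxP _ _ oB)/(_ a b)/(Ck_onN oB)[c0 _] := cTF.
    apply: continuous_eq_on oB Bx _ (c0 x Bx) => z _.
    by rewrite [RHS]mxE.
  move=> e /Fe[i [ie Ke]]; exists (fun z => picard i z a b).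
  have sp := smooth_picard i.
  split=> z Bz.
  - exact: (smooth_derivable (smooth_entry oB a b sp)).
  - apply: le_trans ie; apply: le_trans (FP z Bz i).
    by have := mx_normr_entry (picard i z - F z) a b; rewrite !mxE.
  - rewrite (partial_entry k a b sp Bz); apply: le_trans Ke.
    have -> : partial k (picard i) z a b - (- (Th k z *m F z)) a b =
        (defect i k z - Th k z *m (picard i z - F z)) a b.
      by rewrite mulmxBr /defect !(addmxE, oppmxE); ring.
    apply: le_trans (mx_normr_entry _ _ _) _.
    rewrite (le_trans (ler_normB _ _))//.
    (* The negative term of this bound cancels the error of replacing the iterate by its limit [F],
       leaving the quantity controlled by [Ke]. *)
    have h1 := defect_bound i k Bz.
    have h2 : `|Th k z *m (picard i z - F z)| <= d%:R * C * 4^-1 ^+ i.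
      rewrite (le_trans (mx_norm_mul _ _))// ler_pM ?mulr_ge0 ?FP//.
      by rewrite ler_wpM2l// ThC.
    lra.
have pF k x : B x -> partial k F x = - (Th k x *m F x).
  move=> Bx; apply/matrixP => a b.
  rewrite partial_mxE; first by case: (dF k x a b Bx).
  by apply/derivable_mxP => i j; case: (dF k x i j Bx).
have derF k x : B x -> derivable F x (e_ k).
  by move=> Bx; apply/derivable_mxP => i j; case: (dF k x i j Bx).
split=> //.
(* Bootstrap: if [F] is of class C^n, so is [Th k *m F], hence so are the partials of [F]. *)
- elim=> [|n IH]; first by split=> // x Bx; apply/mx_continuousP => a b; exact: cF.
  split; first by move=> x Bx; apply/mx_continuousP => a b; exact: cF.
  move=> k; split; first by move=> x Bx; exact: derF.
  have CTF : Ck_on n B (fun z => - (Th k z *m F z)).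
    apply/(Ck_on_mxP _ _ oB) => p q.
    have h l : Ck_on n B (fun z => Th k z p l * F z l q).
      apply: (Ck_onM oB); first exact: (smooth_entry oB p l (sTh k) n).
      by have /(Ck_on_mxP _ _ oB) := IH; apply.
    apply: Ck_on_eq (Ck_onN oB (Ck_on_sum (index_enum _) oB h)) => // z _.
    by rewrite !mxE.
  by apply: Ck_on_eq CTF => // x Bx; rewrite pF.
- apply/eqP; rewrite eq_sym -subr_eq0 -normr_le0; apply/ler_addgt0Pl => e e0.
  have [i [ie _]] := Fe _ e0; rewrite addr0 (le_trans _ ie)//.
  by have := FP c (ballxx _ r0) i; rewrite picard_center.
Qed.

End picard.

Lemma flat_parallel_frame (R : realType) (m d : nat) (O : set 'cV[R]_m)
    (c : 'cV[R]_m) (Th : 'I_m -> 'cV[R]_m -> 'M[R]_d) :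
  open O -> O c -> (forall k, smooth_on O (Th k)) ->
  (forall j k x, O x ->
    partial j (Th k) x - partial k (Th j) x + Th j x *m Th k x - Th k x *m Th j x = 0) ->
  exists2 r : R, 0 < r & ball c r `<=` O /\
    exists F : 'cV[R]_m -> 'M[R]_d,
    [/\ smooth_on (ball c r) F, F c = 1%:M
      & forall k x, ball c r x -> partial k F x = - (Th k x *m F x)].
Proof.
move=> oO Oc sTh flat.
pose C := \sum_k `|Th k c| + 1.
have C1 : 1 <= C by rewrite lerDr sumr_ge0.
have C0 : 0 <= C by rewrite (le_trans _ C1).
have nearC : \forall x \near c, O x /\ forall k, `|Th k x| <= C.
  have hO : \forall x \near c, O x by exact: open_nbhs_nbhs.
  have FF := nbhs_filter c.
  have hC : \forall x \near c, forall k, `|Th k x| <= C.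
    apply: (filter_forall (F := nbhs c)) => k.
    have /cvgrPdist_lt/(_ _ ltr01) := smooth_continuous (sTh k) Oc.
    apply: filterS => x h; rewrite -(subrKC (Th k c) (Th k x)).
    rewrite (le_trans (ler_normD _ _))// lerD//; last by rewrite distrC ltW.
    by rewrite (bigD1 k)//= lerDl sumr_ge0.
  exact: filterI.
have /nbhs_ballP[q q0 qP] := nearC.
(* Chosen so that [r * K <= 1] implies [small]; the summand 1 keeps [K] positive. *)
pose K := m%:R * (d%:R * C) * 4 + 1.
have K0 : 0 < K by rewrite ltr_wpDl// !mulr_ge0.
pose r := Num.min q K^-1.
have r0 : 0 < r by rewrite lt_min q0 invr_gt0.
have rq : ball c r `<=` ball c q by apply: le_ball; rewrite ge_min lexx.
have small : m%:R * r * (d%:R * C) <= 4^-1.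
  have rK : r * K <= 1 by rewrite -ler_pdivlMr// mul1r ge_min lexx orbT.
  have e1 : m%:R * r * (d%:R * C) = (r * K - r) / 4 by rewrite /K; field.
  rewrite e1; lra.
exists r => //; split; first by move=> x /rq /qP[].
apply: (@small_ball_parallel_frame _ _ _ c r r0 Th _ _ C) => //.
- by move=> k n; apply: Ck_on_sub _ (sTh k n) => x /rq /qP[].
- by move=> j k x /rq /qP[Ox _]; exact: flat.
- by move=> k x /rq /qP[_]; apply.
Qed.

(** * Levi-Civita connection in a chart *)

(* The identities of this section are stated for free matrix variables: ring
   would otherwise compare partial derivatives up to conversion. *)
Section matrix_identities.
Variables (R : realFieldType) (m : nat).
Implicit Types A Aj Ak p g Gj Gk dGjk dGkj : 'M[R]_m.

Lemma commutator_identity A Aj Ak p Gj Gk dGjk dGkj :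
  (dGjk - dGkj + Gj *m Gk - Gk *m Gj) *m A - A *m (dGjk - dGkj + Gj *m Gk - Gk *m Gj) =
  (p + (dGjk *m A + Gk *m Aj) - (Aj *m Gk + A *m dGjk)
   + Gj *m (Ak + Gk *m A - A *m Gk) - (Ak + Gk *m A - A *m Gk) *m Gj)
  - (p + (dGkj *m A + Gj *m Ak) - (Ak *m Gj + A *m dGkj)
   + Gk *m (Aj + Gj *m A - A *m Gj) - (Aj + Gj *m A - A *m Gj) *m Gk).
Proof. rewrite !(mulmxDr, mulmxDl, mulmxN, mulNmx) !mulmxA; mx_abel. Qed.

Lemma metric_identity g Gj Gk dGjk dGkj :
  dGjk^T *m g + Gk^T *m (Gj^T *m g + g *m Gj)
    + ((Gj^T *m g + g *m Gj) *m Gk + g *m dGjk) =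
  dGkj^T *m g + Gj^T *m (Gk^T *m g + g *m Gk)
    + ((Gk^T *m g + g *m Gk) *m Gj + g *m dGkj) ->
  g *m (dGjk - dGkj + Gj *m Gk - Gk *m Gj) =
  - ((dGjk - dGkj + Gj *m Gk - Gk *m Gj)^T *m g).
Proof.
have tr (a b c d : 'M[R]_m) : (a - b + c - d)^T = a^T - b^T + c^T - d^T.
  by apply/matrixP => i k; rewrite !mxE.
rewrite tr !trmx_mul !(mulmxDr, mulmxDl, mulmxN, mulNmx) !mulmxA => h.
apply/matrixP => a b; move/matrixP: h => /(_ a b).
by rewrite ?(addmxE, oppmxE); lra.
Qed.

End matrix_identities.

Section levi_civita.
Variables (R : realType) (m : nat).
Local Notation E := 'cV[R]_m.
Variables (U : set E) (oU : open U) (G : E -> 'M[R]_m).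
Hypothesis sG : smooth_on U G.
Hypothesis Gsym : forall x, U x -> (G x)^T = G x.
Hypothesis Gunit : forall x, U x -> G x \in unitmx.

(** Christoffel symbols of the first kind. Separating the inverse metric lets symmetry and metric
    compatibility be checked on expressions linear in the derivatives of [G]. *)
Definition lowered_christoffel (k : 'I_m) (x : E) : 'M[R]_m :=
  \matrix_(s, j) (2^-1 *
    (partial k G x s j + partial j G x k s - partial s G x k j)).

Definition chart_christoffel (k : 'I_m) (x : E) : 'M[R]_m :=
  invmx (G x) *m lowered_christoffel k x.

Local Notation Gam := chart_christoffel.

Lemma mul_christoffel k x : U x -> G x *m Gam k x = lowered_christoffel k x.
Proof. by move=> Ux; rewrite mulmxA mulmxV ?mul1mx ?Gunit. Qed.

Lemma partial_metric_sym k x i j : U x -> partial k G x i j = partial k G x j i.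
Proof.
move=> Ux; rewrite -(partial_entry k i j sG Ux) -(partial_entry k j i sG Ux).
apply: (partial_eq_on k oU Ux) => z Uz.
by rewrite -[in LHS](Gsym Uz) mxE.
Qed.

Lemma smooth_lowered k : smooth_on U (lowered_christoffel k).
Proof.
have se a b c : smooth_on U (fun x => partial a G x b c).
  by apply: (smooth_entry oU); exact: smooth_partial.
apply/(smooth_mxP oU) => s j.
have h := smoothM oU (smooth_cst oU (2^-1 : R))
  (smoothD oU (smoothD oU (se k s j) (se j k s))
     (smoothM oU (smooth_cst oU (-1 : R)) (se s k j))).
by apply: (smooth_on_eq oU) h => x _; rewrite mxE mulN1r.
Qed.

Lemma smooth_christoffel k : smooth_on U (Gam k).
Proof.
by apply: (smooth_mul oU); [exact: (smooth_invmx oU)|exact: smooth_lowered].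
Qed.

Lemma lowered_christoffel_sym k j s x : U x ->
  lowered_christoffel k x s j = lowered_christoffel j x s k.
Proof.
move=> Ux; rewrite !mxE; congr (_ * _).
have alg (d : 'I_m -> 'I_m -> 'I_m -> R) : (forall a b c, d a b c = d a c b) ->
    d k s j + d j k s - d s k j = d j s k + d k j s - d s j k.
  by move=> ds; rewrite (ds k s j) (ds j k s) (ds s k j); ring.
exact: (alg (fun a b c => partial a G x b c) (fun a b c => partial_metric_sym a b c Ux)).
Qed.

Lemma christoffel_sym k j l x : U x -> Gam k x l j = Gam j x l k.
Proof.
by move=> Ux; rewrite !mxE; apply: eq_bigr => s _; rewrite (lowered_christoffel_sym k).
Qed.

Lemma christoffel_compat k x : U x ->
  partial k G x = (Gam k x)^T *m G x + G x *m Gam k x.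
Proof.
move=> Ux; have -> : (Gam k x)^T *m G x = (G x *m Gam k x)^T.
  by rewrite (trmx_mul (G x)) Gsym.
rewrite mul_christoffel//; apply/matrixP => s j; rewrite [RHS]mxE [X in X + _]mxE.
rewrite [X in X + _]mxE [X in _ + X]mxE.
have alg (d : 'I_m -> 'I_m -> 'I_m -> R) : (forall a b c, d a b c = d a c b) ->
    d k s j = 2^-1 * (d k j s + d s k j - d j k s) + 2^-1 * (d k s j + d j k s - d s k j).
  by move=> ds; rewrite (ds k j s); field.
exact: (alg (fun a b c => partial a G x b c) (fun a b c => partial_metric_sym a b c Ux)).
Qed.

#[local] Opaque chart_christoffel.

(** Koszul's formula. It is stated for matrices at a single point so that symbols transported from
    another chart can be recognised without computing their inverse metric. *)
Lemma christoffel_unique (L : 'I_m -> 'M[R]_m) x : U x ->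
  (forall k j l, L k l j = L j l k) ->
  (forall k, partial k G x = (L k)^T *m G x + G x *m L k) ->
  forall k, L k = Gam k x.
Proof.
move=> Ux Lsym Lcompat k.
have -> : Gam k x = invmx (G x) *m lowered_christoffel k x by [].
rewrite -[LHS](mulKmx (Gunit Ux)); congr (_ *m _).
pose N k a b := (G x *m L k) a b.
have Nsym a s b : N a s b = N b s a.
  by rewrite /N !mxE; apply: eq_bigr => l _; rewrite Lsym.
have NG a s j : partial a G x s j = N a j s + N a s j.
  rewrite Lcompat addmxE; congr (_ + _).
  by rewrite -[in LHS](Gsym Ux) -trmx_mul mxE.
have alg (d M : 'I_m -> 'I_m -> 'I_m -> R) s j :
    (forall a b c, d a b c = M a c b + M a b c) ->
    (forall a b c, M a b c = M c b a) ->
    M k s j = 2^-1 * (d k s j + d j k s - d s k j).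
  by move=> dM Ms; rewrite !dM (Ms k j s) (Ms j s k) (Ms j k s); field.
apply/matrixP => s j; rewrite [RHS]mxE.
exact: (alg (fun a b c => partial a G x b c) N s j NG Nsym).
Qed.

Definition chart_nabla (k : 'I_m) (A : E -> 'M[R]_m) (x : E) : 'M[R]_m :=
  partial k A x + Gam k x *m A x - A x *m Gam k x.

Lemma smooth_chart_nabla k A : smooth_on U A -> smooth_on U (chart_nabla k A).
Proof.
move=> sA; have sk := smooth_christoffel k.
apply: (smoothD oU); last by apply: (smoothN oU); exact: (smooth_mul oU).
by apply: (smoothD oU); [exact: smooth_partial|exact: (smooth_mul oU)].
Qed.

Lemma chart_nablaM k A B x : smooth_on U A -> smooth_on U B -> U x ->
  chart_nabla k (fun z => A z *m B z) x =
  chart_nabla k A x *m B x + A x *m chart_nabla k B x.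
Proof.
move=> sA sB Ux; rewrite /chart_nabla (partial_mul oU k sA sB Ux).
rewrite !(mulmxDr, mulmxDl, mulmxN, mulNmx) !mulmxA; mx_abel.
Qed.

Lemma chart_nablaD k A B x : smooth_on U A -> smooth_on U B -> U x ->
  chart_nabla k (fun z => A z + B z) x = chart_nabla k A x + chart_nabla k B x.
Proof.
move=> sA sB Ux; rewrite /chart_nabla (partialD k sA sB Ux).
by rewrite !(mulmxDr, mulmxDl); mx_abel.
Qed.

Lemma chart_nabla_scale k (f : E -> R) A x : smooth_on U f -> smooth_on U A -> U x ->
  chart_nabla k (fun z => f z *: A z) x =
  partial k f x *: A x + f x *: chart_nabla k A x.
Proof.
move=> sf sA Ux; rewrite /chart_nabla (partial_scale oU k sf sA Ux).
by rewrite -scalemxAr -scalemxAl !(scalerDr, scalerN) !addrA.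
Qed.

Lemma chart_nabla_cst_scalar k (a : R) x : chart_nabla k (fun=> a%:M) x = 0.
Proof. by rewrite /chart_nabla partial_cst add0r scalar_mxC subrr. Qed.

Lemma chart_nabla_eq k A B x : U x -> (forall z, U z -> A z = B z) ->
  chart_nabla k A x = chart_nabla k B x.
Proof.
by move=> Ux AB; rewrite /chart_nabla (partial_eq_on k oU Ux AB) AB.
Qed.

Lemma chart_nabla_sum k (I : Type) (s : seq I) (f : I -> E -> R)
    (A : I -> E -> 'M[R]_m) x :
  (forall i, smooth_on U (f i)) -> (forall i, smooth_on U (A i)) -> U x ->
  chart_nabla k (fun z => \sum_(i <- s) f i z *: A i z) x =
  \sum_(i <- s) (partial k (f i) x *: A i x + f i x *: chart_nabla k (A i) x).
Proof.
move=> sf sA Ux; elim: s => [|i s IH].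
  rewrite big_nil -[RHS](chart_nabla_cst_scalar k 0 x).
  by apply: chart_nabla_eq => // z _; rewrite big_nil raddf0.
have sfA i := smooth_scale oU (sf i) (sA i).
rewrite big_cons -IH -chart_nabla_scale//.
rewrite -chart_nablaD//; last exact: (smooth_mx_sum oU s sfA).
by apply: chart_nabla_eq => // z _; rewrite big_cons.
Qed.

Definition curvature j k x : 'M[R]_m :=
  partial j (Gam k) x - partial k (Gam j) x
  + Gam j x *m Gam k x - Gam k x *m Gam j x.

Lemma curvature_anti j k x : curvature j k x = - curvature k j x.
Proof.
have alg (a b p q : 'M[R]_m) : a - b + p - q = - (b - a + q - p) by mx_abel.
exact: alg.
Qed.

(** Symmetry of the Christoffel symbols in their lower indices makes the derivative terms and the
    quadratic terms cancel in pairs. *)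
Lemma curvature_bianchi j k l x : U x ->
  col l (curvature j k x) + col j (curvature k l x) + col k (curvature l j x) = 0.
Proof.
move=> Ux.
have ds a b c i : partial a (Gam b) x i c = partial a (Gam c) x i b.
  apply: etrans (esym (partial_entry a i c (smooth_christoffel b) Ux)) _.
  apply: etrans _ (partial_entry a i b (smooth_christoffel c) Ux).
  by apply: (partial_eq_on a oU Ux) => z Uz; exact: christoffel_sym.
have ms a b c i : (Gam a x *m Gam b x) i c = (Gam a x *m Gam c x) i b.
  rewrite [LHS]mxE [RHS]mxE; apply: eq_bigr => s _.
  by rewrite (christoffel_sym b).
have colE (A : 'M[R]_m) a i : col a A i 0 = A i a by rewrite mxE.
have alg (d M : 'I_m -> 'I_m -> 'I_m -> R) :
    (forall a b c, d a b c = d a c b) -> (forall a b c, M a b c = M a c b) ->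
    d j k l - d k j l + M j k l - M k j l + (d k l j - d l k j + M k l j - M l k j)
    + (d l j k - d j l k + M l j k - M j l k) = 0.
  move=> hd hM; rewrite (hd j k l) (hd k l j) (hd l j k) (hM j k l) (hM k l j) (hM l j k).
  by ring.
apply/colP => i; rewrite 2!addmxE !colE [RHS]mxE /curvature 9!addmxE 6!oppmxE.
exact: (alg (fun a b c => partial a (Gam b) x i c)
  (fun a b c => (Gam a x *m Gam b x) i c)).
Qed.

(** Ricci identity. The iterated [chart_nabla] treats the direction index as a parameter and does
    not correct it; since coordinate fields commute, no further term appears. *)
Lemma curvature_commutator j k A x : smooth_on U A -> U x ->
  curvature j k x *m A x - A x *m curvature j k x =
  chart_nabla j (chart_nabla k A) x - chart_nabla k (chart_nabla j A) x.
Proof.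
move=> sA Ux.
have dn a b : partial a (chart_nabla b A) x = partial a (partial b A) x
   + (partial a (Gam b) x *m A x + Gam b x *m partial a A x)
   - (partial a A x *m Gam b x + A x *m partial a (Gam b) x).
  have sb := smooth_christoffel b.
  have s1 := smooth_partial b sA.
  have s2 := smooth_mul oU sb sA; have s3 := smooth_mul oU sA sb.
  rewrite (partialD a (smoothD oU s1 s2) (smoothN oU s3) Ux).
  rewrite (partialD a s1 s2 Ux) (partialN a s3 Ux).
  by rewrite (partial_mul oU a sb sA Ux) (partial_mul oU a sA sb Ux).
rewrite [chart_nabla j _ x]/chart_nabla [chart_nabla k (chart_nabla j A) x]/chart_nabla.
rewrite (dn j k) (dn k j) (partial_comm_mx oU j k sA Ux).
exact: commutator_identity.
Qed.

(** Differentiate metric compatibility once more and compare the two orders of the second partials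
    of [G]. *)
Lemma curvature_metric j k x : U x ->
  G x *m curvature j k x = - ((curvature j k x)^T *m G x).
Proof.
move=> Ux; have sj := smooth_christoffel j; have sk := smooth_christoffel k.
have dd a b : partial a (partial b G) x =
   (partial a (Gam b) x)^T *m G x + (Gam b x)^T *m partial a G x
   + (partial a G x *m Gam b x + G x *m partial a (Gam b) x).
  have sb := smooth_christoffel b.
  have st := smooth_tr oU sb.
  have s1 := smooth_mul oU st sG; have s2 := smooth_mul oU sG sb.
  rewrite (partial_eq_on a oU Ux (fun z => @christoffel_compat b z)).
  rewrite (partialD a s1 s2 Ux) (partial_mul oU a st sG Ux).
  by rewrite (partial_mul oU a sG sb Ux) (partial_tr oU a sb Ux).
have := partial_comm_mx oU j k sG Ux; rewrite (dd j k) (dd k j).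
rewrite (christoffel_compat j Ux) (christoffel_compat k Ux).
exact: metric_identity.
Qed.

End levi_civita.

Lemma form_mx_eq (R : realType) (p q : nat) (A B : 'M[R]_(p, q)) :
  (forall (x : 'cV_p) (y : 'cV_q), (x^T *m A *m y) 0 0 = (x^T *m B *m y) 0 0) -> A = B.
Proof.
have E (C : 'M[R]_(p, q)) i j :
    ((delta_mx i 0 : 'cV[R]_p)^T *m C *m (delta_mx j 0 : 'cV[R]_q)) 0 0 = C i j.
  by rewrite trmx_delta -rowE -colE !mxE.
by move=> h; apply/matrixP => i j; rewrite -!E h.
Qed.

(** * Quaternionic submersions between charts *)

Section adjoint_identities.
Variables (R : realFieldType) (m n : nat).
Implicit Types (g L P dP : 'M[R]_m).

(** [L] is a connection matrix and [dP] a partial derivative; the second premise is the first one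
    differentiated, with metric compatibility substituted for the derivative of [g]. *)
Lemma selfadjoint_derivative g L P dP :
  g *m P = P^T *m g ->
  (L^T *m g + g *m L) *m P + g *m dP = dP^T *m g + P^T *m (L^T *m g + g *m L) ->
  g *m (dP + L *m P - P *m L) = (dP + L *m P - P *m L)^T *m g.
Proof.
have tr (a b c : 'M[R]_m) : (a + b - c)^T = a^T + b^T - c^T.
  by apply/matrixP => i k; rewrite !mxE.
move=> gP; rewrite tr !trmx_mul !(mulmxDr, mulmxDl, mulmxN, mulNmx) !mulmxA gP.
rewrite -(mulmxA L^T g P) gP !mulmxA => h.
apply/matrixP => a b; move/matrixP: h => /(_ a b).
by rewrite ?(addmxE, oppmxE); lra.
Qed.

(** The last premise is the derivative of [g *m S = D^T]. It exhibits the derivative of [D *m S] as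
    a symmetrised Hessian, with [dD - D *m L] in the role of the Hessian. *)
Lemma lift_derivative g L (S dS : 'M[R]_(m, n)) (D dD : 'M[R]_(n, m)) :
  g \in unitmx -> g^T = g -> g *m S = D^T ->
  (L^T *m g + g *m L) *m S + g *m dS = dD^T ->
  dD *m S + D *m dS = (dD - D *m L) *m S + ((dD - D *m L) *m S)^T.
Proof.
move=> gu gs gS h.
have tr : (dD - D *m L)^T = dD^T - L^T *m D^T by rewrite -trmx_mul; apply/matrixP => i k;
    rewrite !mxE.
have SG : S^T *m g = D by rewrite -[LHS]trmxK trmx_mul trmxK gs gS trmxK.
have gdS : g *m dS = (dD - D *m L)^T - g *m (L *m S).
  rewrite tr -h -gS !(mulmxDl, mulmxDr) !mulmxA; mx_abel.
have -> : D *m dS = S^T *m (g *m dS) by rewrite mulmxA SG.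
rewrite [in RHS]trmx_mul gdS mulmxBr (mulmxA S^T g) SG !mulmxBl !mulmxA.
by mx_abel.
Qed.

End adjoint_identities.

Section chart_submersion.
Variables (R : realType) (m n : nat).
Local Notation E := 'cV[R]_m.
Variables (U : set E) (V : set 'cV[R]_n) (phi : E -> 'cV[R]_n).
Variables (G : E -> 'M[R]_m) (Gp : 'cV[R]_n -> 'M[R]_n).
Hypotheses (oU : open U) (oV : open V) (UV : forall x, U x -> V (phi x)).
Hypothesis sphi : smooth_on U phi.
Hypothesis sG : smooth_on U G.
Hypothesis Gsym : forall x, U x -> (G x)^T = G x.
Hypothesis Gpos : forall x, U x -> forall u : E, u != 0 -> 0 < (u^T *m G x *m u) 0 0.
Hypothesis sGp : smooth_on V Gp.
Hypothesis Gpsym : forall y, V y -> (Gp y)^T = Gp y.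
Local Notation D := (jac phi).
Hypothesis rankD : forall x, U x -> \rank (D x) = n.
Hypothesis isoD : forall x, U x -> forall u v : E,
  (forall w : E, D x *m w = 0 -> (u^T *m G x *m w) 0 0 = 0) ->
  (forall w : E, D x *m w = 0 -> (v^T *m G x *m w) 0 0 = 0) ->
  ((D x *m u)^T *m Gp (phi x) *m (D x *m v)) 0 0 = (u^T *m G x *m v) 0 0.

Lemma smooth_jac : smooth_on U D.
Proof.
apply/(smooth_mxP oU) => i j.
have := smooth_entry oU i 0 (smooth_partial j sphi).
by apply: (smooth_on_eq oU) => x _; rewrite mxE.
Qed.

Lemma partial_jac k x i l : U x ->
  partial k D x i l = partial k (partial l phi) x i 0.
Proof.
move=> Ux; apply: etrans (esym (partial_entry k i l smooth_jac Ux)) _.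
apply: etrans _ (partial_entry k i 0 (smooth_partial l sphi) Ux).
by apply: (partial_eq_on k oU Ux) => z _; rewrite mxE.
Qed.

Lemma partial_jac_sym k x i l : U x -> partial k D x i l = partial l D x i k.
Proof.
move=> Ux; apply: etrans (partial_jac k i l Ux) _.
apply: etrans _ (esym (partial_jac l i k Ux)).
by rewrite (partial_comm_mx oU k l sphi Ux).
Qed.

Variable S : E -> 'M[R]_(m, n).
Hypothesis sS : smooth_on U S.
Hypothesis mul_lift : forall x, U x -> G x *m S x = (D x)^T.
(** As [S] is G^-1 D^T, the product [S x *m Gp (phi x)] is the metric adjoint D* of [D x], and this
    is D* D. No horizontal frame is chosen, so smoothness is immediate. *)
Definition horizontal_projector x := S x *m Gp (phi x) *m D x.
Definition vertical_projector x := 1%:M - horizontal_projector x.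
Local Notation P' := horizontal_projector.
Local Notation P := vertical_projector.

Lemma Gunit x : U x -> G x \in unitmx.
Proof. by move=> Ux; exact: posdef_unitmx (Gpos Ux). Qed.

Lemma lift_adj x : U x -> (S x)^T *m G x = D x.
Proof.
move=> Ux; rewrite -[LHS]trmxK trmx_mul trmxK Gsym// mul_lift//.
by rewrite trmxK.
Qed.

Lemma jac_lift_sym x : U x -> (D x *m S x)^T = D x *m S x.
Proof.
by move=> Ux; rewrite (trmx_mul (D x)) -{1}(mul_lift Ux) mulmxA lift_adj.
Qed.

Lemma jac_lift_unit x : U x -> D x *m S x \in unitmx.
Proof.
move=> Ux; rewrite -row_free_unit; apply/inj_row_free => v vDS.
have Sv : S x *m v^T = 0.
  apply: (ip_eq0 (Gpos Ux)); rewrite /ip (trmx_mul (S x)) trmxK.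
  by rewrite -(mulmxA v) lift_adj// mulmxA -(mulmxA v (D x)) vDS mul0mx mxE.
have rf : row_free (D x) by rewrite /row_free rankD.
apply: (row_free_inj rf); rewrite mul0mx; apply: trmx_inj.
by rewrite trmx_mul trmx0 -(mul_lift Ux) -mulmxA Sv mulmx0.
Qed.

(** The columns of [S x] are horizontal, so the isometry condition on them reads (DS)^T G' (DS) =
    DS; the symmetric invertible factor DS cancels. *)
Lemma metric_jac_lift x : U x -> Gp (phi x) *m (D x *m S x) = 1%:M.
Proof.
move=> Ux; have hS (xi : 'cV[R]_n) (w : E) : D x *m w = 0 -> ((S x *m xi)^T *m G x *m w) 0 0
    = 0.
  move=> Dw; rewrite (trmx_mul (S x)) -(mulmxA xi^T) lift_adj// -mulmxA Dw.
  by rewrite mulmx0 mxE.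
have E : (D x *m S x)^T *m Gp (phi x) *m (D x *m S x) = D x *m S x.
  apply: form_mx_eq => xi eta; have := isoD Ux (hS xi) (hS eta).
  rewrite (trmx_mul (D x)) !(trmx_mul (S x)) (trmx_mul (D x)) => h.
  rewrite !mulmxA in h *; rewrite h -!mulmxA; congr ((_ *m _) 0 0).
  by rewrite !mulmxA lift_adj.
rewrite jac_lift_sym// -mulmxA in E.
by rewrite -(mulKmx (jac_lift_unit Ux) (Gp _ *m _)) E mulVmx// jac_lift_unit.
Qed.

Lemma smooth_metric_phi : smooth_on U (Gp \o phi).
Proof. exact: (smooth_comp oU oV). Qed.

Lemma smooth_vertical_projector : smooth_on U P.
Proof.
apply: (smoothD oU); first exact: (smooth_cst oU).
apply: (smoothN oU); apply: (smooth_mul oU); last exact: smooth_jac.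
by apply: (smooth_mul oU); [exact: sS|exact: smooth_metric_phi].
Qed.

Lemma jac_horizontal x : U x -> D x *m P' x = D x.
Proof.
move=> Ux; rewrite /horizontal_projector !mulmxA.
by rewrite (mulmx1C (metric_jac_lift Ux)) mul1mx.
Qed.

Lemma jac_vertical x : U x -> D x *m P x = 0.
Proof. by move=> Ux; rewrite mulmxBr mulmx1 jac_horizontal// subrr. Qed.

Lemma vertical_idem x : U x -> P x *m P x = P x.
Proof.
move=> Ux; have P'P' : P' x *m P' x = P' x.
  by rewrite {1}/horizontal_projector -!mulmxA jac_horizontal// mulmxA.
by rewrite {2}/vertical_projector mulmxBr mulmx1 {2}/vertical_projector mulmxBl mul1mx P'P'
    subrr subr0.
Qed.

Lemma vertical_of_ker x (w : E) : D x *m w = 0 -> P x *m w = w.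
Proof. by move=> Dw; rewrite mulmxBl mul1mx -mulmxA Dw mulmx0 subr0. Qed.

Lemma vertical_selfadjoint x : U x -> G x *m P x = (P x)^T *m G x.
Proof.
move=> Ux; have GP' : G x *m P' x = (P' x)^T *m G x.
  rewrite /horizontal_projector !trmx_mul Gpsym; last exact: UV.
  by rewrite !mulmxA mul_lift// -!mulmxA lift_adj.
have -> : (P x)^T = 1%:M - (P' x)^T by apply/matrixP => i j; rewrite !mxE eq_sym.
by rewrite mulmxBr mulmxBl mulmx1 mul1mx GP'.
Qed.

Variables (d : nat) (J : 'I_d -> E -> 'M[R]_m).
Hypothesis sJ : forall b, smooth_on U (J b).
Hypothesis JJ : forall x b, U x -> J b x *m J b x = - 1%:M.
Hypothesis JC : forall x b c, U x -> b != c -> J b x *m J c x = - (J c x *m J b x).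
Hypothesis Jiso : forall x b, U x -> forall u v : E,
  ((J b x *m u)^T *m G x *m (J b x *m v)) 0 0 = (u^T *m G x *m v) 0 0.
Hypothesis Jhol : forall x b, U x -> exists J', D x *m J b x = J' *m D x.
Hypothesis Jpar : forall x k b, U x -> exists a : 'I_d -> R,
  chart_nabla G k (J b) x = \sum_c a c *: J c x.
Hypotheses (n_gt0 : (0 < n)%N) (n_lt_m : (n < m)%N) (d_gt1 : (1 < d)%N).

Let Gunit : forall x, U x -> G x \in unitmx.
Proof. by move=> x Ux; exact: posdef_unitmx (Gpos Ux). Qed.

Local Notation Gam := (chart_christoffel G).
Local Notation nab := (chart_nabla G).

Lemma J_skew x b : U x -> G x *m J b x = - ((J b x)^T *m G x).
Proof.
move=> Ux; have E : (J b x)^T *m G x *m J b x = G x.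
  apply: form_mx_eq => u v; rewrite -(Jiso b Ux) (trmx_mul (J b x)).
  by rewrite !mulmxA.
by rewrite -{1}E -mulmxA JJ// mulmxN mulmx1.
Qed.

(* D J = J' D makes im P = ker D invariant, and skewness of J its complement. *)
Lemma vertical_J x b : U x -> P x *m J b x = J b x *m P x.
Proof.
move=> Ux; have [J' DJ] := Jhol b Ux.
have PJP : P x *m (J b x *m P x) = J b x *m P x.
  rewrite {1}/vertical_projector mulmxBl mul1mx /horizontal_projector -[X in _ - X]mulmxA.
  by rewrite (mulmxA (D x)) DJ -(mulmxA J') jac_vertical// !mulmx0 subr0.
have PT := vertical_selfadjoint Ux.
have E : G x *m (P x *m J b x *m P x) = G x *m (P x *m J b x).
  have : (P x *m (J b x *m P x))^T *m G x = (J b x *m P x)^T *m G x by rewrite PJP.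
  rewrite !trmx_mul -!mulmxA -PT (mulmxA (J b x)^T) -[(J b x)^T *m G x]opprK -J_skew//.
  rewrite !(mulNmx, mulmxN) => /oppr_inj.
  by rewrite -!mulmxA (mulmxA _ (G x)) -PT -!mulmxA (mulmxA _ (G x)) -PT -!mulmxA => ->.
by have := can_inj (mulKmx (Gunit Ux)) E; rewrite -mulmxA PJP => ->.
Qed.

Lemma nabla_J_vertical x k b : U x -> P x *m nab k (J b) x = nab k (J b) x *m P x.
Proof.
move=> Ux; have [a ->] := Jpar k b Ux.
rewrite mulmx_sumr mulmx_suml; apply: eq_bigr => c _.
by rewrite -scalemxAl -scalemxAr vertical_J.
Qed.

(** Hessian of the coordinates of [phi], without the Christoffel term of N: that term would be
    evaluated on the images under [D] of both arguments, and below one argument is always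
    vertical. *)
Definition hess k x := partial k D x - D x *m Gam k x.

Lemma hess_sym k l i x : U x -> hess k x i l = hess l x i k.
Proof.
move=> Ux; rewrite /hess !addmxE !oppmxE; congr (_ - _); first exact: partial_jac_sym.
rewrite [LHS]mxE [RHS]mxE; apply: eq_bigr => s _.
by rewrite (christoffel_sym oU sG Gsym k).
Qed.

Let sP := smooth_vertical_projector.

Lemma nabla_vertical_idem k x : U x ->
  nab k P x *m P x + P x *m nab k P x = nab k P x.
Proof.
move=> Ux; rewrite -(chart_nablaM oU G k sP sP Ux).
by apply: (chart_nabla_eq oU) => // z; exact: vertical_idem.
Qed.

(** In the derivative of P J = J P, the terms containing the derivative of [J b] cancel: by [Jpar]
    it lies in the span of the [J c], which commute with [P]. *)
Lemma nabla_vertical_J k b x : U x ->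
  nab k P x *m J b x = J b x *m nab k P x.
Proof.
move=> Ux; have h : nab k (fun z => P z *m J b z) x = nab k (fun z => J b z *m P z) x.
  by apply: (chart_nabla_eq oU) => // z; exact: vertical_J.
rewrite (chart_nablaM oU G k sP (sJ b) Ux) (chart_nablaM oU G k (sJ b) sP Ux) in h.
move: h; rewrite nabla_J_vertical// addrC => /addrI.
by [].
Qed.

Lemma nabla_vertical_selfadjoint k x : U x ->
  G x *m nab k P x = (nab k P x)^T *m G x.
Proof.
move=> Ux; apply: selfadjoint_derivative; first exact: vertical_selfadjoint.
rewrite -(christoffel_compat oU sG Gsym Gunit k Ux) -(partial_tr oU k sP Ux).
rewrite -(partial_mul oU k sG sP Ux) -(partial_mul oU k (smooth_tr oU sP) sG Ux).
by apply: (partial_eq_on k oU Ux) => z; exact: vertical_selfadjoint.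
Qed.

Lemma jac_nabla_vertical k x : U x -> D x *m nab k P x = - (hess k x *m P x).
Proof.
move=> Ux; have h : partial k D x *m P x + D x *m partial k P x = 0.
  rewrite -(partial_mul oU k smooth_jac sP Ux) -[RHS](partial_cst (0 : 'M[R]_(n, m)) k x).
  by apply: (partial_eq_on k oU Ux) => z; exact: jac_vertical.
have alg (a b c p : 'M[R]_(n, m)) : a + b = 0 -> p = 0 -> b + c - p = - (a - c).
  move=> h1 ->; apply/matrixP => i j; move/matrixP: h1 => /(_ i j).
  by rewrite ?(addmxE, oppmxE) ![(0 : 'M[R]_(n, m)) i j]mxE; lra.
rewrite /chart_nabla mulmxBr mulmxDr (mulmxA (D x) (Gam k x)) (mulmxA (D x) (P x)).
rewrite /hess mulmxBl; apply: alg h _.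
by rewrite jac_vertical// mul0mx.
Qed.

(** [Gp \o phi] does not vary along the fibres, hence neither does its inverse [D *m S], whose
    derivative is the symmetrised Hessian by [lift_derivative]. *)
Lemma hess_lift x (v : E) : U x -> D x *m v = 0 ->
  along (hess^~ x) v *m S x + (along (hess^~ x) v *m S x)^T = 0.
Proof.
move=> Ux Dv.
have hS k : hess k x *m S x + (hess k x *m S x)^T =
    partial k (fun z => D z *m S z) x.
  rewrite (partial_mul oU k smooth_jac sS Ux); apply: esym.
  apply: (lift_derivative (Gunit Ux) (Gsym Ux) (mul_lift Ux)).
  rewrite -(christoffel_compat oU sG Gsym Gunit k Ux) -(partial_mul oU k sG sS Ux).
  rewrite -(partial_tr oU k smooth_jac Ux).
  by apply: (partial_eq_on k oU Ux) => z; exact: mul_lift.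
rewrite -alongMr; have -> : along (fun k => hess k x *m S x) v + (along (fun k => hess k x *m
    S x) v)^T
    = along (fun k => partial k (fun z => D z *m S z) x) v.
  rewrite -(along_eq v hS) along_add; congr (_ + _).
  by rewrite /along linear_sum; apply: eq_bigr => k _; rewrite linearZ.
have sDS := smooth_mul oU smooth_jac sS.
have WE : along (fun k => partial k (Gp \o phi) x) v = 0.
  transitivity (\sum_l (D x *m v) l 0 *: partial l Gp (phi x)).
    under [RHS]eq_bigr do rewrite mxE scaler_suml.
    rewrite [RHS]exchange_big; apply: eq_bigr => k _ /=.
    rewrite (partial_comp oU oV k UV sGp sphi Ux) scaler_sumr.
    by apply: eq_bigr => l _; rewrite scalerA mxE mulrC.
  by rewrite Dv big1// => l _; rewrite mxE scale0r.
have h k : partial k (Gp \o phi) x *m (D x *m S x)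
    + Gp (phi x) *m partial k (fun z => D z *m S z) x = 0.
  rewrite -(partial_mul oU k smooth_metric_phi sDS Ux) -[RHS](partial_cst (1%:M : 'M[R]_n) k x).
  by apply: (partial_eq_on k oU Ux) => z; exact: metric_jac_lift.
have := along_eq v h; rewrite along_add alongMr WE mul0mx add0r alongMl.
rewrite [RHS]/along big1 => [e|k _]; last by rewrite scaler0.
have /(congr1 (mulmx (D x *m S x))) := e.
by rewrite mulmx0 mulmxA (mulmx1C (metric_jac_lift Ux)) mul1mx.
Qed.

Lemma vertical_parallel k x : U x -> nab k P x = 0.
Proof.
move=> Ux; have n10 : Ordinal (ltnW d_gt1) != Ordinal d_gt1 by [].
set b1 := Ordinal _ in n10; set b2 := Ordinal _ in n10.
refine (vertical_projector_parallel (Gsym Ux) (Gpos Ux) (mul_lift Ux)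
  (metric_jac_lift Ux) (Q := fun k => nab k P x) (H := hess^~ x)
  (JJ b1 Ux) (JJ b2 Ux) (JC Ux n10) (vertical_J b1 Ux) (vertical_J b2 Ux)
  _ _ _ _ _ _ _ k).
- by move=> l; exact: nabla_vertical_idem.
- by move=> l; exact: nabla_vertical_selfadjoint.
- by move=> l; exact: nabla_vertical_J.
- by move=> l; exact: nabla_vertical_J.
- by move=> l; exact: jac_nabla_vertical.
- by move=> i l l'; exact: hess_sym.
- by move=> v; exact: hess_lift.
Qed.

(** [Jpar] gives coefficients point by point; the trace form recovers the same ones by a formula
    visibly smooth in [x]. The factor is the inverse of the trace of the square of [J c]. *)
Definition conn_form k x : 'M[R]_d :=
  \matrix_(c, b) (- m%:R^-1 * \tr (J c x *m nab k (J b) x)).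
Local Notation Th := conn_form.

Let m_neq0 : m%:R != 0 :> R.
Proof. by rewrite pnatr_eq0 -lt0n (leq_ltn_trans _ n_lt_m). Qed.

Lemma nabla_J k b x : U x -> nab k (J b) x = \sum_c Th k x c b *: J c x.
Proof.
move=> Ux; have [a aE] := Jpar k b Ux; rewrite {1}aE; apply: eq_bigr => c _.
congr (_ *: _); rewrite mxE aE mulmx_sumr raddf_sum (bigD1 c)//= big1 ?addr0.
  rewrite -scalemxAr linearZ /= (mxtrace_JJ (fun b => JJ b Ux) (fun b c => JC Ux)).
  by rewrite eqxx mulr1n; field.
move=> e ec; rewrite -scalemxAr linearZ /= (mxtrace_JJ (fun b => JJ b Ux) (fun b c => JC Ux)).
by rewrite eq_sym (negPf ec) mulr0n oppr0 mulr0.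
Qed.

Lemma smooth_conn_form k : smooth_on U (Th k).
Proof.
apply/(smooth_mxP oU) => c b.
have sn := smooth_chart_nabla oU sG Gunit k (sJ b).
have st : smooth_on U (fun x => \tr (J c x *m nab k (J b) x)).
  by apply: (smooth_sum oU) => i; apply: (smooth_entry oU); exact: (smooth_mul oU).
apply: (smooth_on_eq oU) (smoothM oU (smooth_cst oU (- m%:R^-1 : R)) st) => x _.
by rewrite mxE.
Qed.

(** Take the trace of the derivative of the constant [J b *m J c + J c *m J b]. *)
Lemma conn_form_skew k x b c : U x -> Th k x b c = - Th k x c b.
Proof.
move=> Ux; have h : nab k (fun z => J b z *m J c z + J c z *m J b z) x = 0.
  rewrite -[RHS](chart_nabla_cst_scalar G k (- 2 *+ (b == c)) x).
  apply: (chart_nabla_eq oU) => // z Uz; have [->|bc] := eqVneq b c.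
    rewrite JJ// mulr1n -opprD -[in LHS]raddfD/= -[in LHS]raddfN /=.
    by congr (_%:M).
  by rewrite (JC Uz bc) addNr mulr0n raddf0.
have sbc := smooth_mul oU (sJ b) (sJ c); have scb := smooth_mul oU (sJ c) (sJ b).
rewrite (chart_nablaD G k sbc scb Ux) in h.
rewrite (chart_nablaM oU G k (sJ b) (sJ c) Ux) (chart_nablaM oU G k (sJ c) (sJ b) Ux) in h.
have trD (a1 a2 a3 a4 : 'M[R]_m) :
    \tr (a1 + a2 + (a3 + a4)) = \tr a1 + \tr a2 + (\tr a3 + \tr a4).
  by rewrite !mxtraceD.
move/(congr1 mxtrace): h; rewrite trD mxtrace0.
rewrite (mxtrace_mulC (nab k (J b) x)) (mxtrace_mulC (nab k (J c) x)) !mxE.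
move: (\tr (J b x *m _)) (\tr (J c x *m _)) => p q h.
have -> : p = - q by lra.
by rewrite mulrN.
Qed.

(** Two derivatives of [J b] have the coefficients [partial a (Th l) + Th a *m Th l].
    Antisymmetrised, they form the commutator of curvature with [J b], that is, the [F] of
    [span_curvature_eq0]. *)
Lemma conn_form_flat j k x : U x ->
  partial j (Th k) x - partial k (Th j) x + Th j x *m Th k x - Th k x *m Th j x = 0.
Proof.
move=> Ux.
have nnJ a l b : nab a (nab l (J b)) x =
    \sum_c (partial a (Th l) x + Th a x *m Th l x) c b *: J c x.
  rewrite (chart_nabla_eq oU (B := fun z => \sum_c Th l z c b *: J c z) G a Ux); last first.
    by move=> z; exact: nabla_J.
  have sT c : smooth_on U (fun z => Th l z c b).
    exact: (smooth_entry oU c b (smooth_conn_form l)).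
  rewrite (chart_nabla_sum oU G a (index_enum _) sT sJ Ux) big_split/=.
  under [RHS]eq_bigr do rewrite addmxE scalerDl.
  rewrite [RHS]big_split/=; congr (_ + _).
    apply: eq_bigr => c _; congr (_ *: _).
    exact: (partial_entry a c b (smooth_conn_form l) Ux).
  under eq_bigr do rewrite nabla_J// scaler_sumr.
  rewrite exchange_big; apply: eq_bigr => e _ /=; rewrite mxE scaler_suml.
  by apply: eq_bigr => c _; rewrite scalerA mulrC.
(* A vertical test vector: the rank [n] of the differential is smaller than [m]. *)
have [v0 v0_neq0 Dv0] : exists2 v : E, v != 0 & D x *m v = 0.
  have : kermx (D x)^T != 0.
    rewrite kermx_eq0 /row_free mxrank_tr rankD// neq_ltn n_lt_m.
    by [].
  move=> /rowV0Pn[w /sub_kermxP wD w0]; exists w^T; first by rewrite trmx_eq0.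
  by rewrite -[LHS]trmxK trmx_mul trmxK wD trmx0.
(* A horizontal test vector: the lift of a nonzero vector of the base, available because [0 < n]. *)
pose e0 : 'cV[R]_n := delta_mx (Ordinal n_gt0) 0.
pose u0 := S x *m e0.
have Pu0 : P x *m u0 = 0.
  have SE : P' x *m u0 = S x *m (Gp (phi x) *m (D x *m S x)) *m e0.
    by rewrite /horizontal_projector /u0 !mulmxA.
  by rewrite mulmxBl mul1mx SE metric_jac_lift// mulmx1 subrr.
have u0_neq0 : u0 != 0.
  apply/eqP => u00; have : Gp (phi x) *m (D x *m u0) = 0 by rewrite u00 !mulmx0.
  rewrite /u0 !mulmxA -(mulmxA (Gp _)) metric_jac_lift// mul1mx => /colP/(_ (Ordinal n_gt0)).
  by rewrite !mxE !eqxx => /eqP; rewrite oner_eq0.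
have nab0 a l : nab a (nab l P) x = 0.
  rewrite -[RHS](chart_nabla_cst_scalar G a 0 x).
  by apply: (chart_nabla_eq oU) => // z Uz; rewrite vertical_parallel// raddf0.
have Ranti a l : curvature G a l x = - curvature G l a x by exact: curvature_anti.
have Rb a l e := curvature_bianchi oU sG Gsym Gunit a l e Ux.
have GR a l := curvature_metric oU sG Gsym Gunit a l Ux.
have RP a l : curvature G a l x *m P x = P x *m curvature G a l x.
  apply/eqP; rewrite -subr_eq0.
  by rewrite (curvature_commutator oU sG Gunit a l sP Ux) !nab0 subrr.
have RJ a l b : curvature G a l x *m J b x - J b x *m curvature G a l x =
    \sum_c (partial a (Th l) x - partial l (Th a) x + Th a x *m Th l x
             - Th l x *m Th a x) c b *: J c x.
  rewrite (curvature_commutator oU sG Gunit a l (sJ b) Ux) !nnJ -sumrB.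
  apply: eq_bigr => c _; rewrite -scalerBl; congr (_ *: _).
  have alg (p q r s : R) : p + r - (q + s) = p - q + r - s by ring.
  by rewrite !(addmxE, oppmxE) alg.
exact: (span_curvature_eq0 Ranti Rb (Gsym Ux) (Gpos Ux) GR (vertical_idem Ux) RP
  (fun b => JJ b Ux) (fun b c => JC Ux) (fun b => vertical_J b Ux)
  RJ u0_neq0 v0_neq0 Pu0 (vertical_of_ker Dv0)).
Qed.

End chart_submersion.

(** * Tensoriality of the covariant derivative *)

Section change_of_chart.
Variables (R : realType) (m : nat).
Local Notation E := 'cV[R]_m.
Variables (U1 U2 : set E) (psi : E -> E).
Hypotheses (oU1 : open U1) (oU2 : open U2) (U12 : forall x, U1 x -> U2 (psi x)).
Hypothesis spsi : smooth_on U1 psi.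
Variables G1 G2 : E -> 'M[R]_m.
Hypothesis sG2 : smooth_on U2 G2.
Hypothesis G1sym : forall x, U1 x -> (G1 x)^T = G1 x.
Hypothesis G2sym : forall x, U2 x -> (G2 x)^T = G2 x.
Hypothesis G1unit : forall x, U1 x -> G1 x \in unitmx.
Hypothesis G2unit : forall x, U2 x -> G2 x \in unitmx.
Local Notation T := (jac psi).
Hypothesis GT : forall x, U1 x -> (T x)^T *m G2 (psi x) *m T x = G1 x.

Let sT := smooth_jac oU1 spsi.

Lemma jac_change_unit x : U1 x -> T x \in unitmx.
Proof.
move=> Ux; have := G1unit Ux; rewrite -GT// !unitmx_mul.
by case/andP.
Qed.

Definition pulled_christoffel k x :=
  along (fun l => chart_christoffel G2 l (psi x)) (col k (T x)).
Local Notation Lam := pulled_christoffel.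

Lemma partial_comp_along p q (A : E -> 'M[R]_(p, q)) k x : smooth_on U2 A -> U1 x ->
  partial k (A \o psi) x = along (fun l => partial l A (psi x)) (col k (T x)).
Proof.
move=> sA Ux; rewrite (partial_comp oU1 oU2 k U12 sA spsi Ux).
by apply: eq_bigr => l _; rewrite !mxE.
Qed.

(** The candidate obtained by solving for the symbols of [G1] is symmetric and compatible with [G1],
    so [christoffel_unique] identifies it. *)
Lemma christoffel_change k x : U1 x ->
  T x *m chart_christoffel G1 k x = Lam k x *m T x + partial k T x.
Proof.
move=> Ux; have uT := jac_change_unit Ux.
pose X l := Lam l x *m T x + partial l T x.
suff <- : invmx (T x) *m X k = chart_christoffel G1 k x.
  by rewrite mulmxA mulmxV ?mul1mx.
have TX l : T x *m (invmx (T x) *m X l) = X l by rewrite mulmxA mulmxV ?mul1mx.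
apply: (christoffel_unique G1sym G1unit (L := fun k => invmx (T x) *m X k) Ux).
  move=> a b l; rewrite [LHS]mxE [RHS]mxE; apply: eq_bigr => s _; congr (_ * _).
  have XE c e : X c s e = (Lam c x *m T x) s e + partial c T x s e by exact: addmxE.
  suff E1 : (Lam a x *m T x) s b = (Lam b x *m T x) s a.
    have E2 := partial_jac_sym oU1 spsi a s b Ux.
    exact: etrans (XE a b) (etrans (f_equal2 +%R E1 E2) (esym (XE b a))).
  have E c e : (Lam c x *m T x) s e =
      \sum_i \sum_i' T x i c * (chart_christoffel G2 i (psi x) s i' * T x i' e).
    rewrite /pulled_christoffel /along mulmx_suml summxE; apply: eq_bigr => i _.
    rewrite -scalemxAl mxE [X in _ * X]mxE mulr_sumr; apply: eq_bigr => i' _.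
    by rewrite [X in X * _]mxE.
  rewrite (E a b) (E b a) exchange_big; apply: eq_bigr => i _; apply: eq_bigr => i' _ /=.
  rewrite (christoffel_sym oU2 sG2 G2sym i' i s (U12 Ux)).
  have alg (t g u : R) : t * (g * u) = u * (g * t) by ring.
  exact: alg.
move=> l.
have sTt := smooth_tr oU1 sT.
have sG2psi := smooth_comp oU1 oU2 U12 sG2 spsi.
have dG1 : partial l G1 x =
    (partial l T x)^T *m G2 (psi x) *m T x
    + (T x)^T *m ((Lam l x)^T *m G2 (psi x) + G2 (psi x) *m Lam l x) *m T x
    + (T x)^T *m G2 (psi x) *m partial l T x.
  have sTG := smooth_mul oU1 sTt sG2psi.
  rewrite -(partial_eq_on l oU1 Ux GT).
  apply: etrans (partial_mul oU1 l sTG sT Ux) _.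
  rewrite (partial_mul oU1 l sTt sG2psi Ux) (partial_tr oU1 l sT Ux).
  rewrite mulmxDl; congr (_ + _ *m _ *m _ + _).
  rewrite partial_comp_along// /pulled_christoffel.
  rewrite (along_eq _ (fun a => christoffel_compat oU2 sG2 G2sym G2unit a (U12 Ux))).
  rewrite along_add alongMl alongMr; congr (_ *m _ + _).
  by rewrite /along linear_sum; apply: eq_bigr => i _; rewrite linearZ.
rewrite dG1 -(GT Ux).
have -> : (T x)^T *m G2 (psi x) *m T x *m (invmx (T x) *m X l) =
   (T x)^T *m G2 (psi x) *m X l by rewrite -mulmxA TX.
have -> : (invmx (T x) *m X l)^T *m ((T x)^T *m G2 (psi x) *m T x) =
   (X l)^T *m G2 (psi x) *m T x.
  by rewrite !mulmxA -(trmx_mul (T x)) TX.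
have alg (a b g t : 'M[R]_m) :
   a^T *m g *m t + t^T *m (b^T *m g + g *m b) *m t + t^T *m g *m a =
   (b *m t + a)^T *m g *m t + t^T *m g *m (b *m t + a).
  have tr (u v : 'M[R]_m) : (u + v)^T = u^T + v^T by apply/matrixP => i j; rewrite !mxE.
  by rewrite tr trmx_mul !(mulmxDl, mulmxDr) !mulmxA; mx_abel.
exact: alg.
Qed.

Variables A1 A2 : E -> 'M[R]_m.
Hypotheses (sA1 : smooth_on U1 A1) (sA2 : smooth_on U2 A2).
Hypothesis AT : forall x, U1 x -> A2 (psi x) *m T x = T x *m A1 x.

(** Differentiating [AT] produces second derivatives of the coordinate change; the transformation
    law of the Christoffel symbols cancels them. *)
Lemma chart_nabla_change k x : U1 x ->
  along (fun l => chart_nabla G2 l A2 (psi x)) (col k (T x)) *m T x =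
  T x *m chart_nabla G1 k A1 x.
Proof.
move=> Ux; have cE := christoffel_change k Ux; have aE := AT Ux.
have sA2psi := smooth_comp oU1 oU2 U12 sA2 spsi.
have dE : along (fun l => partial l A2 (psi x)) (col k (T x)) *m T x
    + A2 (psi x) *m partial k T x = partial k T x *m A1 x + T x *m partial k A1 x.
  rewrite -(partial_comp_along k sA2 Ux).
  rewrite -(partial_mul oU1 k sT sA1 Ux).
  apply: etrans (esym (partial_mul oU1 k sA2psi sT Ux)) _.
  exact: (partial_eq_on k oU1 Ux AT).
have -> : along (fun l => chart_nabla G2 l A2 (psi x)) (col k (T x)) =
    along (fun l => partial l A2 (psi x)) (col k (T x))
    + Lam k x *m A2 (psi x) - A2 (psi x) *m Lam k x.
  rewrite /pulled_christoffel -alongMr -alongMl.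
  have alongB Q Q' u : along (fun l => Q l - Q' l) u = along Q u - along Q' u :> 'M[R]_m.
    by rewrite /along -sumrB; apply: eq_bigr => i _; rewrite scalerBr.
  by rewrite -along_add -alongB.
rewrite /chart_nabla.
have alg (dA da t dt a a' L g : 'M[R]_m) : t *m g = L *m t + dt -> a' *m t = t *m a ->
    dA *m t + a' *m dt = dt *m a + t *m da ->
    (dA + L *m a' - a' *m L) *m t = t *m (da + g *m a - a *m g).
  move=> h1 h2 h3; rewrite !(mulmxDl, mulmxDr, mulmxN, mulNmx) !mulmxA h1 -h2.
  rewrite -(mulmxA a' t g) h1 !(mulmxDl, mulmxDr) !mulmxA -(mulmxA L t a) -h2 !mulmxA.
  apply/matrixP => i j; move/matrixP: h3 => /(_ i j).
  by rewrite ?(addmxE, oppmxE); lra.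
exact: (alg _ _ _ _ _ _ _ _ cE aE dE).
Qed.

End change_of_chart.

(** * Charts and parallel canonical bases *)

Section manifold_charts.
Variables (R : realType) (m : nat) (M : manifold R m).
Implicit Types (i j : chart_index M) (p q : M) (W : set M) (A : components M).

Lemma open_chart_image i W : open W -> open (chart i @` (cdom i `&` W)).
Proof.
move=> oW; rewrite openE => x [p [cp Wp] <-].
have nx : nbhs (chart i p) (chart i @` cdom i).
  by apply: open_nbhs_nbhs; split; [exact: chart_open|exists p].
have ci := chart_inv_continuous (ex_intro2 _ _ p cp erefl : (chart i @` cdom i) (chart i p)).
have nW : nbhs (chart i p) (chart_inv i @^-1` W).
  by apply: ci; rewrite /= chartK//; exact: open_nbhs_nbhs.
apply: filterS (filterI nx nW) => y [[q cq <-]]; rewrite /= chartK// => Wq.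
by exists q.
Qed.

Lemma chart_component i A q : cdom i q -> (A i \o chart_inv i) (chart i q) = A i q.
Proof. by move=> cq; rewrite /= chartK. Qed.

Lemma christoffelE (g : components M) i k q : cdom i q ->
  christoffel g i k q = chart_christoffel (g i \o chart_inv i) k (chart i q).
Proof.
move=> cq; apply/matrixP => l j; rewrite [RHS]mxE [LHS]mxE mulr_sumr.
apply: eq_bigr => s _; rewrite chart_component// [in RHS]mxE.
by rewrite mulrCA.
Qed.

Lemma nablaE (g : components M) i q u A : cdom i q ->
  nabla g i q u A =
  along (fun k => chart_nabla (g i \o chart_inv i) k (A i \o chart_inv i) (chart i q)) u.
Proof.
move=> cq; apply: eq_bigr => k _; congr (_ *: _).
by rewrite /chart_nabla christoffelE// chart_component.
Qed.

Section metric.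
Variable g : components M.
Hypothesis rg : riemannian_metric g.

Lemma metric_sym i q : cdom i q -> (g i q)^T = g i q.
Proof.
move=> cq; apply: form_mx_eq => u v; have [_ gs _ _] := rg.
rewrite -[RHS](gs i q v u cq) /Defs.form -[RHS]trmx11 !trmx_mul trmxK.
by rewrite mulmxA.
Qed.

Lemma metric_pos i q : cdom i q ->
  forall u : 'cV[R]_m, u != 0 -> 0 < (u^T *m g i q *m u) 0 0.
Proof. by move=> cq u u0; have [_ _ gp _] := rg; exact: gp. Qed.

Lemma metric_smooth i W : smooth_on (chart i @` (cdom i `&` W)) (g i \o chart_inv i).
Proof.
have [_ _ _ gsm] := rg => r; apply: Ck_on_sub (gsm i r).
by move=> _ [q [cq _] <-]; exists q.
Qed.

Lemma transition_metric i j q : cdom i q -> cdom j q ->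
  (transition i j q)^T *m g j q *m transition i j q = g i q.
Proof.
move=> ci cj; apply: form_mx_eq => u v; have [gt _ _ _] := rg.
have := gt i j q u v ci cj; rewrite /Defs.form (trmx_mul (transition i j q)) => <-.
by rewrite !mulmxA.
Qed.

Lemma transition_smooth i j W :
  smooth_on (chart i @` (cdom i `&` (cdom j `&` W))) (chart j \o chart_inv i).
Proof.
move=> r; apply: Ck_on_sub (@chart_transition _ _ M i j r).
by move=> _ [q [ci [cj _]] <-]; exists q.
Qed.

(** A frame constructed in one chart has to be parallel in every chart, since [parallel_on] ranges
    over all of them. *)
Lemma parallel_change_chart i j W A q : open W -> endo_field W A ->
  W q -> cdom i q -> cdom j q ->
  (forall u, nabla g i q u A = 0) -> forall u, nabla g j q u A = 0.
Proof.
move=> oW [Atr Asm] Wq ci cj par u.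
pose U1 := chart i @` (cdom i `&` (cdom j `&` W)).
pose U2 := chart j @` (cdom j `&` W).
have oU1 : open U1 by apply: open_chart_image; apply: openI => //; exact: cdom_open.
have oU2 : open U2 by exact: open_chart_image.
have U12 x : U1 x -> U2 ((chart j \o chart_inv i) x).
  by move=> [z [cz [cjz Wz]] <-]; exists z => //=; rewrite chartK.
have U1q : U1 (chart i q) by exists q.
have mp k z : cdom k z -> forall u : 'cV[R]_m, u != 0 -> 0 < (u^T *m g k z *m u) 0 0.
  by move=> cz; exact: metric_pos.
have unit1 x : U1 x -> (g i \o chart_inv i) x \in unitmx.
  by move=> [z [cz _] <-]; rewrite chart_component//; exact: posdef_unitmx (mp _ _ cz).
have unit2 x : U2 x -> (g j \o chart_inv j) x \in unitmx.
  by move=> [z [cz _] <-]; rewrite chart_component//; exact: posdef_unitmx (mp _ _ cz).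
have sym1 x : U1 x -> ((g i \o chart_inv i) x)^T = (g i \o chart_inv i) x.
  by move=> [z [cz _] <-]; rewrite chart_component//; exact: metric_sym.
have sym2 x : U2 x -> ((g j \o chart_inv j) x)^T = (g j \o chart_inv j) x.
  by move=> [z [cz _] <-]; rewrite chart_component//; exact: metric_sym.
have psiE z : cdom i z -> (chart j \o chart_inv i) (chart i z) = chart j z.
  by move=> cz; rewrite /= chartK.
have GT x : U1 x -> (jac (chart j \o chart_inv i) x)^T
    *m (g j \o chart_inv j) ((chart j \o chart_inv i) x)
    *m jac (chart j \o chart_inv i) x = (g i \o chart_inv i) x.
  move=> [z [cz [cjz _]] <-]; rewrite psiE// !chart_component//.
  exact: transition_metric.
have AT x : U1 x -> (A j \o chart_inv j) ((chart j \o chart_inv i) x)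
    *m jac (chart j \o chart_inv i) x = jac (chart j \o chart_inv i) x *m (A i \o chart_inv
        i) x.
  move=> [z [cz [cjz Wz]] <-]; rewrite psiE// !chart_component//.
  exact: Atr.
have sA1 : smooth_on U1 (A i \o chart_inv i).
  by move=> r; apply: Ck_on_sub (Asm i r) => _ [z [cz [_ Wz]] <-]; exists z.
have sA2 : smooth_on U2 (A j \o chart_inv j) := Asm j.
have sG2 : smooth_on U2 (g j \o chart_inv j) by exact: metric_smooth.
have spsi : smooth_on U1 (chart j \o chart_inv i) by exact: transition_smooth.
have change k := chart_nabla_change oU1 oU2 U12 spsi sG2 sym1 sym2 unit1 unit2 GT
  sA1 sA2 AT k U1q.
have uT := jac_change_unit unit1 GT U1q.
have nab1 k : chart_nabla (g i \o chart_inv i) k (A i \o chart_inv i) (chart i q) = 0.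
  by have := par (delta_mx k 0); rewrite nablaE// along_delta.
rewrite nablaE//; set T := jac _ _ in change uT; rewrite psiE// in change.
have cols k : along (fun l => chart_nabla (g j \o chart_inv j) l (A j \o chart_inv j) (chart
    j q))
    (col k T) = 0.
  by rewrite -[LHS](mulmxK uT) change nab1 mulmx0 mul0mx.
(* The columns of the invertible [T] span all directions in the second chart, so vanishing along
   them is enough. *)
pose w := invmx T *m u; have -> : u = \sum_k w k 0 *: col k T.
  rewrite -[LHS](mulKVmx uT) -/w; apply/colP => a; rewrite mxE summxE.
  by apply: eq_bigr => k _; rewrite !mxE mulrC.
have lin (I : Type) (s : seq I) (F : I -> 'cV[R]_m) (c : I -> R) Q :
    (forall k, along Q (F k) = 0 :> 'M[R]_m) -> along Q (\sum_(k <- s) c k *: F k) = 0.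
  move=> h; elim: s => [|k s IH].
    by rewrite big_nil /along big1// => l _; rewrite mxE scale0r.
  rewrite big_cons alongD IH addr0.
  have -> : along Q (c k *: F k) = c k *: along Q (F k).
    by rewrite /along scaler_sumr; apply: eq_bigr => l _; rewrite mxE scalerA.
  by rewrite h scaler0.
exact: lin cols.
Qed.

End metric.
End manifold_charts.

(** Indexing by ['I_3] gives access to the results on families [J : 'I_d -> _]; the index never
    reaches the default of [nth]. *)
Definition triple (T : Type) (a b c : T) (k : 'I_3) : T := nth a [:: a; b; c] k.

Section quaternion_triple.
Variables (R : realFieldType) (m : nat) (A B C : 'M[R]_m).
Hypotheses (AA : A *m A = - 1%:M) (BB : B *m B = - 1%:M) (CC : C *m C = - 1%:M).
Hypotheses (AB : A *m B = C) (BA : - (B *m A) = C).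
Local Notation J := (triple A B C).

Lemma triple_mul_mem (s : {vspace 'M[R]_m}) b c : A \in s -> B \in s -> C \in s ->
  b != c -> J b *m J c \in s.
Proof.
move=> As Bs Cs.
have BA' : B *m A = - C by rewrite -BA opprK.
have AC : A *m C = - B by rewrite -AB mulmxA AA mulNmx mul1mx.
have CA : C *m A = B by rewrite -BA mulNmx -mulmxA AA mulmxN mulmx1 opprK.
have CB : C *m B = - A by rewrite -AB -mulmxA BB mulmxN mulmx1.
have BC : B *m C = A by rewrite -BA mulmxN mulmxA BB mulNmx mul1mx opprK.
by case: b c => [[|[|[|[]//]]] hb] [[|[|[|[]//]]] hc] //= _;
  rewrite /triple /= ?AB ?BA' ?AC ?CA ?CB ?BC ?memvN.
Qed.

Lemma triple_sqr b : J b *m J b = - 1%:M.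
Proof. by case: b => [[|[|[|[]//]]] hb]; rewrite /triple /=. Qed.

Lemma triple_anticomm b c : b != c -> J b *m J c = - (J c *m J b).
Proof.
have BA' : B *m A = - C by rewrite -BA opprK.
have AC : A *m C = - B by rewrite -AB mulmxA AA mulNmx mul1mx.
have CA : C *m A = B by rewrite -BA mulNmx -mulmxA AA mulmxN mulmx1 opprK.
have CB : C *m B = - A by rewrite -AB -mulmxA BB mulmxN mulmx1.
have BC : B *m C = A by rewrite -BA mulmxN mulmxA BB mulNmx mul1mx opprK.
by case: b c => [[|[|[|[]//]]] hb] [[|[|[|[]//]]] hc] //= _;
  rewrite /triple /= ?AB ?BA' ?AC ?CA ?CB ?BC ?opprK.
Qed.

Lemma triple_free : (0 < m)%N -> free [:: A; B; C].
Proof.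
move=> m_gt0; apply/(@freeP _ _ 3 [tuple A; B; C]) => k kJ b.
have v0 : (delta_mx (Ordinal m_gt0) 0 : 'cV[R]_m) != 0.
  apply/eqP => /colP/(_ (Ordinal m_gt0)); rewrite !mxE !eqxx => /eqP.
  by rewrite oner_eq0.
apply: (span_J_eq0 triple_sqr triple_anticomm v0 (x := k)).
have -> : \sum_b k b *: J b = 0.
  by rewrite -[RHS]kJ; apply: eq_bigr => -[[|[|[|[]//]]] hc] _.
exact: mul0mx.
Qed.

End quaternion_triple.

(** Anticommutation is the polarisation of [sqr_span_J]: the sum of two orthonormal columns has
    squared length 2. *)
Lemma orthonormal_columns_quaternion (R : realFieldType) (m d : nat)
    (J : 'I_d -> 'M[R]_m) (X : 'M[R]_d) :
  (forall b, J b *m J b = - 1%:M) ->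
  (forall b c, b != c -> J b *m J c = - (J c *m J b)) ->
  X^T *m X = 1%:M ->
  let K a := \sum_b X b a *: J b in
  (forall a, K a *m K a = - 1%:M) /\
  (forall a e, a != e -> K a *m K e = - (K e *m K a)).
Proof.
move=> JJ JC XX K.
have ip a e : \sum_b X b a * X b e = (a == e)%:R.
  have /matrixP/(_ a e) := XX; rewrite !mxE => <-.
  by apply: eq_bigr => b _; rewrite mxE.
have KK a : K a *m K a = - 1%:M.
  rewrite (sqr_span_J JJ JC); congr (- _%:M).
  have := ip a a; rewrite eqxx mulr1n => ipaa; rewrite -[RHS]ipaa.
  by apply: eq_bigr => b _; rewrite expr2.
split=> // a e ae.
have sumE : K a + K e = \sum_b (X b a + X b e) *: J b.
  by rewrite -big_split; apply: eq_bigr => b _; rewrite scalerDl.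
have := sqr_span_J JJ JC (fun b => X b a + X b e); rewrite -sumE.
have -> : \sum_b (X b a + X b e) ^+ 2 = 2.
  transitivity (\sum_b X b a * X b a + (\sum_b X b a * X b e + \sum_b X b a * X b e)
      + \sum_b X b e * X b e).
    by rewrite -!big_split; apply: eq_bigr => b _ /=; ring.
  by rewrite !ip !eqxx (negPf ae) mulr0n mulr1n; ring.
rewrite mulmxDl !mulmxDr !KK => h; apply/eqP; rewrite -addr_eq0; apply/eqP.
have two : (2%:M : 'M[R]_m) = 1%:M + 1%:M by rewrite -raddfD.
apply/matrixP => i j; move/matrixP: h => /(_ i j); rewrite two.
by rewrite ?(addmxE, oppmxE) ![(0 : 'M[R]_m) i j]mxE; lra.
Qed.

(** * From a flat skew connection form to a parallel canonical basis *)

Section parallel_frame.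
Variables (R : realType) (m : nat) (M : manifold R m).
Variables (sigma : endo_subspaces M) (g : components M).
Hypothesis rg : riemannian_metric g.
Variables (U0 W : set M) (J1 J2 J3 : components M).
Hypothesis cb : canonical_local_basis sigma U0 J1 J2 J3.
Hypotheses (oW : open W) (WU : W `<=` U0) (m_gt0 : (0 < m)%N).
Variables (i : chart_index M) (p0 : M).
Hypotheses (Wp0 : W p0) (cp0 : cdom i p0).
Local Notation J := (triple J1 J2 J3).
Local Notation G := (g i \o chart_inv i).
Local Notation O := (chart i @` (cdom i `&` W)).
Local Notation Jc := (fun b => J b i \o chart_inv i).

Lemma canonical_endo b : endo_field U0 (J b).
Proof. by case: cb => _ [h1 h2 h3] _ _; case: b => [[|[|[|[]//]]] hb]. Qed.

Lemma tripleE b i' q : J b i' q = triple (J1 i' q) (J2 i' q) (J3 i' q) b.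
Proof. by case: b => [[|[|[|[]//]]] hb]. Qed.

Lemma canonical_sqr b i' q : U0 q -> cdom i' q -> J b i' q *m J b i' q = - 1%:M.
Proof.
move=> Uq cq; case: cb => _ _ _ /(_ i' q Uq cq)[h1 h2 h3 h4 h5].
by rewrite tripleE; exact: triple_sqr.
Qed.

Lemma canonical_anticomm b c i' q : U0 q -> cdom i' q -> b != c ->
  J b i' q *m J c i' q = - (J c i' q *m J b i' q).
Proof.
move=> Uq cq; case: cb => _ _ _ /(_ i' q Uq cq)[h1 h2 h3 h4 h5] bc.
by rewrite !tripleE; exact: triple_anticomm.
Qed.

Lemma canonical_mem b i' q : U0 q -> cdom i' q -> J b i' q \in sigma i' q.
Proof.
move=> Uq cq; case: cb => _ _ /(_ i' q Uq cq) bs _; rewrite tripleE.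
by apply: (basis_mem bs); case: b => [[|[|[|[]//]]] hb]; rewrite /triple !inE eqxx ?orbT.
Qed.

Lemma canonical_coef A i' q : U0 q -> cdom i' q -> A \in sigma i' q ->
  exists a : 'I_3 -> R, A = \sum_c a c *: J c i' q.
Proof.
move=> Uq cq; case: cb => _ _ /(_ i' q Uq cq) bs _ As.
exists (fun c => coord [tuple J1 i' q; J2 i' q; J3 i' q] c A).
rewrite {1}(@coord_span _ _ 3 [tuple J1 i' q; J2 i' q; J3 i' q] A).
  by apply: eq_bigr => c _; congr (_ *: _); case: c => [[|[|[|[]//]]] hc].
by rewrite (span_basis bs).
Qed.

Lemma smooth_chart_J b : smooth_on O (Jc b).
Proof.
move=> r; apply: Ck_on_sub ((canonical_endo b).2 i r).
by move=> _ [q [cq /WU Uq] <-]; exists q.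
Qed.

Lemma canonical_endo_combination (X : M -> 'M[R]_3) a V :
  open V -> V `<=` W ->
  (forall i', smooth_on (chart i' @` (cdom i' `&` V)) (X \o chart_inv i')) ->
  endo_field V (fun i' q => \sum_b X q b a *: J b i' q).
Proof.
move=> oV VW sX; split.
  move=> i1 i2 q Vq c1 c2; rewrite mulmx_suml mulmx_sumr; apply: eq_bigr => b _.
  rewrite -scalemxAl -scalemxAr; congr (_ *: _).
  by apply: (canonical_endo b).1 => //; exact/WU/VW.
move=> i'; have oVi := @open_chart_image _ _ M i' _ oV.
apply: (smooth_mx_sum oVi) => b.
apply: (smooth_scale oVi); first exact: (smooth_entry oVi b a (sX i')).
move=> r; apply: Ck_on_sub ((canonical_endo b).2 i' r).
by move=> _ [q [cq /VW/WU Uq] <-]; exists q.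
Qed.

Lemma endo_field_mul (V : set M) (A B : components M) : open V -> endo_field V A ->
    endo_field V B ->
  endo_field V (fun i' q => A i' q *m B i' q).
Proof.
move=> oV [Atr Asm] [Btr Bsm]; split.
  by move=> i1 i2 q Vq c1 c2; rewrite -mulmxA Btr// mulmxA Atr// mulmxA.
by move=> i'; exact: (smooth_mul (@open_chart_image _ _ M i' _ oV) (Asm i') (Bsm i')).
Qed.

Variable Th : 'I_m -> 'cV[R]_m -> 'M[R]_3.
Hypothesis sTh : forall k, smooth_on O (Th k).
Hypothesis flat : forall j k x, O x ->
  partial j (Th k) x - partial k (Th j) x + Th j x *m Th k x - Th k x *m Th j x = 0.
Hypothesis Th_skew : forall k x b c, O x -> Th k x b c = - Th k x c b.
Hypothesis nabJ : forall k b x, O x ->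
  chart_nabla G k (Jc b) x = \sum_c Th k x c b *: Jc c x.

Lemma zero_partial_ball_cst (p q : nat) (c : 'cV[R]_m) (r : R) (K : 'cV[R]_m -> 'M[R]_(p, q)) :
  smooth_on (ball c r) K -> (forall k x, ball c r x -> partial k K x = 0) ->
  forall x, ball c r x -> K x = K c.
Proof.
move=> sK dK x Bx; have r0 : 0 < r by case: Bx.
apply/matrixP => a b; apply/eqP; rewrite -subr_eq0 -normr_le0.
have oB : open (ball c r) by exact: ball_open.
have := @ball_lipschitz R m (fun z => K z a b) c r 0 c x.
rewrite mul0r; apply => //; last exact: ballxx.
move=> z k Bz; split; first exact: (smooth_derivable (smooth_entry oB a b sK) Bz).
by rewrite (partial_entry k a b sK Bz) dK// mxE normr0.
Qed.

(** Columns of an orthogonal [F] combine the [J b] into anticommuting complex structures, and the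
    equation for [F] cancels the connection terms in their covariant derivatives. *)
Lemma parallel_frame : exists (V : set M) (K1 K2 K3 : components M),
  [/\ V p0, canonical_local_basis sigma V K1 K2 K3,
      parallel_on g V K1, parallel_on g V K2 & parallel_on g V K3].
Proof.
have oO : open O by exact: open_chart_image.
have Oc : O (chart i p0) by exists p0.
have [r r0 [BO [F [sF Fc dF]]]] := flat_parallel_frame oO Oc sTh flat.
set c := chart i p0 in r0 BO sF Fc dF.
have oB : open (ball c r) by exact: ball_open.
(* Skewness of [Th] makes the derivative of [(F x)^T *m F x] vanish, and [F c] is the identity. *)
have FF x : ball c r x -> (F x)^T *m F x = 1%:M.
  have sFt := smooth_tr oB sF; have sK := smooth_mul oB sFt sF.
  move=> Bx; rewrite (zero_partial_ball_cst sK _ Bx); first by rewrite Fc trmx1 mulmx1.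
  move=> k z Bz; rewrite (partial_mul oB k sFt sF Bz) (partial_tr oB k sF Bz) dF//.
  have tr : (- (Th k z *m F z))^T = (F z)^T *m Th k z.
    have skew : (Th k z)^T = - Th k z.
      by apply/matrixP => a b; rewrite [LHS]mxE [RHS]mxE Th_skew//; exact: BO.
    have trN (A : 'M[R]_3) : (- A)^T = - A^T by apply/matrixP => a b; rewrite !mxE.
    by rewrite trN trmx_mul skew mulmxN opprK.
  by rewrite tr mulmxN mulmxA subrr.
pose V := W `&` [set q | cdom i q /\ ball c r (chart i q)].
have VW : V `<=` W by move=> q [].
have oV : open V.
  apply: openI => //; rewrite openE => q [cq Bq].
  have n1 : nbhs q (cdom i) by apply: open_nbhs_nbhs; split => //; exact: cdom_open.
  have n2 : nbhs q (chart i @^-1` ball c r).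
    by apply: (chart_continuous cq); apply: open_nbhs_nbhs.
  by apply: filterS (filterI n1 n2) => z [].
have Vp0 : V p0 by split=> //; split=> //; exact: ballxx.
pose X q := F (chart i q).
have sX i' : smooth_on (chart i' @` (cdom i' `&` V)) (X \o chart_inv i').
  have oVi := @open_chart_image _ _ M i' _ oV.
  apply: (smooth_comp oVi oB (A := F) (phi := chart i \o chart_inv i')) => //.
    by move=> _ [q [cq [_ [_ Bq]]] <-]; rewrite /= chartK.
  move=> n; apply: Ck_on_sub (@chart_transition _ _ M i' i n).
  by move=> _ [q [cq [_ [ciq _]]] <-]; exists q.
pose K a : components M := fun i' q => \sum_b X q b a *: J b i' q.
have eK a : endo_field V (K a) by exact: canonical_endo_combination.
pose o1 : 'I_3 := Ordinal (isT : (1 < 3)%N).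
(* The third structure is the product of the first two rather than the third column of [F], so the
   orientation of [F] need not be discussed. *)
pose K3 : components M := fun i' q => K ord0 i' q *m K o1 i' q.
have eK3 : endo_field V K3 by exact: endo_field_mul.
have XX q : V q -> (X q)^T *m X q = 1%:M by move=> [_ [_ Bq]]; exact: FF.
have rel i' q : V q -> cdom i' q ->
    (forall a, K a i' q *m K a i' q = - 1%:M) /\
    (forall a e, a != e -> K a i' q *m K e i' q = - (K e i' q *m K a i' q)).
  move=> Vq cq; apply: orthonormal_columns_quaternion (XX q Vq).
    by move=> b; apply: canonical_sqr => //; exact/WU/VW.
  by move=> b e; apply: canonical_anticomm => //; exact/WU/VW.
have qrel i' q : V q -> cdom i' q ->
    [/\ K ord0 i' q *m K ord0 i' q = - 1%:M, K o1 i' q *m K o1 i' q = - 1%:M,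
        K3 i' q *m K3 i' q = - 1%:M, K ord0 i' q *m K o1 i' q = K3 i' q
      & - (K o1 i' q *m K ord0 i' q) = K3 i' q].
  move=> Vq cq; have [sq ac] := rel i' q Vq cq.
  have ac01 : K ord0 i' q *m K o1 i' q = - (K o1 i' q *m K ord0 i' q) := ac ord0 o1 isT.
  split; [exact: sq|exact: sq| |by []|exact: esym ac01].
  rewrite /K3 [X in X *m _]ac01 mulNmx -mulmxA (mulmxA (K ord0 i' q)) sq.
  by rewrite mulNmx mul1mx mulmxN opprK sq.
have par a : forall k x, (chart i @` (cdom i `&` V)) x ->
    chart_nabla G k (K a i \o chart_inv i) x = 0.
  move=> k x Vx; have oVi := @open_chart_image _ _ M i _ oV.
  have VO y : (chart i @` (cdom i `&` V)) y -> O y.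
    by move=> [q [cq /VW Wq] <-]; exists q.
  have VB y : (chart i @` (cdom i `&` V)) y -> ball c r y.
    by move=> [q [cq [_ [_ Bq]]] <-].
  rewrite (chart_nabla_eq oVi (B := fun z => \sum_b F z b a *: Jc b z) G k Vx); last first.
    by move=> _ [q [cq _] <-]; rewrite /K /X /= chartK.
  have sFV : smooth_on (chart i @` (cdom i `&` V)) F.
    by move=> n; exact: Ck_on_sub VB (sF n).
  have sFe b : smooth_on (chart i @` (cdom i `&` V)) (fun z => F z b a).
    exact: (smooth_entry oVi b a sFV).
  have sJV b : smooth_on (chart i @` (cdom i `&` V)) (Jc b).
    by move=> n; exact: Ck_on_sub VO (smooth_chart_J b n).
  rewrite (chart_nabla_sum oVi G k (index_enum _) sFe sJV Vx) big_split/=.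
  have -> : \sum_b F x b a *: chart_nabla G k (Jc b) x =
      \sum_e (Th k x *m F x) e a *: Jc e x.
    under eq_bigr => b _ do rewrite (nabJ k b (VO x Vx)) scaler_sumr.
    rewrite exchange_big; apply: eq_bigr => e _ /=; rewrite mxE scaler_suml.
    by apply: eq_bigr => b _; rewrite scalerA mulrC.
  rewrite -big_split big1// => e _ /=; rewrite -scalerDl.
  rewrite (partial_entry k e a sFV Vx) dF; last exact: VB.
  by rewrite oppmxE addNr scale0r.
have parV A : endo_field V A ->
    (forall k x, (chart i @` (cdom i `&` V)) x -> chart_nabla G k (A i \o chart_inv i) x = 0) ->
    parallel_on g V A.
  move=> eA hA i' q u Vq cq; have [_ [ciq _]] := Vq.
  apply: (parallel_change_chart rg oV eA Vq ciq cq) => v.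
  rewrite nablaE// /along big1// => k _; rewrite hA ?scaler0//.
  by exists q.
exists V, (K ord0), (K o1), K3; split=> //.
- split; [exact: oV|by split; [exact: eK|exact: eK|exact: eK3]| |by []].
  move=> i' q Vq cq.
  have Uq : U0 q by exact/WU/VW.
  have Kmem a : K a i' q \in sigma i' q.
    by apply: memv_suml => b _; apply: memvZ; exact: canonical_mem.
  have K3mem : K3 i' q \in sigma i' q.
    (* The diagonal terms of the product are multiples of the identity, with total coefficient minus
       the inner product of two orthogonal columns; what remains are products [J b *m J e] with
       distinct indices, which stay in [sigma]. *)
    have E : K3 i' q = \sum_b \sum_(e | e != b) (X q b ord0 * X q e o1) *: (J b i' q *m J e
        i' q).
      have diag : \sum_b (X q b ord0 * X q b o1) *: (J b i' q *m J b i' q) = 0.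
        under eq_bigr => b _ do rewrite canonical_sqr//.
        rewrite -scaler_suml; have /matrixP/(_ ord0 o1) := XX q Vq.
        rewrite mxE [RHS]mxE /= => h; rewrite -[X in X *: _](_ : \sum_b (X q)^T ord0 b * X q
            b o1 = _).
          by rewrite h scale0r.
        by apply: eq_bigr => b _; rewrite mxE.
      transitivity (\sum_b (X q b ord0 * X q b o1) *: (J b i' q *m J b i' q)
        + \sum_b \sum_(e | e != b) (X q b ord0 * X q e o1) *: (J b i' q *m J e i' q)).
        2: by rewrite diag add0r.
      rewrite -big_split /K3 /K mulmx_suml; apply: eq_bigr => b _ /=.
      rewrite mulmx_sumr (bigD1 b)//= -scalemxAl -scalemxAr scalerA; congr (_ + _).
      by apply: eq_bigr => e _; rewrite -scalemxAl -scalemxAr scalerA.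
    rewrite E; apply: memv_suml => b _; apply: memv_suml => e eb; apply: memvZ.
    case: cb => _ _ _ /(_ i' q Uq cq)[h1 h2 h3 h4 h5].
    rewrite !tripleE; apply: triple_mul_mem => //; last by rewrite eq_sym.
    + by have := canonical_mem ord0 Uq cq; rewrite tripleE.
    + by have := canonical_mem o1 Uq cq; rewrite tripleE.
    + by have := canonical_mem ord_max Uq cq; rewrite tripleE.
  have [q1 q2 q3 q4 q5] := qrel i' q Vq cq.
  case: cb => _ _ /(_ i' q Uq cq) bs _.
  rewrite basisEfree (triple_free q1 q2 q3 q4 q5 m_gt0) /= -(size_basis bs) leqnn andbT.
  by apply/span_subvP => Y; rewrite !inE => /or3P[] /eqP ->.
- by apply: parV => //; exact: par.
- by apply: parV => //; exact: par.
- apply: parV => // k x Vx; have oVi := @open_chart_image _ _ M i _ oV.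
  have s1 := (eK ord0).2 i; have s2 := (eK o1).2 i.
  apply: etrans (chart_nablaM oVi G k s1 s2 Vx) _.
  by rewrite !par// mul0mx mulmx0 addr0.
Qed.

End parallel_frame.

(** In dimension zero all endomorphisms coincide, so three of them cannot form a free family. *)
Lemma quaternionic_dim_gt0 (R : realType) (n : nat) (N : manifold R n)
    (sigma' : endo_subspaces N) (q : N) : almost_quaternionic sigma' -> (0 < n)%N.
Proof.
move=> /(_ q)[V [K1 [K2 [K3 [Vq [_ _ bs _]]]]]]; have [j cj] := cdom_cover q.
case: n N sigma' q V K1 K2 K3 Vq bs j cj => [|//] N sigma' q V K1 K2 K3 Vq bs j cj.
have /basis_free/free_uniq := bs j q Vq cj.
by rewrite /= !inE [K1 j q]flatmx0 [K2 j q]flatmx0 eqxx.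
Qed.

Section submersion.
Variables (R : realType) (m n : nat).
Variables (M : manifold R m) (sigma : endo_subspaces M) (g : components M).
Variables (N : manifold R n) (sigma' : endo_subspaces N) (g' : components N).
Hypothesis qkM : quaternionic_kahler sigma g.
Hypothesis qkN : quaternionic_kahler sigma' g'.
Variable f : M -> N.
Hypothesis subf : quaternionic_submersion sigma g sigma' g' f.

Theorem quaternionic_submersion_hyperkahler : locally_hyperkahler sigma g.
Proof.
move=> p; have [[aqM rgM hermM] parM] := qkM; have [[aqN rgN _] _] := qkN.
have [[n_lt_m [cf sf] rkf isof] holf] := subf.
have n_gt0 : (0 < n)%N := quaternionic_dim_gt0 (f p) aqN.
have m_gt0 : (0 < m)%N := ltn_trans n_gt0 n_lt_m.
have [U0 [J1 [J2 [J3 [U0p cb]]]]] := aqM p.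
have oU0 : open U0 by case: cb.
have [Jiso1 Jiso2 Jiso3] := hermM U0 J1 J2 J3 cb.
have [i cp] := cdom_cover p; have [j cfp] := cdom_cover (f p).
(* On [W] both the canonical basis and the expression of [f] in the chart [j] are available, so all
   the chart-level hypotheses can be checked there. *)
pose W := U0 `&` f @^-1` cdom j.
have oW : open W.
  apply: openI => //; apply: open_comp => [q _|]; first exact: cf.
  exact: cdom_open.
have WU : W `<=` U0 by move=> q [].
have Wp : W p by [].
pose O := chart i @` (cdom i `&` W); pose Vj := chart j @` (cdom j `&` setT).
have oO : open O by exact: open_chart_image.
have oVj : open Vj by apply: open_chart_image; exact: openT.
pose phi := chart j \o f \o chart_inv i.
have phiE q : cdom i q -> phi (chart i q) = chart j (f q).
  by move=> cq; rewrite /phi /= chartK.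
have OV x : O x -> Vj (phi x).
  by move=> [q [cq [_ cfq]] <-]; exists (f q) => //; rewrite phiE.
have sphi : smooth_on O phi.
  by move=> r; apply: Ck_on_sub (sf i j r) => _ [q [cq [_ cfq]] <-]; exists q.
pose G := g i \o chart_inv i; pose Gp := g' j \o chart_inv j.
have sG : smooth_on O G by exact: metric_smooth.
have sGp : smooth_on Vj Gp by exact: metric_smooth.
have Gsym x : O x -> (G x)^T = G x.
  by move=> [q [cq _] <-]; rewrite /G chart_component//; exact: metric_sym.
have Gpos x : O x -> forall u : 'cV[R]_m, u != 0 -> 0 < (u^T *m G x *m u) 0 0.
  by move=> [q [cq _] <-] u u0; rewrite /G chart_component//; exact: metric_pos.
have Gunit x : O x -> G x \in unitmx by move=> Ox; exact: posdef_unitmx (Gpos x Ox).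
have Gpsym y : Vj y -> (Gp y)^T = Gp y.
  by move=> [q [cq _] <-]; rewrite /Gp chart_component//; exact: metric_sym.
have DE q : jac phi (chart i q) = differential f i j q by [].
have rankD x : O x -> \rank (jac phi x) = n.
  by move=> [q [cq [_ cfq]] <-]; rewrite DE rkf.
have isoD x : O x -> forall u v : 'cV[R]_m,
    (forall w : 'cV[R]_m, jac phi x *m w = 0 -> (u^T *m G x *m w) 0 0 = 0) ->
    (forall w : 'cV[R]_m, jac phi x *m w = 0 -> (v^T *m G x *m w) 0 0 = 0) ->
    ((jac phi x *m u)^T *m Gp (phi x) *m (jac phi x *m v)) 0 0 = (u^T *m G x *m v) 0 0.
  move=> [q [cq [_ cfq]] <-] u v; rewrite DE phiE// /G /Gp !chart_component// => hu hv.
  exact: isof.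
pose S x := invmx (G x) *m (jac phi x)^T.
have sD := smooth_jac oO sphi.
have sS : smooth_on O S.
  by apply: (smooth_mul oO); [exact: (smooth_invmx oO)|exact: (smooth_tr oO)].
have GS x : O x -> G x *m S x = (jac phi x)^T.
  by move=> Ox; rewrite /S mulmxA mulmxV ?mul1mx ?Gunit.
pose J := triple J1 J2 J3; pose Jc b := J b i \o chart_inv i.
have sJ b : smooth_on O (Jc b) by exact: (smooth_chart_J cb WU i b).
have JE b q : cdom i q -> Jc b (chart i q) = J b i q by exact: chart_component.
have JJ x b : O x -> Jc b x *m Jc b x = - 1%:M.
  by move=> [q [cq /WU Uq] <-]; rewrite JE//; exact: (canonical_sqr cb).
have JC x b c : O x -> b != c -> Jc b x *m Jc c x = - (Jc c x *m Jc b x).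
  by move=> [q [cq /WU Uq] <-] bc; rewrite !JE//; exact: (canonical_anticomm cb).
have Jiso x b : O x -> forall u v : 'cV[R]_m,
    ((Jc b x *m u)^T *m G x *m (Jc b x *m v)) 0 0 = (u^T *m G x *m v) 0 0.
  move=> [q [cq /WU Uq] <-] u v; rewrite JE// /G chart_component//.
  case: b => [[|[|[|[]//]]] hb]; rewrite /J /triple /=.
  - exact: Jiso1.
  - exact: Jiso2.
  - exact: Jiso3.
have Jhol x b : O x -> exists J', jac phi x *m Jc b x = J' *m jac phi x.
  move=> [q [cq [Uq cfq]] <-]; rewrite JE// DE.
  have [J' _ hJ'] := holf i j q cq cfq _ (canonical_mem cb b Uq cq).
  by exists J'.
have Jpar x k b : O x -> exists a : 'I_3 -> R,
    chart_nabla G k (Jc b) x = \sum_c a c *: Jc c x.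
  move=> [q [cq /WU Uq] <-].
  have memJ i' q' : U0 q' -> cdom i' q' -> J b i' q' \in sigma i' q'.
    exact: canonical_mem.
  have := parM U0 (J b) oU0 (canonical_endo cb b) memJ i q (delta_mx k 0) Uq cq.
  rewrite nablaE// along_delta => /(canonical_coef cb Uq cq)[a aE].
  by exists a; rewrite aE; apply: eq_bigr => c _; rewrite JE.
apply: (parallel_frame rgM cb oW WU m_gt0 Wp cp (Th := conn_form G Jc)).
- by move=> k; exact: (smooth_conn_form oO sG Gpos sJ).
- move=> k l x Ox.
  exact: (conn_form_flat oO oVj OV sphi sG Gsym Gpos sGp Gpsym rankD isoD sS GS
           sJ JJ JC Jiso Jhol Jpar).
- by move=> k x b c Ox; exact: (conn_form_skew G oO sJ JJ JC).
- by move=> k b x Ox; exact: (nabla_J JJ JC Jpar n_lt_m).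
Qed.

End submersion.

Theorem corollary5p5 (R : realType) (m n : nat)
    (M : manifold R m) (sigma : endo_subspaces M) (g : components M)
    (N : manifold R n) (sigma' : endo_subspaces N) (g' : components N) :
  quaternionic_kahler sigma g ->
  quaternionic_kahler sigma' g' ->
  ~ locally_hyperkahler sigma g ->
  ~ locally_hyperkahler sigma' g' ->
  ~ exists f : M -> N, quaternionic_submersion sigma g sigma' g' f.
Proof.
by move=> qkM qkN nhkM _ [f subf]; exact: nhkM (quaternionic_submersion_hyperkahler qkM qkN
    subf).
Qed.
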